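(* Let $p(x)\in\mathbb{Z}[x]$ be a polynomial of degree $d\ge 1$ with leading coefficient $\pm1$, with derivative $p'(x)$, and let $\mathcal{A}_{p(x)}=\mathbb{Z}[x]/(p(x))$. All isomorphisms below are of abelian groups. (i) $HH_i(\mathcal{A}_{p(x)})\cong\mathbb{Z}[x]/(p(x),p'(x))$ for $i$ odd, and $HH_i(\mathcal{A}_{p(x)})\cong\{[q(x)]\in\mathbb{Z}[x]/(p(x)) : q(x)p'(x)\text{ is divisible by }p(x)\}$ for $i$ even, $i\ge 2$. In both cases the $\mathbb{Z}$-rank of the group equals the degree of $\gcd(p(x),p'(x))$. (ii) In particular, for $p(x)=x^{m+1}$ ($m\ge 0$) and $\mathcal{A}_{m+1}=\mathbb{Z}[x]/(x^{m+1})$: $HH_i(\mathcal{A}_{m+1})\cong\mathbb{Z}_{m+1}\oplus\mathbb{Z}^m$ for odd $i$, $HH_i(\mathcal{A}_{m+1})\cong\mathbb{Z}^m$ for $i$ even, $i\ge 2$, and $HH_0(\mathcal{A}_{m+1})\cong\mathcal{A}_{m+1}\cong\mathbb{Z}^{m+1}$. (iii) For the $n$-gon $P_n$, $n\ge 2$, the graph cohomology $H^i_{\mathcal{A}_{p(x)}}(P_n)$ is given by $$H^{n-2i}_{\mathcal{A}_{p(x)}}(P_n)\cong\mathcal{A}_{p(x)}/(p'(x))\quad\text{for }1\le i\le\tfrac{n-1}{2},$$ $$H^{n-2i-1}_{\mathcal{A}_{p(x)}}(P_n)\cong\ker\bigl(\mathcal{A}_{p(x)}\xrightarrow{\;p'(x)\;}\mathcal{A}_{p(x)}\bigr)\quad\text{for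 }1\le i\le\tfrac{n-2}{2}.$$ Furthermore, $H^k_{\mathcal{A}_{p(x)}}(P_n)=0$ for $k\ge n-1$, and $H^0_{\mathcal{A}_{p(x)}}(P_n)$ is a free abelian group of rank $(d-1)^n+(-1)^n(d-1)$ if $n$ is even, and of rank $(d-1)^n+(-1)^n(d-1)+\operatorname{rank}\bigl(H^1_{\mathcal{A}_{p(x)}}(P_n)\bigr)$ if $n$ is odd. (Here $(d-1)^n+(-1)^n(d-1)$ is the Euler characteristic of $\{H^i_{\mathcal{A}_{p(x)}}(P_n)\}$.)
   Context: $\mathbb{Z}_{m+1}=\mathbb{Z}/(m+1)\mathbb{Z}$; the map labelled $p'(x)$ is multiplication by $p'(x)$; the gcd is taken in $\mathbb{Q}[x]$. Tensor products are over $\mathbb{Z}$. $HH_r(\mathcal{A})$ denotes the $r$-th Hochschild homology of the ring $\mathcal{A}$ over $\mathbb{Z}$ with coefficients in $\mathcal{A}$. **Graph cohomology of a polygon over a commutative ring $\mathcal{A}$.** $P_n$ is the cycle with $n$ vertices and $n$ edges (two vertices joined by two parallel edges if $n=2$); $E$ is its edge set. For $s\subset E$ let $[P_n:s]$ be the subgraph with all vertices and edge set $s$, and $k(s)$ its number of connected components. Put $\Phi(s)=\mathcal{A}^{\otimes k(s)}$, one tensor factor attached to each component. For $e\in E\setminus s$ define $\Phi(s\subset s\cup e):\Phi(s)\to\Phi(s\cup e)$ as follows: if $e$ joins two different components of $[P_n:s]$, the map multiplies the corresponding two factors (the product is attached to the merged component) and leaves the others unchanged; if both endpoints of $e$ lie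 in the same component of $[P_n:s]$, the map is the identity. Set $C^i=\bigoplus_{|s|=i}\Phi(s)$ with differential which on $\Phi(s)$ is $d=\sum_{e\notin s}(-1)^{t(s,e)}\Phi(s\subset s\cup e)$, where $E$ is given a fixed linear ordering and $t(s,e)$ is the number of elements of $s$ smaller than $e$. The $i$-th cohomology of this complex is $H^i_{\mathcal{A}}(P_n)$. The Euler characteristic is $\sum_i(-1)^i\operatorname{rank}H^i_{\mathcal{A}}(P_n)$. *)

(* Defs.v *)
From HB Require Import structures.
From mathcomp Require Import all_boot all_order all_algebra.
From mathcomp Require Import boolp.
From mathcomp.multinomials Require Import freeg.

Set Implicit Arguments.
Unset Strict Implicit.
Unset Printing Implicit Defensive.

Import GRing.Theory.

Local Open Scope ring_scope.
Local Open Scope quotient_scope.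

Definition zmod_iso (V W : zmodType) : Prop :=
  exists f : {additive V -> W}, bijective f.

Notation "V \simeq W" := (zmod_iso V W) (at level 70, no associativity).

Definition zindep (V : zmodType) r (v : 'I_r -> V) : Prop :=
  forall c : 'I_r -> int, \sum_(i < r) v i *~ c i = 0 -> forall i, c i = 0.

(* The rank is the maximal number of Z-linearly independent elements; as a
   relation, it fails for every r when V has infinite rank. *)
Definition has_rank (V : zmodType) (r : nat) : Prop :=
  (exists v : 'I_r -> V, zindep v) /\ (forall v : 'I_r.+1 -> V, ~ zindep v).

Section Subgroup.
Variables (V : zmodType) (S : zmodClosed V).

Record subgroup := Subgroup { sg_val :> V; _ : sg_val \in S }.

HB.instance Definition _ := [isSub for sg_val].
HB.instance Definition _ := [Choice of subgroup by <:].
HB.instance Definition _ := [SubChoice_isSubZmodule of subgroup by <:].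

End Subgroup.

Section KernelHomology.
Variables (U V W : zmodType) (f : {additive U -> V}) (g : {additive V -> W}).

Definition in_ker : {pred V} := fun x => g x == 0.

Fact in_ker_zmod_closed : zmod_closed in_ker.
Proof.
by split=> [|x y]; rewrite !unfold_in ?raddf0 // raddfB => /eqP-> /eqP->; rewrite subrr.
Qed.
HB.instance Definition _ := GRing.isZmodClosed.Build V in_ker in_ker_zmod_closed.

Definition ker : zmodType := subgroup in_ker.

Definition in_im : {pred ker} := fun x => `[< exists y : U, f y = sg_val x >].

Fact in_im_zmod_closed : zmod_closed in_im.
Proof.
split=> [|x y]; rewrite !unfold_in; first by apply/asboolP; exists 0; rewrite !raddf0.
move=> /asboolP[a fa] /asboolP[b fb]; apply/asboolP; exists (a - b).
by rewrite raddfB fa fb.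
Qed.
HB.instance Definition _ := GRing.isZmodClosed.Build ker in_im in_im_zmod_closed.

(* The homology at V of U --f--> V --g--> W.  When g \o f = 0, as for all the
   complexes below, in_im is the whole image of f. *)
Definition homology : zmodType := Quotient.quot in_im.

End KernelHomology.

Section QuotientMap.
Variables (V W : zmodType) (I : zmodClosed V) (J : zmodClosed W).
Variables (F : {additive V -> W}) (FIJ : forall x, x \in I -> F x \in J).
Local Notation piI := (\pi_(Quotient.quot I)).
Local Notation piJ := (\pi_(Quotient.quot J)).

Definition quot_map (x : Quotient.quot I) : Quotient.quot J := piJ (F (repr x)).

Lemma quot_map_pi x : quot_map (piI x) = piJ (F x).
Proof.
apply/eqP; rewrite /quot_map -Quotient.idealrBE -raddfB; apply: FIJ.
by rewrite Quotient.idealrBE reprK.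
Qed.

Fact quot_map_is_zmod_morphism : zmod_morphism quot_map.
Proof.
move=> x y; rewrite -[x]reprK -[y]reprK -[_ - _](raddfB piI) !quot_map_pi.
by rewrite !raddfB.
Qed.

End QuotientMap.

Arguments quot_map {V W} I J F x.
Arguments quot_map_pi {V W I J F} FIJ x.
Arguments quot_map_is_zmod_morphism {V W I J F} FIJ.

Section IdealQuotient.
Variables (R : comPzRingType) (s : seq R).

Definition in_ideal : {pred R} :=
  fun x => `[< exists c : 'I_(size s) -> R, x = \sum_i c i * s`_i >].

Fact in_ideal_zmod_closed : zmod_closed in_ideal.
Proof.
split=> [|x y]; rewrite !unfold_in.
  by apply/asboolP; exists (fun=> 0); rewrite big1 // => i _; rewrite mul0r.
move=> /asboolP[c ->] /asboolP[c' ->]; apply/asboolP; exists (fun i => c i - c' i).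
by rewrite -sumrB; apply: eq_bigr => i _; rewrite mulrBl.
Qed.
HB.instance Definition _ := GRing.isZmodClosed.Build R in_ideal in_ideal_zmod_closed.

Fact in_ideal_mul a x : x \in in_ideal -> a * x \in in_ideal.
Proof.
rewrite !unfold_in => /asboolP[c ->]; apply/asboolP; exists (fun i => a * c i).
by rewrite mulr_sumr; apply: eq_bigr => i _; rewrite mulrA.
Qed.

(* The library only provides the ring structure for proper ideals. *)
Definition ring_quot := Quotient.quot in_ideal.

HB.instance Definition _ := GRing.Zmodule.on ring_quot.
HB.instance Definition _ := EqQuotient.on ring_quot.

Definition rq_one : ring_quot := \pi_ring_quot 1.
Definition rq_mul (x y : ring_quot) : ring_quot := \pi_ring_quot (repr x * repr y).

Lemma rq_mul_pi x y : rq_mul (\pi x) (\pi y) = \pi_ring_quot (x * y).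
Proof.
apply/eqP; rewrite /rq_mul -Quotient.idealrBE.
set x' := repr _; set y' := repr _.
have -> : x' * y' - x * y = x' * (y' - y) + y * (x' - x).
  by rewrite !mulrBr (mulrC y x') addrA subrK (mulrC y x).
by rewrite rpredD // in_ideal_mul // Quotient.idealrBE reprK.
Qed.

Fact rq_mulA : associative rq_mul.
Proof. by move=> x y z; rewrite -[x]reprK -[y]reprK -[z]reprK !rq_mul_pi mulrA. Qed.
Fact rq_mulC : commutative rq_mul.
Proof. by move=> x y; rewrite -[x]reprK -[y]reprK !rq_mul_pi mulrC. Qed.
Fact rq_mul1 : left_id rq_one rq_mul.
Proof. by move=> x; rewrite -[x]reprK rq_mul_pi mul1r. Qed.
Fact rq_mulDl : left_distributive rq_mul +%R.
Proof.
move=> x y z; rewrite -[x]reprK -[y]reprK -[z]reprK -[_ + _]raddfD !rq_mul_pi.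
by rewrite -[RHS]raddfD mulrDl.
Qed.
HB.instance Definition _ :=
  GRing.Zmodule_isComPzRing.Build ring_quot rq_mulA rq_mulC rq_mul1 rq_mulDl.

Definition rclass (x : R) : ring_quot := \pi_ring_quot x.

Fact rclass_is_zmod_morphism : zmod_morphism rclass.
Proof. exact: raddfB. Qed.
HB.instance Definition _ :=
  GRing.isZmodMorphism.Build R ring_quot rclass rclass_is_zmod_morphism.

Fact rclass_is_monoid_morphism : monoid_morphism rclass.
Proof. by split=> // x y; rewrite /rclass -rq_mul_pi. Qed.
HB.instance Definition _ :=
  GRing.isMonoidMorphism.Build R ring_quot rclass rclass_is_monoid_morphism.

End IdealQuotient.

Definition poly_quot (p : {poly int}) : comPzRingType := ring_quot [:: p].

Section DerivativeAnnihilator.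
Variable p : {poly int}.

Definition in_deriv_ann : {pred poly_quot p} := fun a =>
  `[< exists2 q : {poly int}, a = rclass [:: p] q & exists u, q * p^`() = u * p >].

Fact in_deriv_ann_zmod_closed : zmod_closed in_deriv_ann.
Proof.
split=> [|x y]; rewrite !unfold_in.
  by apply/asboolP; exists 0; [rewrite raddf0 | exists 0; rewrite !mul0r].
move=> /asboolP[q -> [u hu]] /asboolP[r -> [v hv]]; apply/asboolP.
by exists (q - r); [rewrite raddfB | exists (u - v); rewrite !mulrBl hu hv].
Qed.
HB.instance Definition _ :=
  GRing.isZmodClosed.Build (poly_quot p) in_deriv_ann in_deriv_ann_zmod_closed.

Definition deriv_ann : zmodType := subgroup in_deriv_ann.

End DerivativeAnnihilator.

Section Tensor.
Variables (A : zmodType) (I : finType).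

Definition upd (a : {ffun I -> A}) (i : I) (u : A) : {ffun I -> A} :=
  [ffun k => if k == i then u else a k].

Inductive multilinear_rel : {freeg {ffun I -> A} / int} -> Prop :=
| MLgen a i u v :
    multilinear_rel (<< upd a i (u + v) >> - << upd a i u >> - << upd a i v >>)
| ML0 : multilinear_rel 0
| MLsub x y : multilinear_rel x -> multilinear_rel y -> multilinear_rel (x - y).

Definition in_mlrel : {pred {freeg {ffun I -> A} / int}} :=
  fun x => `[< multilinear_rel x >].

Fact in_mlrel_zmod_closed : zmod_closed in_mlrel.
Proof.
split=> [|x y]; rewrite !unfold_in; first by apply/asboolP; exact: ML0.
by move=> /asboolP hx /asboolP hy; apply/asboolP; exact: MLsub.
Qed.
HB.instance Definition _ :=
  GRing.isZmodClosed.Build {freeg {ffun I -> A} / int} in_mlrel in_mlrel_zmod_closed.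

(* The tensor product over Z of copies of A indexed by I. *)
Definition tensor : zmodType := Quotient.quot in_mlrel.

Definition pure (a : {ffun I -> A}) : tensor := \pi_(Quotient.quot in_mlrel) << a >>.

End Tensor.

Section TensorMap.
Variables (A : comPzRingType) (I J : finType) (phi : I -> J).

Definition merge (a : {ffun I -> A}) : {ffun J -> A} :=
  [ffun j => \prod_(i | phi i == j) a i].

Definition free_merge : {freeg {ffun I -> A} / int} -> {freeg {ffun J -> A} / int} :=
  fglift (fun a => << merge a >>).

HB.instance Definition _ := GRing.isZmodMorphism.Build _ _ free_merge
  (lift_is_additive (fun a => << merge a >>)).

Lemma merge_upd a i u :
  merge (upd a i u) =
  upd (merge a) (phi i) (u * \prod_(k | (phi k == phi i) && (k != i)) a k).
Proof.
apply/ffunP => j; rewrite !ffunE; case: eqP => [->|ji].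
  rewrite (bigD1 i) //= ffunE eqxx; congr (_ * _).
  by apply: eq_bigr => k /andP[_ /negPf ki]; rewrite ffunE ki.
by apply: eq_bigr => k /eqP kj; rewrite ffunE; case: eqP => // ki; case: ji; rewrite -kj ki.
Qed.

Fact free_merge_mlrel x : x \in @in_mlrel A I -> free_merge x \in @in_mlrel A J.
Proof.
rewrite !unfold_in => /asboolP h; apply/asboolP.
elim: h => [a i u v||y z _ hy _ hz].
- rewrite !raddfB /= /free_merge !liftU !scale1r !merge_upd mulrDl; exact: MLgen.
- by rewrite raddf0; exact: ML0.
- by rewrite raddfB; exact: MLsub.
Qed.

(* The map A^{(x) I} -> A^{(x) J} which multiplies together the factors with
   indices in the same fibre of phi (and inserts 1 over an empty fibre). *)
Definition tensor_map : tensor A I -> tensor A J :=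
  quot_map (@in_mlrel A I) (@in_mlrel A J) free_merge.

HB.instance Definition _ := GRing.isZmodMorphism.Build (tensor A I) (tensor A J)
  tensor_map (quot_map_is_zmod_morphism free_merge_mlrel).

Lemma tensor_map_pure a : tensor_map (pure a) = pure (merge a).
Proof. by rewrite /tensor_map /pure (quot_map_pi free_merge_mlrel) /= /free_merge liftU scale1r. Qed.

End TensorMap.

Section Hochschild.
Variable A : comPzRingType.

(* For i <= n this identifies i and i.+1; for i = n.+1 it identifies n.+1 and 0. *)
Definition face_index n (i k : 'I_n.+2) : 'I_n.+1 :=
  inord ((if k <= i then k : nat else k.-1) %% n.+1)%N.

(* d_i (a_0 (x) ... (x) a_{n+1}) = a_0 (x) ... (x) a_i a_{i+1} (x) ... (x) a_{n+1}
   for i <= n, and d_{n+1} (...) = a_{n+1} a_0 (x) a_1 (x) ... (x) a_n;  the order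
   of the factors in a product is irrelevant since A is commutative. *)
Definition hoch_face n (i : 'I_n.+2) : tensor A 'I_n.+2 -> tensor A 'I_n.+1 :=
  tensor_map (face_index i).

Definition hoch_diff n (x : tensor A 'I_n.+2) : tensor A 'I_n.+1 :=
  \sum_(i < n.+2) hoch_face i x *~ (-1) ^+ i.

Fact hoch_diff_is_zmod_morphism n : zmod_morphism (@hoch_diff n).
Proof.
move=> x y; rewrite /hoch_diff -sumrB; apply: eq_bigr => i _.
by rewrite /hoch_face raddfB mulrzBl.
Qed.
HB.instance Definition _ n := GRing.isZmodMorphism.Build
  (tensor A 'I_n.+2) (tensor A 'I_n.+1) (@hoch_diff n) (@hoch_diff_is_zmod_morphism n).

Definition HH (r : nat) : zmodType :=
  match r with
  | 0 => homology (@hoch_diff 0) (\0 : tensor A 'I_1 -> tensor A 'I_1)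
  | r'.+1 => homology (@hoch_diff r'.+1) (@hoch_diff r')
  end.

End Hochschild.

Section DirectSum.
Variables (I : finType) (V : I -> zmodType).
Local Notation sumV := {dffun forall i, V i}.

Definition ds_zero : sumV := [ffun i => 0 : V i].
Definition ds_opp (x : sumV) : sumV := [ffun i => - x i].
Definition ds_add (x y : sumV) : sumV := [ffun i => x i + y i].

Fact ds_addA : associative ds_add.
Proof. by move=> x y z; apply/ffunP => i; rewrite !ffunE addrA. Qed.
Fact ds_addC : commutative ds_add.
Proof. by move=> x y; apply/ffunP => i; rewrite !ffunE addrC. Qed.
Fact ds_add0 : left_id ds_zero ds_add.
Proof. by move=> x; apply/ffunP => i; rewrite !ffunE add0r. Qed.
Fact ds_addN : left_inverse ds_zero ds_opp ds_add.
Proof. by move=> x; apply/ffunP => i; rewrite !ffunE addNr. Qed.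
HB.instance Definition _ :=
  GRing.isZmodule.Build sumV ds_addA ds_addC ds_add0 ds_addN.

End DirectSum.

Section Polygon.
Variables (A : comPzRingType) (n : nat).

(* Vertices and edges of P_n are both 'I_n; the edge e joins e and e + 1 mod n.
   For n = 2 this gives two parallel edges. *)
Definition joins (e : 'I_n) : rel 'I_n := fun u v =>
  (u == e) && (v == ordS e) || (v == e) && (u == ordS e).

Definition adj (s : {set 'I_n}) : rel 'I_n := fun u v => [exists e in s, joins e u v].

Fact adj_connect_sym s : connect_sym (adj s).
Proof.
apply: sym_connect_sym => u v; apply: eq_existsb => e.
by rewrite /joins orbC.
Qed.

(* A connected component of [P_n : s] is given by its canonical representative. *)
Definition component (s : {set 'I_n}) : finType := {v : 'I_n | roots (adj s) v}.

(* For s \subset t, this maps a component of [P_n : s] to the component of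
   [P_n : t] which contains it. *)
Definition comp_map (s t : {set 'I_n}) (c : component s) : component t :=
  exist _ (fingraph.root (adj t) (val c)) (roots_root (adj_connect_sym t) (val c)).

Definition Phi (s : {set 'I_n}) : zmodType := tensor A (component s).

(* If s and t = s \cup e have the same components, comp_map is the identity
   bijection, and hence so is Phi_map. *)
Definition Phi_map (s t : {set 'I_n}) : Phi s -> Phi t := tensor_map (@comp_map s t).

Definition cochain (i : nat) : zmodType :=
  {dffun forall s : {s : {set 'I_n} | #|s| == i}, Phi (val s)}.

Definition edge_pos (s : {set 'I_n}) (e : 'I_n) : nat := #|[set e' in s | e' < e]%N|.

(* The summand of d x indexed by t: the inner sum has one term, indexed by the
   unique e with t = s \cup e, when s \subset t, and none otherwise. *)
Definition graph_diff i (x : cochain i) : cochain i.+1 :=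
  [ffun t : {t : {set 'I_n} | #|t| == i.+1} =>
     \sum_(s : {s : {set 'I_n} | #|s| == i})
      \sum_(e | (e \notin val s) && (e |: val s == val t))
       Phi_map (val t) (x s) *~ (-1) ^+ edge_pos (val s) e].

Fact graph_diff_is_zmod_morphism i : zmod_morphism (@graph_diff i).
Proof.
move=> x y; apply/ffunP => t; rewrite !ffunE -sumrB; apply: eq_bigr => s _.
by rewrite -sumrB; apply: eq_bigr => e _; rewrite !ffunE /Phi_map raddfB mulrzBl.
Qed.
HB.instance Definition _ i := GRing.isZmodMorphism.Build
  (cochain i) (cochain i.+1) (@graph_diff i) (@graph_diff_is_zmod_morphism i).

Definition polygon_cohomology (i : nat) : zmodType :=
  match i with
  | 0 => homology (\0 : cochain 0 -> cochain 0) (@graph_diff 0)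
  | i'.+1 => homology (@graph_diff i') (@graph_diff i'.+1)
  end.

End Polygon.

(* Main.v *)
(** With A = Z[x]/(p) and V_n the n-fold tensor power of A, let L_n be the set of
elements of V_n killed by all products of two consecutive factors, and M_n the
set of those also killed by the product of the last factor with the first one.
Normalising the Hochschild complex with its degeneracies gives
HH_r = M_(r+1) / d L_(r+2), where d multiplies the last factor into the first.
Splitting the multiplications along a path of edges concentrates every
k-cocycle of the polygon on the set of the last k edges, and gives the same
quotient: H^k(P_n) = M_(n-k) / d L_(n-k+1) for 0 < k < n - 1, and 0 for k >= n - 1,
while H^0(P_n) = M_n.

Write D(a,b) = (p(a) - p(b)) / (a - b), and let y and w be the first and the last
variable of V_n = Z[x_1, .., x_n] / (p(x_1), .., p(x_n)).  Put
  alpha_n = {v in L_n | (y - w) v = 0} / D(w,y) L_n,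
  beta_n  = {v in L_n | D(w,y) v = 0} / (w - y) L_n.
If z is one more variable, v |-> v D(z,y) induces beta_n = alpha_(n+1) and
v |-> v (z - w) induces alpha_n = beta_(n+1); moreover beta_n = M_n / d L_(n+1).
Hence the groups are 2-periodic, and alpha_1 = A/(p'), beta_1 = ker p'.

The ranks of M_n follow from rank L_n = d (d-1)^(n-1) by induction along
0 -> M_n -> L_n -> M_(n-1) -> beta_(n-1) -> 0, and M_n is free as a subgroup of V_n. *)
Require Import Defs.
From HB Require Import structures.
From mathcomp Require Import all_boot all_order all_algebra.
From mathcomp Require Import boolp.
From mathcomp.multinomials Require Import freeg.
From mathcomp Require Import zify ring.

Set Implicit Arguments.
Unset Strict Implicit.
Unset Printing Implicit Defensive.

Import Order.TTheory GRing.Theory Num.Theory.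
Local Open Scope ring_scope.

(** * Subquotients of abelian groups and their ranks *)

(** The subquotients carry torsion, so nothing can be checked over a field, and [V_n] has zero
    divisors, so dividing by [z - w] or [D(z,y)] there makes no sense. The way out is to lift
    everything to the nested polynomial ring Z[x_1]..[x_n]. If [J] is the ideal of relations among n
    variables, then n + 1 variables satisfy [J[X] + (P)], and [L] has a similar recursive
    description. Both [X - w] and [D(X,y)] are monic in the new variable [X], so they can be
    cancelled modulo [J] by comparing leading coefficients, as long as degrees stay below that of
    [P]. One abstract step, for ideals [J] inside [L] of any commutative ring, then gives the two
    periodicity isomorphisms and the rank of [L]. This is also where the leading coefficient of p
    has to be a unit.

    For the polygon, the groups Phi(s) differ from one edge set to the next. All of them are
    quotients of the full tensor power, so cochains are lifted to functions into this single group
    and compared modulo the kernels.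

    Accordingly all groups are handled through representatives, by predicates [Z] and [D] on an
    ambient group. *)

Definition subg (V : zmodType) (D : V -> Prop) :=
  D 0 /\ forall x y, D x -> D y -> D (x - y).

Section Subg.
Variables (V : zmodType) (D : V -> Prop) (hD : subg D).

Lemma subg0 : D 0. Proof. by case: hD. Qed.
Lemma subgB x y : D x -> D y -> D (x - y). Proof. by case: hD => _; apply. Qed.
Lemma subgN x : D x -> D (- x).
Proof. by move=> dx; rewrite -sub0r; apply: subgB => //; apply: subg0. Qed.
Lemma subgD x y : D x -> D y -> D (x + y).
Proof. by move=> dx dy; rewrite -[y]opprK; apply: subgB => //; apply: subgN. Qed.
Lemma subgDr x y : D y -> D (x + y) -> D x.
Proof. by move=> dy dxy; rewrite -[x](addrK y); apply: subgB. Qed.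
Lemma subgDl x y : D x -> D (x + y) -> D y.
Proof. by rewrite addrC; apply: subgDr. Qed.
Lemma subg_sum (I : Type) (r : seq I) (P : pred I) (F : I -> V) :
  (forall i, P i -> D (F i)) -> D (\sum_(i <- r | P i) F i).
Proof. by move=> h; apply: (big_ind D) => //; [apply: subg0|apply: subgD]. Qed.
Lemma subgMn x n : D x -> D (x *+ n).
Proof.
by move=> dx; elim: n => [|n IH]; [rewrite mulr0n; apply: subg0|rewrite mulrS; apply: subgD].
Qed.
Lemma subgMz x k : D x -> D (x *~ k).
Proof. by case: k => n dx; rewrite ?NegzE ?mulrNz; [|apply: subgN]; apply: subgMn. Qed.

End Subg.

Section ZmodIso.
Variables V W : zmodType.

Lemma zmod_isoI (F : V -> W) : zmod_morphism F -> injective F ->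
  (forall y, exists x, F x = y) -> V \simeq W.
Proof.
move=> FB Finj Fsurj.
pose m := GRing.isZmodMorphism.Build _ _ F FB.
pose F' : {additive V -> W} := HB.pack F m.
exists F'; pose g y := sval (cid (Fsurj y)).
have gK y : F (g y) = y by rewrite /g; case: cid.
by exists g => // x; apply: Finj; rewrite gK.
Qed.

End ZmodIso.

Lemma zmod_iso_sym (V W : zmodType) : V \simeq W -> W \simeq V.
Proof.
case=> f [g fK gK]; apply: (@zmod_isoI _ _ g) => [x y||x].
- by rewrite -[x]gK -[y]gK -raddfB !fK.
- exact: can_inj gK.
- by exists (f x).
Qed.

Lemma zmod_iso_trans (U V W : zmodType) : U \simeq V -> V \simeq W -> U \simeq W.
Proof.
case=> f bf [g bg]; exists (g \o f : {additive U -> W}); exact: bij_comp.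
Qed.

(* G is Z / (Z /\ D): here and below D need not be contained in Z. *)
Definition presents (G V : zmodType) (Z D : V -> Prop) := exists f : V -> G,
  [/\ forall x y, Z x -> Z y -> f (x - y) = f x - f y,
      forall g, exists2 x, Z x & f x = g
    & forall x, Z x -> (f x = 0 <-> D x)].

(** For subgroups, these conditions make [h] induce an isomorphism of the two subquotients. They
    speak of representatives only, so each isomorphism below is verified by polynomial
    identities. *)
Definition subq_iso (V W : zmodType) (h : V -> W) (Z D : V -> Prop) (Z' D' : W -> Prop) :=
  [/\ forall x y, h (x - y) = h x - h y,
      forall x, Z x -> Z' (h x),
      forall x, Z x -> (D x <-> D' (h x))
    & forall y, Z' y -> exists2 x, Z x & D' (y - h x)].

(** The family is independent modulo [D] and spans [Z] up to torsion; having both halves at hand is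
    what makes ranks add up along a tower of subgroups. *)
Definition subq_rank (V : zmodType) (Z D : V -> Prop) (r : nat) :=
  exists (I : finType) (v : I -> V),
  [/\ #|I| = r, forall i, Z (v i),
      forall c : I -> int, D (\sum_i v i *~ c i) -> forall i, c i = 0
    & forall x, Z x -> exists2 k : int, k != 0 & exists c : I -> int,
        D (x *~ k - \sum_i v i *~ c i)].

Section Presents.
Variables (G V : zmodType) (Z D : V -> Prop) (hZ : subg Z).

Lemma presents_iso (G' : zmodType) : presents G Z D -> presents G' Z D -> G \simeq G'.
Proof.
move=> [f [fB fsurj fD]] [f' [f'B f'surj f'D]].
pose s g := s2val (cid2 (fsurj g)).
have sZ g : Z (s g) by rewrite /s; case: cid2.
have sK g : f (s g) = g by rewrite /s; case: cid2.
have key x y : Z x -> Z y -> f x = f y <-> f' x = f' y.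
  move=> zx zy; have zxy := subgB hZ zx zy; split=> e; apply/eqP; rewrite -subr_eq0; apply/eqP.
    by rewrite -f'B //; apply/f'D => //; apply/fD => //; rewrite fB // e subrr.
  by rewrite -fB //; apply/fD => //; apply/f'D => //; rewrite f'B // e subrr.
apply: (@zmod_isoI _ _ (f' \o s)) => [x y|x y|y] /=.
- by rewrite -f'B //; apply/key => //; [apply: subgB|rewrite fB // !sK].
- by move/key; rewrite !sK; apply.
- by have [x zx <-] := f'surj y; exists (f x); apply/key => //; rewrite sK.
Qed.

(** Composition with [h] transports a presentation backwards, so an inverse of [h] never has to be
    constructed. *)
Lemma presents_pull (U : zmodType) (h : U -> V) (Y C : U -> Prop) :
  subq_iso h Y C Z D -> presents G Z D -> presents G Y C.
Proof.
move=> [hB hYZ hCD hs] [f [fB fsurj fD]]; exists (f \o h); split=> [x y yx yy|g|x yx] /=.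
- by rewrite hB fB //; apply: hYZ.
- have [z zz <-] := fsurj g; have [x yx dx] := hs z zz; exists x => //.
  have zh := hYZ x yx; apply/eqP; rewrite eq_sym -subr_eq0 -fB //; apply/eqP/fD => //.
  exact: subgB.
- by rewrite hCD // -fD //; apply: hYZ.
Qed.

Lemma presents_of_iso (G' : zmodType) : presents G Z D -> G \simeq G' -> presents G' Z D.
Proof.
move=> [f [fB fsurj fD]] [F [F' FK F'K]]; exists (F \o f); split=> [x y zx zy|g|x zx] /=.
- by rewrite fB // raddfB.
- by have [x zx fx] := fsurj (F' g); exists x => //; rewrite fx F'K.
- by rewrite -fD //; split=> [e|->]; [rewrite -[f x]FK e -[LHS]FK F'K; apply: (can_inj FK);
  rewrite F'K raddf0|rewrite raddf0].
Qed.

End Presents.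

Lemma presents_ext (G V : zmodType) (Z D Z' D' : V -> Prop) :
  (forall x, Z x <-> Z' x) -> (forall x, Z x -> D x <-> D' x) ->
  presents G Z D -> presents G Z' D'.
Proof.
move=> eZ eD [f [fB fs fD]]; exists f; split=> [x y /eZ zx /eZ zy|g|x /eZ zx].
- exact: fB.
- by have [x /eZ zx <-] := fs g; exists x.
- by rewrite fD // eD.
Qed.

Lemma presents_homology (U V W : zmodType) (f : {additive U -> V}) (g : {additive V -> W}) :
  presents (homology f g) (fun x => g x = 0) (fun x => exists u, f u = x).
Proof.
pose Q := Quotient.quot (@in_im _ _ _ f g).
(* [presents] constrains [F] on the kernel of [g] only; the value 0 elsewhere is a default. *)
pose F (x : V) : homology f g :=
  match pselect (g x = 0) with
  | left e => (\pi_Q (Subgroup (introT eqP e : x \in in_ker g)))%qT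
  | right _ => 0
  end.
have FE x (e : x \in in_ker g) : F x = (\pi_Q (Subgroup e))%qT.
  rewrite /F; case: pselect => [e'|]; last by case; apply/eqP.
  by congr (\pi_Q _)%qT; apply: val_inj.
have Z_ x : g x = 0 -> x \in in_ker g by move/eqP.
exists F; split=> [x y gx gy|q|x gx].
- have gxy : g (x - y) = 0 by rewrite raddfB gx gy subrr.
  rewrite (FE _ (Z_ _ gx)) (FE _ (Z_ _ gy)) (FE _ (Z_ _ gxy)) -raddfB.
  by congr (\pi_Q _)%qT; apply: val_inj.
- case E: (repr q) => [x kx]; exists x; first by apply/eqP.
  by rewrite (FE _ kx) -E reprK.
- rewrite (FE _ (Z_ _ gx)).
  have -> : (0 : homology f g) = (\pi_Q 0)%qT by rewrite raddf0.
  split=> [/eqP|h]; [|apply/eqP]; rewrite -Quotient.idealrBE subr0 unfold_in.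
    by move=> /asboolP.
  by apply/asboolP.
Qed.

Lemma rat_family_int (I : finType) (u : I -> rat) :
  exists2 k : int, k != 0 & exists c : I -> int, forall i, u i * k%:~R = (c i)%:~R.
Proof.
exists (\prod_i denq (u i)); first by apply/prodf_neq0 => i _; apply: denq_neq0.
exists (fun i => numq (u i) * \prod_(j | j != i) denq (u j)) => i.
rewrite (bigD1 i) //= !intrM mulrA; congr (_ * _).
by rewrite -{1}[u i]divq_num_den divfK // intr_eq0 denq_neq0.
Qed.

(** The rational matrix has rank at most [#|J|], so some nonzero row is killed by it; clearing
    denominators makes this row integral. *)
Lemma int_dependency (I J : finType) (M : I -> J -> int) : (#|J| < #|I|)%N ->
  exists2 c : I -> int, (exists i, c i != 0) & forall j, \sum_i c i * M i j = 0.
Proof.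
move=> ltJI.
pose A : 'M[rat]_(#|I|, #|J|) := \matrix_(a, b) (M (enum_val a) (enum_val b))%:~R.
have : kermx A != 0.
  rewrite -mxrank_eq0 mxrank_ker subn_eq0 -ltnNge.
  exact: leq_ltn_trans (rank_leq_col A) ltJI.
case/rowV0Pn => u /sub_kermxP uA /rV0Pn[a ua].
have [k k0 [c hc]] := rat_family_int (fun i => u 0 (enum_rank i)).
exists c => [|j].
  exists (enum_val a); rewrite -(intr_eq0 rat) -hc enum_valK mulf_neq0 //.
  by rewrite intr_eq0.
apply/eqP; rewrite -(intr_eq0 rat) rmorph_sum /=.
have /rowP/(_ (enum_rank j)) := uA; rewrite !mxE => uAj.
rewrite (eq_bigr (fun i => k%:~R * (u 0 (enum_rank i) * (M i j)%:~R))); last first.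
  by move=> i _; rewrite intrM -hc; ring.
rewrite -mulr_sumr (reindex _ (onW_bij _ (@enum_val_bij I))) /=.
rewrite (eq_bigr (fun i => u 0 i * A i (enum_rank j))) ?uAj ?mulr0 //.
by move=> i _; rewrite !mxE enum_valK enum_rankK.
Qed.

Section SubqRank.
Variables (V : zmodType) (Z D : V -> Prop) (hD : subg D).

(** Nonzero multiples [w i *~ k i] are combinations of the [v j], with coefficient matrix [M]. If
    there were fewer [v j] than [w i], a dependency [c] between the rows of [M] would give a
    relation between the [w i] with coefficients [c i * k i]. *)
Lemma subq_rank_bound r (I : finType) (w : I -> V) : subq_rank Z D r ->
  (forall i, Z (w i)) ->
  (forall c : I -> int, D (\sum_i w i *~ c i) -> forall i, c i = 0) -> (#|I| <= r)%N.
Proof.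
move=> [J [v [<- vZ vfree vspan]]] wZ wfree; rewrite leqNgt; apply/negP => ltJI.
pose k i := s2val (cid2 (vspan _ (wZ i))).
have k0 i : k i != 0 by rewrite /k; case: cid2.
have /choice[M hM] i : exists c : J -> int, D (w i *~ k i - \sum_j v j *~ c j).
  by rewrite /k; case: cid2.
have [c [i ci] hc] := int_dependency M ltJI.
have : c i * k i = 0; last by apply/eqP; rewrite mulf_neq0.
apply: (wfree (fun i => c i * k i)).
have -> : \sum_i w i *~ (c i * k i) =
          \sum_i (w i *~ k i - \sum_j v j *~ M i j) *~ c i.
  transitivity (\sum_i (w i *~ k i) *~ c i - \sum_i (\sum_j v j *~ M i j) *~ c i); last first.
    by rewrite -sumrB; apply: eq_bigr => a _; rewrite mulrzBl.
  rewrite [X in _ - X](_ : _ = 0) ?subr0.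
    by apply: eq_bigr => a _; rewrite -mulrzA mulrC.
  under eq_bigr => a _ do rewrite mulrz_suml.
  rewrite exchange_big /= big1 // => j _.
  have := hc j => /(congr1 (fun z => v j *~ z)); rewrite mulr0z mulrz_sumr => vj0;
    rewrite -[RHS]vj0.
  by apply: eq_bigr => a _; rewrite -mulrzA mulrC.
by apply: subg_sum => // a _; apply: subgMz.
Qed.

Lemma subq_rank_uniq r s : subq_rank Z D r -> subq_rank Z D s -> r = s.
Proof.
move=> hr hs; apply/eqP; rewrite eqn_leq.
have [I [v [cI vZ vf _]]] := hr; have [J [w [cJ wZ wf _]]] := hs.
by rewrite -{1}cI -{2}cJ (subq_rank_bound hs vZ vf) (subq_rank_bound hr wZ wf).
Qed.

(** An independent family in [Y] of maximal size exists since sizes are bounded by [r]. Appending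
    [x] produces a relation, and independence of the family forces the coefficient of [x] in it to
    be nonzero. *)
Lemma subq_rankW (Y : V -> Prop) r : (forall x, Y x -> Z x) -> subq_rank Z D r ->
  exists s, subq_rank Y D s.
Proof.
move=> YZ hr.
pose P n := `[< exists v : 'I_n -> V, (forall i, Y (v i)) /\
  forall c : 'I_n -> int, D (\sum_i v i *~ c i) -> forall i, c i = 0 >].
have P0 : exists n, P n.
  by exists 0%N; apply/asboolP; exists (fun=> 0); split=> [[]|c _ []].
have Pr n : P n -> (n <= r)%N.
  move=> /asboolP[v [vY vf]]; rewrite -[n]card_ord.
  by apply: (subq_rank_bound hr _ vf) => i; apply: YZ.
case: (ex_maxnP P0 Pr) => s /asboolP[v [vY vf]] smax.
exists s, 'I_s, v; split=> //; first exact: card_ord.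
move=> x Yx; pose w (i : 'I_s.+1) := oapp v x (unlift ord_max i).
have wE c : \sum_i w i *~ c i = \sum_(i < s) v i *~ c (widen_ord (leqnSn s) i) + x *~ c ord_max.
  rewrite big_ord_recr /=; congr (_ + _); last by rewrite /w unlift_none.
  apply: eq_bigr => i _; rewrite /w.
  have -> : widen_ord (leqnSn s) i = fintype.lift ord_max i.
    by apply: val_inj; rewrite /= /bump leqNgt ltn_ord.
  by rewrite liftK.
have : ~ P s.+1 by move/smax; rewrite ltnn.
move=> nP; have {nP} [c [Dc [i ci]]] : exists c : 'I_s.+1 -> int,
    D (\sum_i w i *~ c i) /\ exists i, c i <> 0.
  apply: contrapT => nc; apply: nP; apply/asboolP; exists w; split.
    by move=> i; rewrite /w; case: unliftP => [j|] /=.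
  move=> c Dc i; apply: contrapT => ci; apply: nc; exists c; split=> //; by exists i.
exists (c ord_max).
  apply/eqP => c0; move: Dc; rewrite wE c0 mulr0z addr0 => /vf h; apply: ci.
  case: (unliftP ord_max i) => [j ->|-> //].
  rewrite -[RHS](h j); congr (c _); apply: val_inj.
  by rewrite /= /bump leqNgt ltn_ord.
exists (fun i => - c (widen_ord (leqnSn s) i)).
move: Dc; rewrite wE addrC; congr D; congr (_ + _).
by rewrite -sumrN; apply: eq_bigr => j _; rewrite mulrNz opprK.
Qed.

Lemma subq_rankD (E : V -> Prop) a b : (forall x, D x -> Z x) -> (forall x, E x -> D x) ->
  subq_rank Z D a -> subq_rank D E b -> subq_rank Z E (a + b).
Proof.
move=> DZ ED [I [v [<- vZ vf vs]]] [J [w [<- wD wf ws]]].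
exists (I + J)%type, (fun x => match x with inl i => v i | inr j => w j end).
have sumE c : \sum_(x : I + J) (match x with inl i => v i | inr j => w j end) *~ c x =
   \sum_i v i *~ c (inl i) + \sum_j w j *~ c (inr j) by rewrite big_sumType.
split=> [|[i|j]||x Zx].
- by rewrite card_sum.
- exact: vZ.
- exact/DZ/wD.
- move=> c; rewrite sumE => Ec.
  have c1 : forall i, c (inl i) = 0.
    apply: vf; apply: (subgDr hD) (ED _ Ec).
    by apply: subg_sum => // j _; apply: subgMz => //; apply: wD.
  move: Ec; rewrite big1 ?add0r => [/wf c2|i _]; last by rewrite c1.
  by case.
- have [k k0 [c hc]] := vs x Zx; have [k' k'0 [c' hc']] := ws _ hc.
  exists (k * k'); first by rewrite mulf_neq0.
  exists (fun y => match y with inl i => c i * k' | inr j => c' j end).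
  rewrite sumE opprD addrA; move: hc'; rewrite mulrzBl mulrzA.
  by congr E; congr (_ - _ - _); rewrite mulrz_suml; apply: eq_bigr => i _; rewrite mulrzA.
Qed.

End SubqRank.

Lemma subq_rank_push (V W : zmodType) (h : V -> W) (Z D : V -> Prop) (Z' D' : W -> Prop) r :
  subg Z -> subg D' -> subq_iso h Z D Z' D' -> subq_rank Z D r -> subq_rank Z' D' r.
Proof.
move=> hZ hD' [hB hZZ hDD hs] [I [v [<- vZ vf vspan]]].
pose hm := GRing.isZmodMorphism.Build _ _ h hB.
pose h' : {additive V -> W} := HB.pack h hm.
have hE c : \sum_i h (v i) *~ c i = h (\sum_i v i *~ c i).
  by rewrite -[h]/(h' : V -> W) raddf_sum; apply: eq_bigr => i _; rewrite raddfMz.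
have Zs c : Z (\sum_i v i *~ c i) by apply: subg_sum => // i _; apply: subgMz.
exists I, (h \o v); split=> //= [i|c|y Zy].
- exact: hZZ.
- by rewrite hE -hDD // => /vf.
- have [x Zx Dx] := hs y Zy; have [k k0 [c hc]] := vspan x Zx.
  exists k => //; exists c; rewrite hE.
  have -> : y *~ k - h (\sum_i v i *~ c i) = (y - h x) *~ k + h (x *~ k - \sum_i v i *~ c i).
    by rewrite -[h]/(h' : V -> W) raddfB raddfMz mulrzBl /= addrA subrK.
  apply: subgD => //; first exact: subgMz.
  by apply/hDD => //; apply: subgB => //; apply: subgMz.
Qed.

Lemma subq_rank_ext (V : zmodType) (Z D Z' D' : V -> Prop) r :
  (forall x, Z x <-> Z' x) -> (forall x, D x <-> D' x) ->
  subq_rank Z D r -> subq_rank Z' D' r.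
Proof.
move=> eZ eD [I [v [cI vZ vf vs]]]; exists I, v; split=> //.
- by move=> i; apply/eZ.
- by move=> c /eD /vf.
- by move=> x /eZ /vs [k k0 [c hc]]; exists k => //; exists c; apply/eD.
Qed.

Lemma subg_zero (V : zmodType) : subg (fun x : V => x = 0).
Proof. by split=> // x y -> ->; rewrite subrr. Qed.

Lemma presents_rank (G V : zmodType) (Z D : V -> Prop) r : subg Z ->
  presents G Z D -> subq_rank Z D r -> subq_rank (fun _ : G => True) (fun g => g = 0) r.
Proof.
move=> hZ [f [fB fs fD]] [I [v [<- vZ vf vspan]]].
(* [f] is a morphism on [Z] only, and given by differences; its behaviour on sums, opposites and
   multiples is rebuilt there. *)
have f0 : f 0 = 0 by rewrite -[in LHS](subrr 0) fB ?subrr //; apply: subg0.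
have fD' x y : Z x -> Z y -> f (x + y) = f x + f y.
  move=> zx zy; rewrite -{1}[y]opprK fB //; last exact: subgN.
  rewrite -[- y]sub0r fB ?f0 ?sub0r ?opprK //; exact: subg0.
have fN x : Z x -> f (- x) = - f x.
  by move=> zx; rewrite -[- x]sub0r fB ?f0 ?sub0r //; apply: subg0.
have fMz x k : Z x -> f (x *~ k) = f x *~ k.
  have fMn n : Z x -> f (x *+ n) = f x *+ n.
    move=> zx; elim: n => [|n IH]; first by rewrite !mulr0n.
    by rewrite !mulrS fD' // ?IH //; apply: subgMn.
  move=> zx; case: k => n; first exact: fMn.
  by rewrite NegzE !mulrNz fN ?fMn //; apply: subgMn.
have Zs c : Z (\sum_i v i *~ c i) by apply: subg_sum => // i _; apply: subgMz.
have fE c : \sum_i f (v i) *~ c i = f (\sum_i v i *~ c i).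
  suff [_ ->] : Z (\sum_i v i *~ c i) /\ f (\sum_i v i *~ c i) = \sum_i f (v i) *~ c i by [].
  apply: (big_ind2 (fun x y => Z x /\ f x = y)) => [|x1 x2 y1 y2 [zx <-] [zy <-]|i _].
  - by split=> //; apply: subg0.
  - by split; [apply: subgD|apply: fD'].
  - by split; [apply: subgMz|rewrite fMz].
exists I, (f \o v); split=> //= [c|g _].
- by rewrite fE fD // => /vf.
- have [x zx <-] := fs g; have [k k0 [c hc]] := vspan x zx; exists k => //; exists c.
  by rewrite fE -fMz // -fB //; [apply/fD => //; apply: subgB => //|]; apply: subgMz.
Qed.

Lemma has_rankP (G : zmodType) r :
  subq_rank (fun _ : G => True) (fun g => g = 0) r -> has_rank G r.
Proof.
move=> hr; split.
  have [I [v [cI _ vf _]]] := hr.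
  case: r / cI {hr}; exists (v \o enum_val) => c hc a.
  rewrite -[a]enum_valK; move: hc => /= hc.
  apply: (vf (c \o enum_rank)); rewrite (reindex _ (onW_bij _ (@enum_val_bij I))) /=.
  by rewrite -[RHS]hc; apply: eq_bigr => b _; rewrite enum_valK.
move=> v vf; have := @subq_rank_bound _ _ _ (subg_zero G) r 'I_r.+1 v hr (fun=> I).
by rewrite card_ord ltnn => /(_ vf).
Qed.

Lemma presents_has_rank (G V : zmodType) (Z D : V -> Prop) r : subg Z ->
  presents G Z D -> subq_rank Z D r -> has_rank G r.
Proof. by move=> hZ hp hr; apply/has_rankP/(presents_rank hZ hp). Qed.

Lemma presents_self (G : zmodType) : presents G (fun _ : G => True) (fun g => g = 0).
Proof. by exists id; split=> // g; exists g. Qed.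

Lemma row_vector_rank N : subq_rank (fun _ : 'rV[int]_N => True) (fun g => g = 0) N.
Proof.
exists 'I_N, (fun i => delta_mx 0 i).
have sE (c : 'I_N -> int) : \sum_i (delta_mx 0 i : 'rV[int]_N) *~ c i = \row_i c i.
  rewrite [RHS]row_sum_delta; apply: eq_bigr => i _.
  by rewrite mxE -scaler_int intz.
split=> //; first exact: card_ord.
  by move=> c; rewrite sE => /rowP h i; have := h i; rewrite !mxE.
move=> x _; exists 1 => //; exists (fun i => x 0 i); rewrite sE mulr1z.
by apply/rowP => i; rewrite !mxE subrr.
Qed.

(* A nonzero subgroup image of the last coordinate is infinite cyclic, hence splits off. *)
Lemma free_of_embedding K (G : zmodType) (e : {additive G -> 'rV[int]_K}) :
  injective e -> exists N, G \simeq 'rV[int]_N.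
Proof.
elim: K G e => [|K IH] G e einj.
  exists 0%N; exists (\0 : {additive G -> 'rV[int]_0}); exists (fun=> 0) => x.
    by apply: einj; rewrite [LHS]thinmx0 [RHS]thinmx0.
  by rewrite [LHS]thinmx0 [RHS]thinmx0.
pose l g := e g 0 ord_max.
have lB : zmod_morphism l by move=> x y; rewrite /l raddfB !mxE.
pose lm := GRing.isZmodMorphism.Build _ _ l lB.
pose l' : {additive G -> int} := HB.pack l lm.
pose kl := ker l'.
pose e' (x : kl) : 'rV[int]_K := \row_i e (sg_val x) 0 (widen_ord (leqnSn K) i).
have e'B : zmod_morphism e' by move=> x y; apply/rowP => i; rewrite !mxE /= raddfB !mxE.
pose em := GRing.isZmodMorphism.Build _ _ e' e'B.
have e'inj : injective e'.
  move=> x y /rowP h; apply: val_inj; apply: einj; apply/rowP => i.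
  case: (unliftP ord_max i) => [j ->|->].
    have := h j; rewrite !mxE; congr (_ = _); congr (e _ _ _); apply: val_inj;
      by rewrite /= /bump leqNgt ltn_ord.
  case: x {h} => x kx; case: y => y ky /=.
  by move: kx ky; rewrite !unfold_in /= => /eqP kx /eqP ky; rewrite -/(l x) -/(l y) kx ky.
have [N isoN] := IH kl (HB.pack e' em) e'inj.
have [l0|l0] := pselect (forall g, l g = 0).
  exists N; apply: zmod_iso_trans isoN.
  have gk g : g \in in_ker l' by rewrite unfold_in; apply/eqP/l0.
  apply: (@zmod_isoI _ _ (fun g => Subgroup (gk g))) => [x y|x y /(congr1 val) //|[x kx]].
    exact: val_inj.
  by exists x; apply: val_inj.
have [g0 lg0 gmin] : exists2 g0, (0 < `|l g0|)%N & forall g, l g != 0 -> (`|l g0| <= `|l g|)%N.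
  pose P n := `[< exists g, `|l g|%N = n /\ l g != 0 >].
  have : exists n, P n.
    apply: contrapT => nP; apply: l0 => g; apply/eqP/negPn/negP => lg; apply: nP.
    by exists `|l g|%N; apply/asboolP; exists g.
  case/ex_minnP => n /asboolP[g [<- lg]] gmin; exists g; first by rewrite lt0n absz_eq0.
  by move=> g' lg'; apply: gmin; apply/asboolP; exists g'.
have l00 : l g0 != 0 by rewrite -absz_eq0 -lt0n.
have lM g k : l (g *~ k) = l g * k.
  by rewrite -[l]/(l' : G -> int) raddfMz /= -mulrzr intz.
(* The remainder of [l g] modulo [l g0] is again a value of [l], so by minimality it is 0: [l g0]
   generates the image of [l]. *)
have ldiv g : l (g - g0 *~ (l g %/ l g0)%Z) = 0.
  have E : l (g - g0 *~ (l g %/ l g0)%Z) = (l g %% l g0)%Z by rewrite lB lM mulrC.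
  apply/eqP/negPn/negP => /gmin; rewrite E leqNgt => /negP[].
  by rewrite -ltz_nat !abszE ger0_norm ?modz_ge0 ?ltz_mod.
have [F [F' FK F'K]] := isoN.
have kg g : g - g0 *~ (l g %/ l g0)%Z \in in_ker l' by rewrite unfold_in; apply/eqP/ldiv.
have ldivB x y : ((l (x - y)) %/ l g0)%Z = (l x %/ l g0)%Z - (l y %/ l g0)%Z.
  have /eqP := ldiv x; have /eqP := ldiv y; rewrite !lB !lM !subr_eq0 => /eqP hy /eqP hx.
  by rewrite {1}hx {1}hy -mulrBr mulKz.
exists N.+1.
(* The last entry is the quotient q of [l g] by [l g0]; the others are the coordinates of
   [g - g0 *~ q] in the free kernel of [l]. *)
pose T g : 'rV[int]_(N.+1) := \row_i
  oapp (fun j => F (Subgroup (kg g)) 0 j) (l g %/ l g0)%Z (unlift ord_max i).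
apply: (@zmod_isoI _ _ T) => [x y|x y /rowP h|v].
- apply/rowP => i; rewrite !mxE; case: (unlift ord_max i) => [j|] /=; last exact: ldivB.
  have -> : Subgroup (kg (x - y)) = (Subgroup (kg x) : kl) - Subgroup (kg y).
    apply: val_inj; rewrite /= ldivB mulrzBr !opprB addrACA [RHS]addrACA.
    by congr (_ + _); apply: addrC.
  by rewrite raddfB !mxE.
- have hq := h ord_max; rewrite !mxE unlift_none /= in hq.
  have : F (Subgroup (kg x)) = F (Subgroup (kg y)).
    by apply/rowP => j; have := h (fintype.lift ord_max j); rewrite !mxE liftK.
  by move/(can_inj FK)/(congr1 val) => /=; rewrite hq => /(addIr _).
- pose q := v 0 ord_max; pose u := F' (\row_j v 0 (fintype.lift ord_max j)).
  have lu : l (sg_val u) = 0 by case: u => u ku; apply/eqP; exact: ku.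
  have lx : (l (sg_val u + g0 *~ q) %/ l g0)%Z = q.
    have -> : l (sg_val u + g0 *~ q) = l g0 * q.
      by rewrite -[l]/(l' : G -> int) raddfD /= -/(l _) lu add0r -/(l _) lM.
    by rewrite mulKz.
  exists (sg_val u + g0 *~ q); apply/rowP => i; rewrite !mxE.
  case: (unliftP ord_max i) => [j ->|->] /=; last exact: lx.
  have -> : Subgroup (kg (sg_val u + g0 *~ q)) = u by apply: val_inj; rewrite /= lx addrK.
  by rewrite /u F'K mxE.
Qed.

Lemma free_rank (G : zmodType) K (e : {additive G -> 'rV[int]_K}) r :
  injective e -> subq_rank (fun _ : G => True) (fun g => g = 0) r -> G \simeq 'rV[int]_r.
Proof.
move=> einj hr; have [N isoN] := free_of_embedding einj.
suff <- : N = r by [].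
have hp := presents_of_iso (presents_self G) isoN.
have hN := presents_rank (conj Logic.I (fun _ _ _ _ => Logic.I)) hp hr.
exact: (subq_rank_uniq (@subg_zero _) (row_vector_rank N) hN).
Qed.

(** * Tensor powers *)

Section TensorUniversal.
Variables (A : zmodType) (I : finType).

Lemma tensor_gen (D : tensor A I -> Prop) : subg D ->
  (forall a, D (pure a)) -> forall x, D x.
Proof.
move=> hD Dpure x; rewrite -[x]reprK; elim/freeg_ind_dom0: (repr x) => [|k a u _ _ Du].
  by rewrite raddf0; apply: subg0.
rewrite raddfD; apply: subgD => //.
rewrite -[k]intz -freegU_mulz.
by rewrite raddfMz; apply: subgMz => //; apply: Dpure.
Qed.

Lemma additive_tensor_eq (W : zmodType) (f g : {additive tensor A I -> W}) :
  (forall a, f (pure a) = g (pure a)) -> f =1 g.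
Proof.
move=> fg; apply: tensor_gen; [split=> [|x y ex ey]|exact: fg]; first by rewrite !raddf0.
by rewrite !raddfB ex ey.
Qed.

Lemma pure_updD (a : {ffun I -> A}) i u v :
  pure (upd a i (u + v)) = pure (upd a i u) + pure (upd a i v).
Proof.
apply/eqP; rewrite -subr_eq0 /pure -raddfD -raddfB opprD addrA.
rewrite -[X in _ == X](raddf0 (\pi_(Quotient.quot (@in_mlrel A I)))%qT).
rewrite -Quotient.idealrBE subr0 unfold_in; apply/asboolP; exact: MLgen.
Qed.

Lemma upd_id (a : {ffun I -> A}) i : upd a i (a i) = a.
Proof. by apply/ffunP => k; rewrite ffunE; case: eqP => [->|]. Qed.

Section Lift.
Variables (W : zmodType) (F : {ffun I -> A} -> W).
Hypothesis FD : forall a i u v, F (upd a i (u + v)) = F (upd a i u) + F (upd a i v).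

Let G : {freeg {ffun I -> A} / int} -> zmodule W := fglift (F : _ -> zmodule W).
Let GB : zmod_morphism G. Proof. exact: lift_is_additive. Qed.

Let G_rel x : x \in @in_mlrel A I -> G x = 0.
Proof.
rewrite unfold_in => /asboolP; elim=> {x} [a i u v||x y _ hx _ hy].
- by rewrite !GB /G !liftU !scale1r FD addrAC addrK subrr.
- by rewrite -[0](subrr 0) GB subrr.
- by rewrite GB hx hy subrr.
Qed.

Fact tensor_lift_ex : exists T : {additive tensor A I -> W}, forall a, T (pure a) = F a.
Proof.
pose T (x : tensor A I) : W := G (repr x).
have Tpi x : T (\pi_(Quotient.quot (@in_mlrel A I)) x)%qT = G x.
  apply/eqP; rewrite -subr_eq0 -GB; apply/eqP/G_rel.
  by rewrite Quotient.idealrBE reprK.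
have TB : zmod_morphism T.
  by move=> x y; rewrite -[x]reprK -[y]reprK -raddfB !Tpi GB.
pose m := GRing.isZmodMorphism.Build _ _ T TB.
pose T' : {additive tensor A I -> W} := HB.pack T m.
exists T' => a; rewrite /= Tpi /G liftU. exact: (@scale1r _ (zmodule W)).
Qed.

Definition tensor_lift := sval (cid tensor_lift_ex).
Lemma tensor_lift_pure a : tensor_lift (pure a) = F a.
Proof. exact: (svalP (cid tensor_lift_ex)). Qed.

End Lift.
End TensorUniversal.

Section Functor.
Variables (A : comPzRingType).

Lemma tensor_map_comp (I J K : finType) (phi : I -> J) (psi : J -> K) (x : tensor A I) :
  tensor_map psi (tensor_map phi x) = tensor_map (psi \o phi) x.
Proof.
apply: (additive_tensor_eq (f := tensor_map psi \o tensor_map phi)) => a /=.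
rewrite !tensor_map_pure; congr pure; apply/ffunP => k; rewrite !ffunE.
rewrite [RHS](partition_big phi (fun j => psi j == k)) //=.
apply: eq_bigr => j /eqP <-; rewrite ffunE; apply: eq_bigl => i.
by case: (phi i =P j) => [->|]; rewrite ?eqxx ?andbF.
Qed.

Lemma eq_tensor_map (I J : finType) (phi phi' : I -> J) (x : tensor A I) :
  phi =1 phi' -> tensor_map phi x = tensor_map phi' x.
Proof. by move/funext => ->. Qed.

Lemma tensor_map_id (I : finType) (phi : I -> I) (x : tensor A I) :
  phi =1 id -> tensor_map phi x = x.
Proof.
move=> e; rewrite (eq_tensor_map x e).
apply: (additive_tensor_eq (f := tensor_map id) (g := idfun)) => a /=.
rewrite tensor_map_pure; congr pure; apply/ffunP => i; rewrite ffunE.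
by rewrite (big_pred1 i).
Qed.

(** [psi] factors through [phi] as [g \o phi]; the element [i0] merely supplies values of [g]
    outside the image of [phi]. *)
Lemma tensor_map_factor (I J K : finType) (i0 : I) (phi : I -> J) (psi : I -> K) :
  (forall i i', phi i = phi i' -> psi i = psi i') ->
  forall x : tensor A I, tensor_map phi x = 0 -> tensor_map psi x = 0.
Proof.
move=> e x hx; pose g j := odflt (psi i0) (omap psi [pick i | phi i == j]).
have <- : tensor_map (g \o phi) x = tensor_map psi x.
  apply: eq_tensor_map => i; rewrite /g /=; case: pickP => [i' /eqP|/(_ i)] /=; first exact: e.
  by rewrite eqxx.
by rewrite -tensor_map_comp hx raddf0.
Qed.

Lemma tensor_map_inj (I J : finType) (phi : I -> J) (psi : J -> I) (x : tensor A I) :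
  cancel phi psi -> tensor_map phi x = 0 -> x = 0.
Proof.
by move=> e hx; rewrite -[x](tensor_map_id _ e) -tensor_map_comp hx raddf0.
Qed.

End Functor.

Section Adjoin.
Variables (A : comPzRingType) (n : nat).

Definition ext (f : {ffun 'I_n -> A}) (a : A) : {ffun 'I_n.+1 -> A} :=
  [ffun i => oapp f a (unlift ord_max i)].

Lemma ext_lift f a i : ext f a (fintype.lift ord_max i) = f i.
Proof. by rewrite ffunE liftK. Qed.
Lemma ext_max f a : ext f a ord_max = a.
Proof. by rewrite ffunE unlift_none. Qed.

Lemma ffun_last_eq (T : Type) (f g : 'I_n.+1 -> T) :
  (forall i, f (fintype.lift ord_max i) = g (fintype.lift ord_max i)) ->
  f ord_max = g ord_max -> f =1 g.
Proof. by move=> h0 h1 i; case: (unliftP ord_max i) => [j ->|->]. Qed.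

Lemma ext_upd f i u a : ext (upd f i u) a = upd (ext f a) (fintype.lift ord_max i) u.
Proof.
apply/ffunP; apply: ffun_last_eq => [j|]; rewrite !ffunE ?liftK ?unlift_none /=.
  by rewrite ffunE (inj_eq (@lift_inj _ _)).
by rewrite (negPf (neq_lift _ _)).
Qed.

Lemma upd_ext f a b : upd (ext f a) ord_max b = ext f b.
Proof.
apply/ffunP; apply: ffun_last_eq => [j|]; rewrite !ffunE ?liftK ?unlift_none /= ?eqxx //.
by rewrite eq_sym (negPf (neq_lift _ _)).
Qed.

Fact adjoin_lin a f i u v : pure (ext (upd f i (u + v)) a) =
  pure (ext (upd f i u) a) + pure (ext (upd f i v) a).
Proof. by rewrite !ext_upd pure_updD. Qed.

Definition adjoin (a : A) : {additive tensor A 'I_n -> tensor A 'I_n.+1} :=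
  tensor_lift (F := fun f => pure (ext f a)) (adjoin_lin a).

Lemma adjoin_pure a f : adjoin a (pure f) = pure (ext f a).
Proof. exact: tensor_lift_pure. Qed.

Lemma adjoinB a b x : adjoin (a - b) x = adjoin a x - adjoin b x.
Proof.
apply/eqP; rewrite eq_sym subr_eq; apply/eqP.
apply: (additive_tensor_eq (f := adjoin a) (g := (adjoin (a - b) \+ adjoin b)%R)) => f /=.
rewrite !adjoin_pure.
have {1}-> : ext f a = upd (ext f a) ord_max (a - b + b) by rewrite subrK upd_ext.
by rewrite pure_updD !upd_ext.
Qed.

Lemma adjoin0 x : adjoin 0 x = 0.
Proof. by rewrite -(subrr (0 : A)) adjoinB subrr. Qed.

Lemma adjoinD a b x : adjoin (a + b) x = adjoin a x + adjoin b x.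
Proof. by rewrite -{1}[b]opprK adjoinB -[- b]sub0r adjoinB adjoin0 sub0r opprK. Qed.

Lemma adjoinMn a m x : adjoin (a *+ m) x = adjoin a x *+ m.
Proof.
by elim: m => [|m IH]; [rewrite !mulr0n adjoin0|rewrite !mulrS adjoinD IH].
Qed.

Lemma adjoinMz a k x : adjoin (a *~ k) x = adjoin a x *~ k.
Proof.
case: k => m; first exact: adjoinMn.
by rewrite NegzE !mulrNz -[- (a *~ _)]sub0r adjoinB adjoin0 sub0r [in LHS]adjoinMn.
Qed.

Lemma adjoin_sum (J : Type) (r : seq J) (a : J -> A) x :
  adjoin (\sum_(j <- r) a j) x = \sum_(j <- r) adjoin (a j) x.
Proof.
elim: r => [|j r IH]; first by rewrite !big_nil adjoin0.
by rewrite !big_cons adjoinD IH.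
Qed.

Section Coordinate.
Variable c : {additive A -> int}.

Fact coord_lin (f : {ffun 'I_n.+1 -> A}) i u v (F := fun f : {ffun 'I_n.+1 -> A} =>
  pure [ffun k : 'I_n => f (fintype.lift ord_max k)] *~ c (f ord_max)) :
  F (upd f i (u + v)) = F (upd f i u) + F (upd f i v).
Proof.
rewrite /F; case: (unliftP ord_max i) => [j ->|->].
  have E w : [ffun k => upd f (fintype.lift ord_max j) w (fintype.lift ord_max k)] =
      upd [ffun k => f (fintype.lift ord_max k)] j w.
    by apply/ffunP => k; rewrite !ffunE (inj_eq (@lift_inj _ _)).
  have E' w : upd f (fintype.lift ord_max j) w ord_max = f ord_max.
    by rewrite ffunE (negPf (neq_lift _ _)).
  by rewrite !E !E' pure_updD mulrzDl.
have E w : [ffun k => upd f ord_max w (fintype.lift ord_max k)] =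
    [ffun k => f (fintype.lift ord_max k)].
  by apply/ffunP => k; rewrite !ffunE eq_sym (negPf (neq_lift _ _)).
have E' w : upd f ord_max w ord_max = w by rewrite ffunE eqxx.
by rewrite !E !E' raddfD /= mulrzDr.
Qed.

(** Contraction of the last factor with the functional [c]. With [c] running through a dual basis it
    reads off the coordinates along the last factor. *)
Definition tcoord : {additive tensor A 'I_n.+1 -> tensor A 'I_n} :=
  tensor_lift (F := fun f => pure [ffun k : 'I_n => f (fintype.lift ord_max k)] *~ c (f ord_max))
    coord_lin.

Lemma tcoord_adjoin a x : tcoord (adjoin a x) = x *~ c a.
Proof.
have mB : zmod_morphism (fun x : tensor A 'I_n => x *~ c a).
  by move=> y z; rewrite mulrzBl.
pose m := GRing.isZmodMorphism.Build _ _ _ mB.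
pose g : {additive tensor A 'I_n -> tensor A 'I_n} := HB.pack (fun x => x *~ c a) m.
apply: (additive_tensor_eq (f := tcoord \o adjoin a) (g := g)) => f /=.
rewrite adjoin_pure tensor_lift_pure ext_max; congr (pure _ *~ _).
by apply/ffunP => i; rewrite ffunE ext_lift.
Qed.

End Coordinate.

Lemma adjoin_gen (D : tensor A 'I_n.+1 -> Prop) : subg D ->
  (forall a x, D (adjoin a x)) -> forall x, D x.
Proof.
move=> hD h; apply: tensor_gen => // f.
have -> : f = ext [ffun i => f (fintype.lift ord_max i)] (f ord_max).
  by apply/ffunP; apply: ffun_last_eq => [i|]; rewrite ?ext_lift ?ext_max ?ffunE.
by rewrite -adjoin_pure; apply: h.
Qed.

Definition fold_last (i : 'I_n) (k : 'I_n.+1) : 'I_n := odflt i (unlift ord_max k).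

Lemma merge_fold_last i f a : Defs.merge (fold_last i) (ext f a) = upd f i (f i * a).
Proof.
apply/ffunP => j; rewrite !ffunE.
rewrite (bigD1 (fintype.lift ord_max j)) /=; last by rewrite /fold_last liftK.
rewrite ext_lift; case: (j =P i) => [->|ji].
  rewrite (bigD1 ord_max) /=; last by rewrite /fold_last unlift_none /= eqxx neq_lift.
  rewrite ext_max big1 ?mulr1 // => k /andP[/andP[]].
  by case: (unliftP ord_max k) => [k' ->|->]; rewrite ?eqxx // /fold_last liftK /= => /eqP ->;
    rewrite eqxx.
rewrite big1 ?mulr1 // => k /andP[].
case: (unliftP ord_max k) => [k' ->|->]; rewrite /fold_last ?liftK ?unlift_none /= => /eqP.
  by move->; rewrite eqxx.
by move=> e; case: ji.
Qed.

(** Multiplication of the factor [i] by [a], obtained by adjoining [a] and folding it into place: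
    the same folding map expresses the substitution of variables in [psi_horner]. *)
Definition tmul (i : 'I_n) (a : A) (x : tensor A 'I_n) := tensor_map (fold_last i) (adjoin a x).

Lemma tmul_pure i a f : tmul i a (pure f) = pure (upd f i (f i * a)).
Proof. by rewrite /tmul adjoin_pure tensor_map_pure merge_fold_last. Qed.

Fact tmul_additive i a : zmod_morphism (tmul i a).
Proof. by move=> x y; rewrite /tmul !raddfB. Qed.
HB.instance Definition _ i a :=
  GRing.isZmodMorphism.Build _ _ (tmul i a) (tmul_additive i a).

Lemma tmulM i a b x : tmul i a (tmul i b x) = tmul i (b * a) x.
Proof.
apply: (additive_tensor_eq (f := tmul i a \o tmul i b)) => f /=; rewrite !tmul_pure.
by congr pure; apply/ffunP => j; rewrite !ffunE eqxx mulrA; case: eqP.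
Qed.

Lemma tmul1 i x : tmul i 1 x = x.
Proof.
apply: (additive_tensor_eq (f := tmul i 1) (g := idfun)) => f /=.
by rewrite tmul_pure mulr1 upd_id.
Qed.

End Adjoin.
Arguments adjoin {A n} a.
Arguments tcoord {A n} c.

Section AdjoinS.
Variables (A : comPzRingType) (n : nat).

Lemma tmul_last a b (x : tensor A 'I_n) : tmul ord_max a (adjoin b x) = adjoin (b * a) x.
Proof.
apply: (additive_tensor_eq (f := tmul ord_max a \o adjoin b)) => f /=.
by rewrite !adjoin_pure tmul_pure ext_max upd_ext.
Qed.

Lemma tmul_lift i a b (x : tensor A 'I_n) :
  tmul (fintype.lift ord_max i) a (adjoin b x) = adjoin b (tmul i a x).
Proof.
apply: (additive_tensor_eq (f := tmul (fintype.lift ord_max i) a \o adjoin b)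
  (g := adjoin b \o tmul i a)) => f /=.
by rewrite !(adjoin_pure, tmul_pure) ext_lift ext_upd.
Qed.

Definition keep_last m (phi : 'I_n -> 'I_m) (k : 'I_n.+1) : 'I_m.+1 :=
  oapp (fintype.lift ord_max \o phi) ord_max (unlift ord_max k).

Lemma tensor_map_adjoin m (phi : 'I_n -> 'I_m) a (x : tensor A 'I_n) :
  tensor_map (keep_last phi) (adjoin a x) = adjoin a (tensor_map phi x).
Proof.
apply: (additive_tensor_eq (f := tensor_map (keep_last phi) \o adjoin a)
  (g := adjoin a \o tensor_map phi)) => f /=.
rewrite tensor_map_pure !adjoin_pure tensor_map_pure; congr pure.
have kl k : keep_last phi (fintype.lift ord_max k) = fintype.lift ord_max (phi k).
  by rewrite /keep_last liftK.
have km : keep_last phi ord_max = ord_max by rewrite /keep_last unlift_none.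
apply/ffunP; apply: ffun_last_eq => [j|]; rewrite ?ext_lift ?ext_max !ffunE.
  rewrite big_mkcond big_ord_recr /= km (negPf (neq_lift _ _)) mulr1 [RHS]big_mkcond.
  apply: eq_bigr => i _; have -> : widen_ord (leqnSn n) i = fintype.lift ord_max i.
    by apply: val_inj; rewrite /= /bump leqNgt ltn_ord.
  by rewrite kl (inj_eq (@lift_inj _ _)) ext_lift.
rewrite (big_pred1 ord_max) ?ext_max // => k /=.
case: (unliftP ord_max k) => [k' ->|->]; last by rewrite km !eqxx.
by rewrite kl ![fintype.lift _ _ == _]eq_sym !(negPf (neq_lift _ _)).
Qed.

End AdjoinS.

(** * Tensor powers as quotients of polynomial rings *)

(** With nested polynomials the last variable is the polynomial variable, so induction on the number
    of factors becomes Euclidean division by [P]. *)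
Fixpoint iter_poly (n : nat) : comNzRingType :=
  if n is m.+1 then {poly iter_poly m} : comNzRingType else int : comNzRingType.

Section Presentation.
Variables (A : comPzRingType) (pi : {rmorphism {poly int} -> A}) (P : {poly int}).
Hypotheses (Pmonic : P \is monic) (Psize : (1 < size P)%N).
Hypothesis pi_surj : forall a, exists q, pi q = a.
Hypothesis pi_ker : forall q, pi q = 0 <-> exists u, q = u * P.

Local Notation d := (size P).-1.
Local Notation B := iter_poly.
Local Notation V n := (tensor A 'I_n).

Let xi : A := pi 'X.

Definition int_poly (R : nzRingType) : {poly R} := map_poly intr P.

Lemma int_poly_monic (R : nzRingType) : int_poly R \is monic.
Proof. by apply: monic_map. Qed.
Lemma size_int_poly (R : nzRingType) : size (int_poly R) = size P.
Proof.
rewrite size_map_poly_id0 // -[lead_coef P]/(lead_coef P) (monicP Pmonic).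
exact: oner_neq0.
Qed.

Import Pdiv.RingMonic.

Lemma rmodp_pi q r : pi q = pi r -> Pdiv.Ring.rmodp q P = Pdiv.Ring.rmodp r P.
Proof.
move=> e; have /pi_ker[u hu] : pi (q - r) = 0 by rewrite raddfB /= e subrr.
by apply/eqP; rewrite -subr_eq0 -rmodpB // hu rmodp_mull.
Qed.

Fact rem_coef_additive j : zmod_morphism (fun a => (Pdiv.Ring.rmodp (sval (cid (pi_surj a))) P)`_j).
Proof.
move=> a b; case: cid => q /= hq; case: cid => r /= hr; case: cid => s /= hs.
by rewrite -coefB -rmodpB // (@rmodp_pi q (r - s)) // hq raddfB /= hr hs.
Qed.
(** By [rmodp_pi] the lift of [a] does not matter. For j < d these functionals are the basis dual to
    1, xi, .., xi^(d-1). *)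
Definition rem_coef j a := (Pdiv.Ring.rmodp (sval (cid (pi_surj a))) P)`_j.
HB.instance Definition _ j :=
  GRing.isZmodMorphism.Build A int (rem_coef j) (rem_coef_additive j).

Lemma rem_coefE j q : rem_coef j (pi q) = (Pdiv.Ring.rmodp q P)`_j.
Proof.
by rewrite /rem_coef; case: cid => r /= hr; rewrite (rmodp_pi hr).
Qed.

Lemma rem_coefX j i : (i < d)%N -> rem_coef j (xi ^+ i) = (j == i)%:R.
Proof.
move=> id; rewrite -rmorphXn rem_coefE Pdiv.Ring.rmodp_small ?coefXn //.
by rewrite size_polyXn; case: (size P) id.
Qed.

(** The map Z[x_1, .., x_n] -> V_n that puts [xi] in place of each variable, in its own factor. It
    is built as an additive map; products in [V_n] are replaced by [tmul] and by the fact that the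
    kernel is an ideal. *)
Fixpoint psi (n : nat) : B n -> V n :=
  match n return B n -> V n with
  | 0 => fun k => pure [ffun=> 1] *~ k
  | m.+1 => fun b : {poly B m} => \sum_(j < size b) adjoin (xi ^+ j) (psi b`_j)
  end.

Lemma psiS_wide n (b : {poly B n}) N : psi (0 : B n) = 0 -> (size b <= N)%N ->
  psi (b : B n.+1) = \sum_(j < N) adjoin (xi ^+ j) (psi b`_j).
Proof.
move=> psi0 bN; rewrite /= (big_ord_widen N (fun j => adjoin (xi ^+ j) (psi b`_j))) //.
rewrite big_mkcond; apply: eq_bigr => j _; case: ltnP => // sj.
by rewrite nth_default // psi0 raddf0.
Qed.

Fact psi_additive n : zmod_morphism (@psi n).
Proof.
elim: n => [|n IH]; first by move=> b c; rewrite /= mulrzBr.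
have psi0 : psi (0 : B n) = 0 by rewrite -(subrr (0 : B n)) IH subrr.
suff key (b c : {poly B n}) : psi (b - c : B n.+1) = psi (b : B n.+1) - psi (c : B n.+1).
  exact: key.
have sN : (size (b - c)%R <= maxn (size b) (size c))%N.
  by rewrite (leq_trans (size_polyD _ _)) // size_polyN.
rewrite (psiS_wide psi0 sN) (psiS_wide psi0 (leq_maxl _ (size c))).
rewrite (psiS_wide psi0 (leq_maxr (size b) _)) -sumrB.
by apply: eq_bigr => j _; rewrite coefB IH raddfB.
Qed.
HB.instance Definition _ n := GRing.isZmodMorphism.Build (B n) (V n) (@psi n) (@psi_additive n).
Arguments psi n _ : simpl never.

Lemma psi0E (k : B 0) : psi k = pure [ffun=> 1] *~ k.
Proof. by []. Qed.

Lemma psiS n (b : {poly B n}) N : (size b <= N)%N ->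
  psi (b : B n.+1) = \sum_(j < N) adjoin (xi ^+ j) (psi b`_j).
Proof. by apply: psiS_wide; rewrite raddf0. Qed.


Lemma pi_expand (q : {poly int}) : pi q = \sum_(j < size q) xi ^+ j *~ q`_j.
Proof.
rewrite -[in LHS](coefK q) poly_def rmorph_sum /=; apply: eq_bigr => j _.
by rewrite -[q`_j]intz scaler_int rmorphMz rmorphXn intz.
Qed.

Lemma psi_map n (c : B n) (q : {poly int}) :
  psi (c%:P * map_poly intr q : B n.+1) = adjoin (pi q) (psi c).
Proof.
rewrite (@psiS _ _ (size q)); last first.
  rewrite mul_polyC (leq_trans (size_scale_leq _ _)) // size_poly //.
rewrite pi_expand adjoin_sum; apply: eq_bigr => j _.
by rewrite coefCM coef_map /= mulrzr raddfMz raddfMz adjoinMz.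
Qed.

Lemma psi_mulP n (q : {poly B n}) : psi (q * int_poly (B n) : B n.+1) = 0.
Proof.
rewrite -[q]coefK poly_def mulr_suml raddf_sum big1 // => j _.
have -> : q`_j *: 'X^j * int_poly (B n) = (q`_j)%:P * map_poly intr ('X^j * P).
  by rewrite rmorphM /= map_polyXn mulrA mul_polyC.
rewrite /= psi_map; have -> : pi ('X^j * P) = 0 by apply/pi_ker; exists 'X^j.
by rewrite adjoin0.
Qed.

(** Contracting the last factor with the dual functional [rem_coef j] isolates [v j]. *)
Lemma adjoin_free n (v : nat -> V n) :
  \sum_(j < d) adjoin (xi ^+ j) (v j) = 0 -> forall j, (j < d)%N -> v j = 0.
Proof.
move=> h j jd; have := congr1 (tcoord (rem_coef j)) h.
rewrite raddf0 raddf_sum (bigD1 (Ordinal jd)) //= big1 => [|i ij].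
  by rewrite addr0 tcoord_adjoin /= rem_coefX // eqxx mulr1z.
have /negPf ij' : (i : nat) != j := ij.
by rewrite tcoord_adjoin /= rem_coefX // eq_sym ij' mulr0z.
Qed.

Lemma psi_surj n (v : V n) : exists b, psi b = v.
Proof.
elim: n v => [|n IH] v.
  pose D (v : V 0) := exists b : B 0, psi b = v.
  apply: (@tensor_gen _ _ D) => [|a].
    by split=> [|x y [b <-] [c <-]]; [exists 0; rewrite raddf0|exists (b - c); rewrite raddfB].
  by exists 1; rewrite psi0E mulr1z; congr pure; apply/ffunP; case.
pose D (v : V n.+1) := exists b : B n.+1, psi b = v.
apply: (@adjoin_gen _ _ D) => [|a x].
  by split=> [|x y [b <-] [c <-]]; [exists 0; rewrite raddf0|exists (b - c); rewrite raddfB].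
have [q <-] := pi_surj a; have [b <-] := IH x.
by exists (b%:P * map_poly intr q : {poly B n}); rewrite psi_map.
Qed.

Lemma psi_rem n (b : {poly B n}) : psi (b : B n.+1) = psi (Pdiv.Ring.rmodp b (int_poly (B n)) : B
  n.+1).
Proof.
rewrite {1}(rdivp_eq (int_poly_monic (B n)) b) -[LHS]/(psi (_ + _ : B n.+1)).
by rewrite [LHS]raddfD /= -[X in X + _]/(psi (_ : B n.+1)) psi_mulP add0r.
Qed.

Lemma size_rem n (b : {poly B n}) : (size (Pdiv.Ring.rmodp b (int_poly (B n))) <= d)%N.
Proof.
have := Pdiv.CommonRing.ltn_rmodpN0 b (monic_neq0 (int_poly_monic (B n))).
by rewrite size_int_poly; case: (size P) Psize.
Qed.

Lemma psi_test n (K : B n -> Prop) (b : {poly B n}) :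
  (exists q, forall j, K (b - q * int_poly (B n))`_j) ->
  exists2 r : {poly B n}, psi (b : B n.+1) = psi (r : B n.+1) & forall j, K r`_j.
Proof.
case=> q hq; exists (b - q * int_poly (B n)) => //.
by rewrite -[RHS]/(psi (_ - _ : B n.+1)) raddfB /= -[X in _ - X]/(psi (_ : B n.+1)) psi_mulP subr0.
Qed.

(** With [J] the kernel for n variables, the kernel for n + 1 variables is J[X] + (P). The witness
    is the quotient by [P], since [adjoin_free] applies to the remainder, whose degree is below
    d. *)
Lemma psi_ker n (b : {poly B n}) : psi (b : B n.+1) = 0 <->
  exists q, forall j, psi (b - q * int_poly (B n))`_j = 0.
Proof.
split=> [h|/(psi_test (K := fun c => psi c = 0))[r -> hr]]; last first.
  by rewrite (psiS (leqnn _)) big1 // => j _; rewrite hr raddf0.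
exists (Pdiv.Ring.rdivp b (int_poly (B n))) => j.
rewrite {1}(rdivp_eq (int_poly_monic (B n)) b) addrC addKr.
case: (ltnP j d) => [jd|dj]; last by rewrite nth_default ?raddf0 ?(leq_trans (size_rem b)).
apply: (@adjoin_free n (fun j => psi (Pdiv.Ring.rmodp b (int_poly (B n)))`_j)) => //.
by rewrite -(psiS (size_rem b)) -psi_rem.
Qed.

Lemma psi_ker_mul n (b c : B n) : psi c = 0 -> psi (b * c) = 0.
Proof.
elim: n b c => [|n IH] b c.
  rewrite !psi0E => h; suff -> : c = 0 by rewrite mulr0 mulr0z.
  (* The empty tensor power is Z. Over an empty index set multilinearity is void, so the constant 1
     lifts to a functional that detects [c]. *)
  have lin (a : {ffun 'I_0 -> A}) (i : 'I_0) (u v : A) : (1 : int) = 1 + 1 by case: i.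
  have /= := congr1 (tensor_lift (F := fun=> 1 : int) lin) h.
  by rewrite raddf0 raddfMz /= tensor_lift_pure intz.
move=> /psi_ker[q hq]; apply/psi_ker; exists (b * q) => j.
rewrite -mulrA -mulrBr coefM raddf_sum big1 // => i _; exact: IH.
Qed.

(** Replacing the last variable by an element that acts as [xi] on the factor [i] folds the last
    factor into it. Used with the last and the first of the remaining variables, this turns the two
    merging maps needed here into evaluations. *)
Lemma psi_horner n (i : 'I_n) (x : B n) (b : {poly B n}) :
  (forall c, psi (x * c) = tmul i xi (psi c)) ->
  tensor_map (fold_last i) (psi (b : B n.+1)) = psi b.[x].
Proof.
move=> hx; rewrite horner_coef (psiS (leqnn _)) !raddf_sum; apply: eq_bigr => j _ /=.
elim: (nat_of_ord j) (b`_j) => [|k IH] c.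
  by rewrite expr0 mulr1 -[LHS]/(tmul i _ _) ?expr0 tmul1.
rewrite (exprS x) mulrCA hx -IH -/(tmul i (xi ^+ k) _) tmulM.
by rewrite -/(tmul i (xi ^+ k.+1) _) exprSr.
Qed.

Definition last_var n : B n.+1 := 'X : {poly B n}.
Fixpoint first_var n : B n.+1 :=
  if n is m.+1 then (first_var m)%:P : {poly B m.+1} else 'X : {poly B 0}.

Lemma psi_last_var n (c : B n.+1) : psi (last_var n * c) = tmul ord_max xi (psi c).
Proof.
rewrite /last_var mulrC (@psiS _ _ (size (c : {poly B n})).+1); last first.
  by rewrite (leq_trans (size_polyMleq _ _)) // size_polyX addn2.
rewrite (psiS (leqnn (size (c : {poly B n})))) big_ord_recl coefMX /= !raddf0 add0r raddf_sum;
  apply: eq_bigr => j _.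
by rewrite /= coefMX /= tmul_last -exprSr.
Qed.

Lemma psi_first_var n (c : B n.+1) : psi (first_var n * c) = tmul ord0 xi (psi c).
Proof.
elim: n c => [|n IH] c.
  by rewrite (_ : ord0 = ord_max); [exact: psi_last_var|apply: val_inj].
rewrite (_ : ord0 = fintype.lift ord_max ord0); last exact: val_inj.
rewrite [first_var _]/= (@psiS _ _ (size (c : {poly B n.+1}))); last first.
  by rewrite mul_polyC size_scale_leq.
rewrite (psiS (leqnn (size (c : {poly B n.+1})))) raddf_sum; apply: eq_bigr => j _ /=.
by rewrite coefCM IH tmul_lift.
Qed.

(* As a map from 'I_n.+1 to itself: the factor i + 1 becomes a unit instead of disappearing. *)
Definition merge_next n (i : nat) (k : 'I_n.+1) : 'I_n.+1 :=
  if val k == i.+1 then inord i else k.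

(** The subgroup [L_(n+1)] of the overview. *)
Definition chain n (v : V n.+1) := forall i, (i < n)%N -> tensor_map (@merge_next n i) v = 0.

(** All products of neighbours but the last leave the new factor alone, hence act coefficientwise on
    a reduced polynomial; the last one substitutes the previous variable for the new one. *)
Lemma chainS n (b : {poly B n.+1}) : chain (psi (b : B n.+2)) <->
  (exists q, forall j, chain (psi (b - q * int_poly (B n.+1))`_j)) /\ psi b.[last_var n] = 0.
Proof.
have keepE i : (i < n)%N -> @merge_next n.+1 i =1 keep_last (@merge_next n i).
  move=> iN; apply: ffun_last_eq => [k|].
    rewrite /keep_last liftK; apply: val_inj;
      rewrite [RHS]lift_max /merge_next [\val (fintype.lift _ _)]lift_max.
    case: eqP => _; last by rewrite [LHS]lift_max.
    by rewrite inordK; [apply: inordK; lia|lia].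
  by rewrite /keep_last unlift_none /= /merge_next /= eqSS gtn_eqF.
have lastE : @merge_next n.+1 n =1 fintype.lift ord_max \o fold_last (ord_max : 'I_n.+1).
  apply: ffun_last_eq => [k|]; rewrite /= /fold_last ?liftK ?unlift_none /merge_next.
    by rewrite [\val (fintype.lift _ _)]lift_max ltn_eqF.
  by rewrite eqxx; apply: val_inj; rewrite [RHS]lift_max; apply: inordK.
have lastP : tensor_map (@merge_next n.+1 n) (psi (b : B n.+2)) = 0 <-> psi b.[last_var n] = 0.
  rewrite -(psi_horner b (@psi_last_var n)) (eq_tensor_map _ lastE) -tensor_map_comp.
  split=> [|->]; last by rewrite raddf0.
  (* [merge_next] leaves a unit in the last place; folding this place into factor 0 is a left
     inverse of adding it. *)
  apply: (tensor_map_inj (psi := fold_last ord0)) => k; by rewrite /fold_last liftK.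
have sumE i (r : {poly B n.+1}) N : (i < n)%N -> (size r <= N)%N ->
    tensor_map (@merge_next n.+1 i) (psi (r : B n.+2)) =
    \sum_(j < N) adjoin (xi ^+ j) (tensor_map (@merge_next n i) (psi r`_j)).
  move=> iN rN; rewrite (eq_tensor_map _ (keepE i iN)) (psiS rN) raddf_sum.
  by apply: eq_bigr => j _ /=; rewrite tensor_map_adjoin.
split=> [h|[/(psi_test (K := fun c => chain (psi c)))[r hr cr] hl] i].
  split; last by apply/lastP/h.
  exists (Pdiv.Ring.rdivp b (int_poly (B n.+1))) => j i iN.
  rewrite {1}(rdivp_eq (int_poly_monic (B n.+1)) b) addrC addKr.
  case: (ltnP j d) => [jd|dj]; last first.
    by rewrite nth_default ?raddf0 ?(leq_trans (size_rem b)).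
  apply: (@adjoin_free _ (fun j => tensor_map (@merge_next n i)
    (psi (Pdiv.Ring.rmodp b (int_poly (B n.+1)))`_j))) => //.
  by rewrite -(sumE _ _ _ iN (size_rem b)) -psi_rem h // ltnS ltnW.
rewrite ltnS leq_eqVlt => /orP[/eqP->|iN]; first exact/lastP.
by rewrite hr (sumE _ _ _ iN (leqnn _)) big1 // => j _; rewrite cr ?raddf0.
Qed.

Lemma chain_subg n : subg (@chain n).
Proof.
by split=> [|x y hx hy] i iN; rewrite ?raddf0 // raddfB /= hx // hy // subrr.
Qed.

Lemma chain_mul n (b c : B n.+1) : chain (psi c) -> chain (psi (b * c)).
Proof.
elim: n b c => [|n IH] b c; first by move=> _ i.
move=> /chainS[[q hq] hl]; apply/chainS; split; last by rewrite hornerM psi_ker_mul.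
exists (b * q) => j; rewrite -mulrA -mulrBr coefM raddf_sum.
by apply: subg_sum => [|i _]; [apply: chain_subg|apply: IH].
Qed.

(** The d coordinates along the last factor embed [V_(n+1)] into d copies of [V_n]. This is what
    later makes [M_n] free. *)
Lemma tensor_embedding n : exists K (e : {additive V n -> 'rV[int]_K}), injective e.
Proof.
elim: n => [|n [K [e einj]]].
  have lin (a : {ffun 'I_0 -> A}) (i : 'I_0) (u v : A) :
    (const_mx 1 : 'rV[int]_1) = const_mx 1 + const_mx 1 by case: i.
  exists 1%N, (tensor_lift (F := fun=> const_mx 1 : 'rV[int]_1) lin).
  apply: raddf_inj => x; have [b <-] := psi_surj x.
  rewrite psi0E raddfMz /= tensor_lift_pure => /rowP/(_ 0).
  by rewrite -scaler_int !mxE mulr1 intz => ->; rewrite mulr0z.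
pose f (v : V n.+1) : 'rV[int]_(d * K) :=
  mxvec (\matrix_(j < d, i < K) e (tcoord (rem_coef j) v) 0 i).
have fB : zmod_morphism f.
  by move=> x y; rewrite /f -raddfB; congr mxvec; apply/matrixP => j i; rewrite !mxE !raddfB !mxE.
pose m := GRing.isZmodMorphism.Build _ _ f fB.
exists (d * K)%N, (HB.pack_for {additive V n.+1 -> 'rV[int]_(d * K)} f m).
apply: raddf_inj => x; have [b <-] := psi_surj x.
rewrite /= /f psi_rem => /(congr1 vec_mx); rewrite mxvecK raddf0 => /matrixP h.
set r := Pdiv.Ring.rmodp _ _ in h *.
have rd : (size r <= d)%N by apply: size_rem.
rewrite (psiS rd) big1 // => j _.
suff -> : psi (r`_j : B n) = 0 by rewrite raddf0.
apply: einj; rewrite raddf0; apply/rowP => i; have := h j i; rewrite !mxE => <-.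
rewrite (psiS rd) raddf_sum (bigD1 j) //= big1 ?addr0 => [|k kj].
  by rewrite tcoord_adjoin /= rem_coefX // eqxx mulr1z.
have kj' : (k : nat) == j = false by apply: negPf.
by rewrite tcoord_adjoin /= rem_coefX // eq_sym kj' mulr0z.
Qed.

End Presentation.
Arguments psi [A] pi [n] _ : simpl never.

(** * The two-periodic subquotients *)

Lemma horner_int_poly (P : {poly int}) (R : comNzRingType) (a : R) :
  (int_poly P R).[a] = \sum_(j < size P) a ^+ j *~ P`_j.
Proof.
rewrite /int_poly (@horner_coef_wide _ (size P)) ?size_poly //.
by apply: eq_bigr => j _; rewrite coef_map /= mulrzl.
Qed.

Lemma int_polyC (P : {poly int}) (R : comNzRingType) :
  int_poly P {poly R} = (int_poly P R)^:P.
Proof. by rewrite /int_poly -map_poly_comp; apply: eq_map_poly => k /=; rewrite rmorph_int. Qed.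

Lemma horner_int_polyX (P : {poly int}) (R : comNzRingType) :
  (int_poly P {poly R}).['X] = int_poly P R.
Proof. by rewrite int_polyC -[LHS]/(int_poly P R \Po 'X) comp_polyXr. Qed.

Lemma horner_int_polyC (P : {poly int}) (R : comNzRingType) (a : R) :
  (int_poly P {poly R}).[a%:P] = (int_poly P R).[a]%:P.
Proof. by rewrite int_polyC horner_map. Qed.

(** * Divided differences of [P] *)

Section DividedDifference.
Variable P : {poly int}.

Definition delta (R : nzRingType) (a b : R) : R :=
  \sum_(j < size P) (\sum_(i < j) a ^+ (j.-1 - i) * b ^+ i) *~ P`_j.

Lemma deltaE (R : comNzRingType) (a b : R) :
  (a - b) * delta a b = (int_poly P R).[a] - (int_poly P R).[b].
Proof.
rewrite !horner_int_poly -sumrB mulr_sumr; apply: eq_bigr => j _.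
by rewrite -mulrzr mulrA -subrXX mulrzr mulrzBl.
Qed.

Lemma delta_sym (R : comNzRingType) (a b : R) : delta a b = delta b a.
Proof.
apply: eq_bigr => j _; congr (_ *~ _).
rewrite (reindex_inj rev_ord_inj); apply: eq_bigr => i _ /=.
case: j i => j _ [i /= ij]; rewrite mulrC; congr (_ ^+ _ * _ ^+ _); lia.
Qed.

Lemma rmorph_delta (R S : comNzRingType) (f : {rmorphism R -> S}) a b :
  f (delta a b) = delta (f a) (f b).
Proof.
rewrite rmorph_sum; apply: eq_bigr => j _; rewrite rmorphMz rmorph_sum; congr (_ *~ _).
by apply: eq_bigr => i _; rewrite rmorphM !rmorphXn.
Qed.

Lemma deltaXE (R : comNzRingType) (a : R) :
  ('X - a%:P) * delta 'X a%:P = int_poly P R - (int_poly P R).[a]%:P.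
Proof. by rewrite deltaE horner_int_polyX horner_int_polyC. Qed.

Lemma horner_delta (R : comNzRingType) (a b : R) : (delta 'X a%:P).[b] = delta b a.
Proof.
rewrite -[LHS]/(horner_eval b _) rmorph_delta /=.
by rewrite /horner_eval hornerX hornerC.
Qed.

(** Differentiate (X - a) D(X,a) = P(X) - P(a) and set X = a. The derivative of [P] enters the final
    answer through this identity. *)
Lemma delta_diag (R : comNzRingType) (a : R) : delta a a = (int_poly P^`() R).[a].
Proof.
have /(congr1 (fun q => (q^`()).[a])) := deltaXE a.
rewrite derivM derivB derivX derivC subr0 mul1r hornerD hornerM hornerXsubC subrr mul0r addr0.
by rewrite horner_delta derivB derivC subr0 deriv_map.
Qed.

Lemma delta_monic (R : comNzRingType) (a : R) : P \is monic -> (1 < size P)%N ->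
  delta 'X a%:P \is monic.
Proof.
move=> Pm Ps; have := deltaXE a; have Pm' := int_poly_monic Pm R.
have sP := size_int_poly Pm R.
have : int_poly P R - (int_poly P R).[a]%:P \is monic.
  rewrite monicE lead_coefDl ?(monicP Pm') // sP size_polyN (leq_ltn_trans _ Ps) //.
  exact: size_polyC_leq1.
move=> h e; rewrite -e in h.
by rewrite monicMl ?monicXsubC in h.
Qed.

Lemma size_delta (R : comNzRingType) (a : R) : P \is monic -> (1 < size P)%N ->
  size (delta 'X a%:P) = (size P).-1.
Proof.
move=> Pm Ps; have /(congr1 (fun q => size (polyseq q))) := deltaXE a.
rewrite size_Mmonic ?delta_monic ?polyXsubC_eq0 // size_XsubC.
rewrite size_polyDl ?size_polyN ?size_int_poly // ?(leq_ltn_trans (size_polyC_leq1 _)) //.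
by move=> /= <-.
Qed.

End DividedDifference.

(** * Cancelling monic factors modulo an ideal of coefficients *)

Section MonicCancel.
Variables (B : comNzRingType) (K : B -> Prop).
Hypotheses (hK : subg K) (Kmul : forall b c, K c -> K (b * c)).
Local Notation inK q := (forall j, K (q : {poly B})`_j).

Lemma coefP_sub : subg (fun q : {poly B} => inK q).
Proof.
by split=> [|p q hp hq] j; rewrite ?coef0 ?coefB; [apply: subg0|apply: subgB].
Qed.

Lemma coefP_mul (q p : {poly B}) : inK p -> inK (q * p).
Proof. by move=> hp j; rewrite coefM; apply: subg_sum => // i _; apply: Kmul. Qed.

Lemma coefP_C c : K c -> inK c%:P.
Proof. by move=> hc j; rewrite coefC; case: eqP => _ //; apply: subg0. Qed.

Lemma coefP_horner (p : {poly B}) a : inK p -> K p.[a].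
Proof.
move=> hp; rewrite horner_coef; apply: subg_sum => // i _.
by rewrite mulrC; apply: Kmul.
Qed.

(* The leading coefficient of q is a coefficient of q * M - r. *)
Lemma monic_cancel_rem (M q r : {poly B}) : M \is monic -> (size r < size M)%N ->
  inK (q * M - r) -> inK q.
Proof.
move=> Mm rM; move: {2}(size q) (leqnn (size q)) => n.
elim: n q => [|n IH] q; first by rewrite leqn0 size_poly_eq0 => /eqP-> _ j; rewrite coef0;
  apply: subg0.
move=> sq hq; pose q' := q - q`_n *: 'X^n.
have sq' : (size q' <= n)%N.
  apply/leq_sizeP => j nj; rewrite coefB coefZ coefXn; case: eqP => [->|/eqP jn].
    by rewrite mulr1 subrr.
  by rewrite mulr0 subr0 nth_default // (leq_trans sq) // ltn_neqAle eq_sym jn.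
have Mgt0 : (0 < size M)%N by rewrite size_poly_gt0 monic_neq0.
have eq : q = q' + q`_n *: 'X^n by rewrite subrK.
have Kn : K q`_n.
  have := hq (n + (size M).-1)%N; rewrite coefB [r`__]nth_default ?subr0; last first.
    by rewrite -ltnS (leq_trans rM) // -[size M]prednK // ltnS leq_addl.
  have -> // : (q * M)`_(n + (size M).-1) = q`_n.
  rewrite {1}eq mulrDl coefD [(q' * M)`__]nth_default ?add0r; last first.
    by rewrite (leq_trans (size_polyMleq _ _)) // -subn1 leq_subLR; lia.
  rewrite -scalerAl coefZ coefXnM ltnNge leq_addr /= addKn.
  by rewrite -[M`__]/(lead_coef M) (monicP Mm) mulr1.
have KX p : inK (q`_n *: p).
  by move=> j; rewrite coefZ mulrC; apply: Kmul.
move=> j; rewrite eq; apply: (subgD coefP_sub); last exact: KX.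
apply: IH => // {}j; have -> : q' * M - r = (q * M - r) - q`_n *: ('X^n * M).
  by rewrite /q' mulrBl -scalerAl addrAC.
by apply: (subgB coefP_sub) => //; apply: KX.
Qed.

Lemma monic_cancel (M q : {poly B}) : M \is monic -> inK (q * M) -> inK q.
Proof.
move=> Mm hq; apply: (@monic_cancel_rem M q 0 Mm); last by rewrite subr0.
by rewrite size_poly0 size_poly_gt0 monic_neq0.
Qed.

(** Since [r] is too short to affect the leading coefficients, the cancellation above puts [q] in
    K[X], and [r] follows. Thus reduced representatives vanish modulo K[X] + (M) only if they vanish
    modulo K[X]. *)
Lemma monic_small (M q r : {poly B}) : M \is monic -> (size r < size M)%N ->
  inK (r - q * M) -> inK r.
Proof.
move=> Mm rM h; have hq : inK q.
  apply: (@monic_cancel_rem M q r) => //.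
  by move=> j; rewrite -opprB coefN; apply: subgN.
by rewrite -[r](subrK (q * M)); apply: (subgD coefP_sub) => //; rewrite mulrC; apply: coefP_mul.
Qed.

Lemma factor_coefP (p : {poly B}) a : inK p ->
  exists2 u, p = u * ('X - a%:P) + p.[a]%:P & inK u.
Proof.
move=> hp; have /factor_theorem[u hu] : root (p - p.[a]%:P) a.
  by rewrite rootE hornerD hornerN hornerC subrr.
exists u; first by rewrite -hu subrK.
apply: (@monic_cancel ('X - a%:P)); first exact: monicXsubC.
by rewrite -hu; apply: (subgB coefP_sub) => //; apply: coefP_C; apply: coefP_horner.
Qed.

Lemma factor_size (p u : {poly B}) a c : p = u * ('X - a%:P) + c%:P ->
  (size u <= (size p).-1)%N.
Proof.
move=> ->; have [->|u0] := eqVneq u 0; first by rewrite size_poly0.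
have su : size (u * ('X - a%:P)) = (size u).+1.
  by rewrite size_Mmonic ?monicXsubC // size_XsubC addn2.
rewrite size_polyDl su //= (leq_ltn_trans (size_polyC_leq1 _)) // ltnS.
by rewrite size_poly_gt0.
Qed.

End MonicCancel.

Section AlphaBeta.
Variables (P : {poly int}) (R : nzRingType) (J L : R -> Prop) (y w : R).

(** The groups alpha and beta of the overview, as preimages in a polynomial ring: [J] is the kernel
    of the map to the tensor power, so [J x] reads as x = 0 there. *)
Definition alphaZ v := L v /\ J ((y - w) * v).
Definition alphaD v := exists2 l, L l & J (v - delta P w y * l).
Definition betaZ v := L v /\ J (delta P w y * v).
Definition betaD v := exists2 l, L l & J (v - (w - y) * l).

End AlphaBeta.

(** * Adjoining one variable *)

Section Step.
Variables (P : {poly int}) (B : comNzRingType).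
Hypotheses (Pm : P \is monic) (Ps : (1 < size P)%N).
Local Notation PB := (int_poly P B).
Local Notation inK K q := (forall j, K (q : {poly B})`_j).
Variables (J L : B -> Prop) (y w : B) (J' L' : {poly B} -> Prop).
Hypotheses (hJ : subg J) (hL : subg L) (JL : forall x, J x -> L x).
Hypotheses (Jmul : forall b c, J c -> J (b * c)) (Lmul : forall b c, L c -> L (b * c)).
Hypotheses (Jy : J PB.[y]) (Jw : J PB.[w]).
(** This and [L'E] are the recursive descriptions [psi_ker] and [chainS]. The polynomial variable is
    the new last variable, [w] the previous one and [y] the first. *)
Hypothesis J'E : forall b, J' b <-> exists q, inK J (b - q * PB).
Hypothesis L'E : forall b, L' b <-> (exists q, inK L (b - q * PB)) /\ J b.[w].

Let PBm : PB \is monic := int_poly_monic Pm B.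
Let dl : {poly B} := delta P 'X y%:P.
Let dlm : dl \is monic. Proof. exact: delta_monic. Qed.
Let dlE : ('X - y%:P) * dl = PB - PB.[y]%:P. Proof. exact: deltaXE. Qed.

Lemma step_J'0 (q : {poly B}) : inK J q -> J' q.
Proof. by move=> h; apply/J'E; exists 0; rewrite mul0r subr0. Qed.

Lemma step_J'P q : J' (q * PB).
Proof. by apply/J'E; exists q; rewrite subrr => j; rewrite coef0; apply: subg0. Qed.

Lemma step_J'mul b c : J' c -> J' (b * c).
Proof.
move=> /J'E[q hq]; apply/J'E; exists (b * q); rewrite -mulrA -mulrBr.
exact: coefP_mul.
Qed.

Lemma step_J'_subg : subg J'.
Proof.
split=> [|a b /J'E[q hq] /J'E[r hr]].
  by apply: step_J'0 => j; rewrite coef0; apply: subg0.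
apply/J'E; exists (q - r); have -> : a - b - (q - r) * PB = (a - q * PB) - (b - r * PB) by ring.
exact: subgB (coefP_sub hJ) _ _ hq hr.
Qed.
Let hJ' := step_J'_subg.

Lemma step_J'C c q : J c -> J' (q * c%:P).
Proof. by move=> hc; apply: step_J'mul; apply: step_J'0; apply: coefP_C. Qed.

Lemma step_J'_eval a (b : {poly B}) : J PB.[a] -> J' b -> J b.[a].
Proof.
move=> ha /J'E[q hq]; rewrite -[b](subrK (q * PB)) hornerD hornerM.
by apply: subgD => //; [apply: coefP_horner|apply: Jmul].
Qed.

Lemma step_J'_small (r : {poly B}) : (size r < size P)%N -> J' r -> inK J r.
Proof. by rewrite -(size_int_poly Pm B) => sr /J'E[q]; apply: monic_small. Qed.

Lemma step_L'_subg : subg L'.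
Proof.
split=> [|a b /L'E[[q hq] ha] /L'E[[r hr] hb]]; apply/L'E.
  split; last by rewrite horner0; apply: subg0.
  by exists 0 => j; rewrite mul0r subr0 coef0; apply: subg0.
split; last by rewrite hornerD hornerN; apply: subgB.
exists (q - r); have -> : a - b - (q - r) * PB = (a - q * PB) - (b - r * PB) by ring.
exact: subgB (coefP_sub hL) _ _ hq hr.
Qed.

(** Replacing [b] by its remainder modulo [P] makes the degree less than d, and by [monic_small] the
    coefficients of that remainder lie in [L] themselves. *)
Lemma step_L'_rem b : L' b -> exists r : {poly B},
  [/\ (size r <= (size P).-1)%N, inK L r, J r.[w] & J' (b - r)].
Proof.
move=> hb; have /L'E[[q hq] hw] := hb.
pose s := Pdiv.Ring.rdivp b PB; pose r := Pdiv.Ring.rmodp b PB.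
have sr : (size r < size PB)%N by apply: Pdiv.CommonRing.ltn_rmodpN0; apply: monic_neq0.
have eb : b = s * PB + r by apply: Pdiv.RingMonic.rdivp_eq.
have hbr : J' (b - r) by rewrite eb addrK; apply: step_J'P.
exists r; split=> //; first by move: sr; rewrite (size_int_poly Pm); case: (size P) Ps.
- apply: (@monic_small _ _ hL Lmul PB (q - s)) => //.
  by have -> : r - (q - s) * PB = b - q * PB by rewrite eb; ring.
- by have := step_J'_eval Jw hbr; rewrite hornerD hornerN -opprB => /(subgN hJ);
    rewrite opprK; apply: (subgDr hJ); apply: subgN.
Qed.

Lemma step_factor (r : {poly B}) : inK L r -> J r.[w] -> exists u : {poly B},
  [/\ J' (r - ('X - w%:P) * u), inK L u & (size u <= (size r).-1)%N].
Proof.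
move=> hr hw; have [u eu hu] := factor_coefP hL Lmul w hr.
exists u; split=> //; last exact: factor_size eu.
by rewrite {1}eu mulrC addrC addKr -[_%:P]mul1r; apply: step_J'C.
Qed.

(** Modulo [J'] the product (X - y) D(X,y) = P - P(y) vanishes, so D(X,y) a equals a(y) D(X,y). This
    has degree below that of [P], hence vanishes only if its coefficients do, and the leading one is
    a(y). *)
Lemma step_dl a : J' (dl * a) <-> J a.[y].
Proof.
have /factor_theorem[k hk] : root (a - a.[y]%:P) y.
  by rewrite rootE hornerD hornerN hornerC subrr.
have e : dl * a = a.[y]%:P * dl + k * (PB - PB.[y]%:P).
  by rewrite -dlE -{1}[a](subrK a.[y]%:P) hk; ring.
have hk' : J' (k * (PB - PB.[y]%:P)).
  by rewrite mulrBr; apply: (subgB hJ'); [apply: step_J'P|apply: step_J'C].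
have -> : J' (dl * a) <-> J' (a.[y]%:P * dl).
  by rewrite e; split=> [/(subgDr hJ' hk')//|h]; apply: (subgD hJ').
split=> [h|h]; last by rewrite mulrC; apply: step_J'C.
have := step_J'_small _ h; rewrite mul_polyC.
have sdl : size dl = (size P).-1 by apply: size_delta.
rewrite (leq_ltn_trans (size_scale_leq _ _)) ?sdl; last by case: (size P) Ps.
move/(_ isT (size P).-2); rewrite coefZ.
by rewrite -sdl -[dl`__]/(lead_coef dl) (monicP dlm) mulr1.
Qed.

Lemma step_L'_mulX (u : {poly B}) : inK L u -> L' (('X - w%:P) * u).
Proof.
move=> hu; apply/L'E; split; last by rewrite hornerM hornerXsubC subrr mul0r; apply: subg0.
by exists 0; rewrite mul0r subr0; apply: coefP_mul.
Qed.

(** Modulo [J'] an element of [L'] is (X - w) u with u over [L], which at X = y becomes (y - w)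
    u(y). So (w - y) L is the image of [L'] under multiplication of the last factor into the
    first. *)
Lemma betaD_eval v : betaD J L y w v <-> exists2 a, L' a & J (v - a.[y]).
Proof.
split=> [[l hl hv]|[a /step_L'_rem[r [_ hr hw har]] hv]].
  exists (('X - w%:P) * - l%:P).
    by apply: step_L'_mulX => j; rewrite coefN; apply: subgN => //; apply: coefP_C.
  by rewrite hornerM hornerXsubC hornerN hornerC mulrN -mulNr opprB.
have [u eu hu] := factor_coefP hL Lmul w hr.
exists (- u.[y]); first by apply: subgN => //; apply: coefP_horner.
have -> : v - (w - y) * - u.[y] = (v - a.[y]) + (a - r).[y] + r.[w].
  have ry : r.[y] = u.[y] * (y - w) + r.[w].
    by rewrite {1}eu hornerD hornerC hornerM hornerXsubC.
  by rewrite hornerD hornerN ry; ring.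
by do 2?[apply: (subgD hJ)] => //; apply: step_J'_eval.
Qed.

(** The exact sequence 0 -> M_(n+1) -> L_(n+1) -> d L_(n+1) -> 0, in which [step_dl] identifies the
    kernel of evaluation at [y] with that of D(X,y). *)
Lemma eval_iso : subq_iso (horner_eval y) L' (betaZ P J' L' y%:P 'X) (betaD J L y w) J.
Proof.
split=> [a b|a ha|a ha|v /betaD_eval[a ha hv]]; rewrite /horner_eval.
- by rewrite hornerD hornerN.
- by apply/betaD_eval; exists a; rewrite ?subrr //; apply: subg0.
- by split=> [[_ /step_dl]|h] //; split=> //; apply/step_dl.
- by exists a.
Qed.

(** Up to [J'], the elements of [L'] annihilated by X - y are constant multiples of D(X,y), and c
    D(X,y) satisfies the condition at X = w exactly when D(w,y) c vanishes. *)
Lemma beta_alpha_iso : subq_iso (fun v => v%:P * dl)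
  (betaZ P J L y w) (betaD J L y w) (alphaZ J' L' y%:P 'X) (alphaD P J' L' y%:P 'X).
Proof.
have dlw : dl.[w] = delta P w y by apply: horner_delta.
split=> [a b|v [hv hd]|v [hv hd]|a [ha hJa]].
- by rewrite rmorphB /= mulrBl.
- split.
    apply/L'E; split; last by rewrite hornerM hornerC dlw mulrC.
    by exists 0 => j; rewrite mul0r subr0 coefCM mulrC; apply: Lmul.
  have -> : (y%:P - 'X) * (v%:P * dl) = v%:P * PB.[y]%:P - v%:P * PB.
    by rewrite -mulrBr -[PB.[y]%:P - _]opprB -dlE; ring.
  by apply: (subgB hJ'); [apply: step_J'C|apply: step_J'P].
- split=> [[l hl hvl]|[a ha hva]].
    (* As (X - y) dl vanishes modulo [J'], one has (X - w) dl = (y - w) dl; this explains the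
       sign. *)
    exists (('X - w%:P) * - l%:P).
      by apply: step_L'_mulX => j; rewrite coefN; apply: subgN => //; apply: coefP_C.
    have -> : v%:P * dl - dl * (('X - w%:P) * - l%:P) =
        dl * (v - (w - y) * l)%:P + (l%:P * PB - l%:P * PB.[y]%:P).
      by rewrite -mulrBr -dlE !(rmorphB, rmorphM) /=; ring.
    apply: (subgD hJ'); first exact: step_J'C.
    by apply: (subgB hJ'); [apply: step_J'P|apply: step_J'C].
  apply/betaD_eval; exists a => //.
  have := hva; have -> : v%:P * dl - dl * a = dl * (v%:P - a) by ring.
  by move/step_dl; rewrite hornerD hornerN hornerC.
- have [r [sr hr hw har]] := step_L'_rem ha.
  (* [c] is the coefficient of X^(d-1) in [r], the degree of the monic [dl]. Removing [c dl] lowers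
     the degree enough for (X - y) s to stay reduced modulo [P]; its vanishing then forces [s] to
     vanish modulo [J]. *)
  pose c := r`_(size P).-2; have hc : L c by apply: hr.
  have sdl : size dl = (size P).-1 by apply: size_delta.
  pose s := r - c%:P * dl.
  have ss : (size s <= (size P).-2)%N.
    apply/leq_sizeP => j; rewrite leq_eqVlt => /orP[/eqP<-|jd].
      rewrite coefB coefCM -sdl -[dl`__]/(lead_coef dl) (monicP dlm) mulr1.
      by rewrite /c sdl subrr.
    rewrite coefB coefCM !nth_default ?mulr0 ?subrr ?sdl //; first by case: (size P).-1 jd.
    by apply: leq_trans sr _; case: (size P).-1 jd.
  have hs : J' (('X - y%:P) * s).
    have -> : ('X - y%:P) * s = - ((y%:P - 'X) * a) - ('X - y%:P) * (a - r) - c%:P * (PB -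
      PB.[y]%:P).
      by rewrite -dlE /s; ring.
    apply: (subgB hJ'); last first.
      by rewrite mulrBr; apply: (subgB hJ'); [apply: step_J'P|apply: step_J'C].
    by apply: (subgB hJ'); [apply: subgN|apply: step_J'mul].
  have hsJ : inK J s.
    apply: (@monic_cancel _ _ hJ Jmul ('X - y%:P)); first exact: monicXsubC.
    rewrite mulrC; apply: step_J'_small => //.
    rewrite (leq_ltn_trans (size_polyMleq _ _)) // size_XsubC /=.
    by move: ss; case: (size P) Ps => // -[|n].
  have hac : J' (a - c%:P * dl).
    have -> : a - c%:P * dl = (a - r) + s by rewrite /s; ring.
    by apply: (subgD hJ') => //; apply: step_J'0.
  exists c.
    split=> //; have /L'E[_ haw] := ha; have := step_J'_eval Jw hac.
    rewrite hornerD hornerN hornerM hornerC dlw -opprB mulrC => /(subgN hJ).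
    by rewrite opprK; apply: (subgDr hJ); apply: subgN.
  exists 0; first exact: (subg0 step_L'_subg).
  by rewrite mulr0 subr0.
Qed.

(** By [step_dl] the elements annihilated by D(X,y) are those vanishing at X = y, and v (X - w)
    vanishes there exactly when (y - w) v does. *)
Lemma alpha_beta_iso : subq_iso (fun v => v%:P * ('X - w%:P))
  (alphaZ J L y w) (alphaD P J L y w) (betaZ P J' L' y%:P 'X) (betaD J' L' y%:P 'X).
Proof.
pose f : {poly B} := delta P 'X w%:P.
have fm : f \is monic by apply: delta_monic.
have fE : ('X - w%:P) * f = PB - PB.[w]%:P by apply: deltaXE.
have fy : f.[y] = delta P w y by rewrite horner_delta delta_sym.
have hPw q : J' (q * (PB - PB.[w]%:P)).
  by rewrite mulrBr; apply: (subgB hJ'); [apply: step_J'P|apply: step_J'C].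
split=> [a b|v [hv hd]|v [hv hd]|a [ha /step_dl hJa]].
- by rewrite rmorphB /= mulrBl.
- split; first by rewrite mulrC; apply: step_L'_mulX; apply: coefP_C.
  by apply/step_dl; rewrite hornerM hornerC hornerXsubC mulrC.
- split=> [[l hl hvl]|[a ha hva]].
    (* Expand f = D(X,w) at [y] as k (X - y) + D(w,y). Since (X - w) f vanishes modulo [J'], the
       product D(w,y) (X - w) becomes a multiple of X - y. *)
    have /factor_theorem[k hk] : root (f - f.[y]%:P) y.
      by rewrite rootE hornerD hornerN hornerC subrr.
    exists (('X - w%:P) * (- k * l%:P)).
      by apply: step_L'_mulX; apply: coefP_mul => //; apply: coefP_C.
    have -> : v%:P * ('X - w%:P) - ('X - y%:P) * (('X - w%:P) * (- k * l%:P)) =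
        ('X - w%:P) * (v - delta P w y * l)%:P + l%:P * (PB - PB.[w]%:P).
      have fk : f = k * ('X - y%:P) + (delta P w y)%:P by rewrite -fy -hk subrK.
      by rewrite -fE fk !(rmorphB, rmorphM) /=; ring.
    by apply: (subgD hJ') => //; apply: step_J'C.
  have [r [_ hr hw har]] := step_L'_rem ha.
  have [u [hru hu su]] := step_factor hr hw.
  have : J' (('X - w%:P) * (v%:P - ('X - y%:P) * u)).
    have -> : ('X - w%:P) * (v%:P - ('X - y%:P) * u) =
       (v%:P * ('X - w%:P) - ('X - y%:P) * a) + ('X - y%:P) * (a - r) +
       ('X - y%:P) * (r - ('X - w%:P) * u) by ring.
    by do 2?[apply: (subgD hJ')] => //; apply: step_J'mul.
  move=> /J'E[q hq].
  (* [P] is (X - w) f up to P(w), so the monic factor X - w cancels and v - (X - y) u = q f modulo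
     [J]. As [f] is monic too, [q] has coefficients in [L], and X = y yields v = q(y) D(w,y). *)
  have hq' : inK J (v%:P - ('X - y%:P) * u - q * f).
    apply: (@monic_cancel _ _ hJ Jmul ('X - w%:P)); first exact: monicXsubC.
    have -> : (v%:P - ('X - y%:P) * u - q * f) * ('X - w%:P) =
       ('X - w%:P) * (v%:P - ('X - y%:P) * u) - q * PB + q * PB.[w]%:P.
      have -> : q * PB = q * (('X - w%:P) * f) + q * PB.[w]%:P by rewrite fE; ring.
      ring.
    by apply: (subgD (coefP_sub hJ)) => //; apply: coefP_mul => //; apply: coefP_C.
  have hLq : inK L q.
    apply: (@monic_cancel _ _ hL Lmul f) => //.
    have -> : q * f = v%:P - ('X - y%:P) * u - (v%:P - ('X - y%:P) * u - q * f) by ring.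
    apply: (subgB (coefP_sub hL)); last by move=> j; apply/JL/hq'.
    by apply: (subgB (coefP_sub hL)); [apply: coefP_C|apply: coefP_mul].
  exists q.[y]; first exact: coefP_horner.
  have := coefP_horner hJ Jmul y hq'.
  by rewrite !(hornerD, hornerN, hornerM, hornerC, hornerX) subrr mul0r subr0 fy mulrC.
- have [r [_ hr hw har]] := step_L'_rem ha.
  have [u [hru hu su]] := step_factor hr hw.
  have [k ek hk] := factor_coefP hL Lmul y hu.
  (* Modulo [J'], a = (X - w) u and u = k (X - y) + u(y): the first summand falls into [betaD], the
     second is the image of u(y). *)
  exists u.[y].
    split; first exact: coefP_horner.
    have -> : (y - w) * u.[y] = a.[y] - (a - r).[y] - (r - ('X - w%:P) * u).[y].
      rewrite !(hornerD, hornerN, hornerM, hornerC) hornerX; ring.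
    by do 2?[apply: (subgB hJ)] => //; apply: step_J'_eval.
  exists (('X - w%:P) * k); first exact: step_L'_mulX.
  have -> : a - u.[y]%:P * ('X - w%:P) - ('X - y%:P) * (('X - w%:P) * k) =
     (a - r) + (r - ('X - w%:P) * u) by rewrite {2}ek; ring.
  exact: (subgD hJ').
Qed.

(** Modulo [J'], [L'] consists of the products (X - w) u with u over [L] of degree less than d - 1,
    and X - w cancels: this amounts to d - 1 copies of L / J. *)
Lemma chain_rank l : subq_rank L J l -> subq_rank L' J' (l * (size P).-2).
Proof.
move=> [I [v [<- vL vf vs]]].
pose e (x : I * 'I_(size P).-2) : {poly B} := ('X - w%:P) * ((v x.1)%:P * 'X^(x.2)).
pose S (c : I * 'I_(size P).-2 -> int) : {poly B} :=
  \sum_(x : I * 'I_(size P).-2) ((v x.1)%:P * 'X^(x.2)) *~ c x.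
have eE c : \sum_x e x *~ c x = ('X - w%:P) * S c.
  by rewrite mulr_sumr; apply: eq_bigr => x _; rewrite -mulrzAr.
have SE c (j : 'I_(size P).-2) : (S c)`_j = \sum_k v k *~ c (k, j).
  have -> : S c = \sum_k \sum_(i < (size P).-2) ((v k)%:P * 'X^i) *~ c (k, i).
    by rewrite pair_bigA; apply: eq_bigr => -[k i] _.
  rewrite coef_sum.
  apply: eq_bigr => k _; rewrite coef_sum (bigD1 j) //= big1 => [|i /negPf ij].
    by rewrite addr0 -scaler_int coefZ coefCM coefXn eqxx mulr1 mulrzl.
  rewrite -scaler_int coefZ coefCM coefXn -[(j : nat) == _]/(j == i) eq_sym ij.
  by rewrite !mulr0.
have sS c : (size (S c) <= (size P).-2)%N.
  apply: (leq_trans (size_sum _ _ _)); apply/bigmax_leqP => x _.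
  rewrite -scaler_int (leq_trans (size_scale_leq _ _)) // mul_polyC.
  by rewrite (leq_trans (size_scale_leq _ _)) // size_polyXn.
exists (I * 'I_(size P).-2)%type, e; split=> [|x|c|a ha].
- by rewrite card_prod card_ord.
- apply: step_L'_mulX; rewrite mulrC; apply: coefP_mul => //; exact: coefP_C.
- rewrite eE => hc [k j].
  have hS : inK J (S c).
    apply: (@monic_cancel _ _ hJ Jmul ('X - w%:P)); first exact: monicXsubC.
    rewrite mulrC; apply: step_J'_small => //.
    rewrite (leq_ltn_trans (size_polyMleq _ _)) // size_XsubC /=.
    by move: (sS c); case: (size P) Ps => // -[|n].
  by have := hS j; rewrite SE => /vf; apply.
- have [r [sr hr hw har]] := step_L'_rem ha.
  have [u [hru hu su]] := step_factor hr hw.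
  pose m (j : 'I_(size P).-2) := s2val (cid2 (vs _ (hu j))).
  have m0 j : m j != 0 by rewrite /m; case: cid2.
  have /choice[c hc] (j : 'I_(size P).-2) : exists c : I -> int, J (u`_j *~ m j - \sum_k v k *~ c
    k).
    by rewrite /m; case: cid2.
  (* Each coefficient of [u] comes with its own multiplier [m j]; their product serves all of them,
     and [C] rescales accordingly. *)
  pose M := \prod_j m j; exists M; first by apply/prodf_neq0 => j _.
  pose C (x : I * 'I_(size P).-2) := c x.2 x.1 * \prod_(i | i != x.2) m i.
  exists C; rewrite eE.
  have -> : a *~ M - ('X - w%:P) * S C =
      (a - r) *~ M + (r - ('X - w%:P) * u) *~ M + ('X - w%:P) * (u *~ M - S C).
    by rewrite -(mulrzr a) -(mulrzr (a - r)) -(mulrzr (r - _)) -(mulrzr u); ring.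
  apply: (subgD hJ'); first by apply: (subgD hJ'); apply: (subgMz hJ').
  apply: step_J'mul; apply: step_J'0 => j; rewrite coefB -scaler_int coefZ mulrzl.
  case: (ltnP j (size P).-2) => jd; last first.
    rewrite !nth_default ?mul0rz ?subrr ?(leq_trans (sS _)) //; first exact: subg0.
    by move: su sr jd; move: (size u) (size r) (size P) => a1 a2 a3; lia.
  rewrite (SE C (Ordinal jd)) /M (bigD1 (Ordinal jd)) //= mulrzA.
  have -> : \sum_k v k *~ C (k, Ordinal jd) =
     (\sum_k v k *~ c (Ordinal jd) k) *~ \prod_(i | i != Ordinal jd) m i.
    by rewrite mulrz_suml; apply: eq_bigr => k _; rewrite -mulrzA.
  by rewrite -mulrzBl; apply: subgMz => //; apply: (hc (Ordinal jd)).
Qed.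

End Step.

(** * Normalisation of the Hochschild complex *)

(* Innermost conditions first, so that no condition still contains an if. *)
Ltac split_ifs := repeat match goal with
  | |- context [if ?b then _ else _] =>
      lazymatch b with
      | context [if _ then _ else _] => fail
      | _ => case: (boolP b) => ?
      end
  end.

Section Moore.
Variable A : comPzRingType.
Local Notation V n := (tensor A 'I_n).

(** [face_index] with a natural number as index, because the simplicial identities shift it across
    different lengths. *)
Definition face_map n (i : nat) (k : 'I_n.+2) : 'I_n.+1 :=
  inord ((if k <= i then k : nat else k.-1) %% n.+1)%N.
(** The value [i.+1] is skipped, and [tensor_map] inserts a unit there. *)
Definition degen_map n (i : nat) (k : 'I_n.+1) : 'I_n.+2 :=
  inord (if k <= i then k : nat else k.+1)%N.

Definition face n (i : nat) : V n.+2 -> V n.+1 := tensor_map (@face_map n i).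
Definition degen n (i : nat) : V n.+1 -> V n.+2 := tensor_map (@degen_map n i).
HB.instance Definition _ n i := GRing.Additive.on (@face n i).
HB.instance Definition _ n i := GRing.Additive.on (@degen n i).

Lemma val_face_map n i (k : 'I_n.+2) : (i < n.+2)%N ->
  @face_map n i k = (if k <= i then if k == n.+1 :> nat then 0 else k else k.-1)%N :> nat.
Proof.
move=> iN; have := ltn_ord k; rewrite /face_map inordK ?ltn_pmod //.
move: (nat_of_ord k) => m kN; case: leqP => ki; last by rewrite modn_small //; lia.
by case: eqP => [->|kn]; [rewrite modnn|rewrite modn_small //; lia].
Qed.

Lemma val_degen_map n i (k : 'I_n.+1) :
  @degen_map n i k = (if k <= i then k : nat else k.+1)%N :> nat.
Proof.
rewrite /degen_map inordK //; have := ltn_ord k; move: (nat_of_ord k) => m kN.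
by case: ifP => _; lia.
Qed.

Lemma face_face n i j (x : V n.+3) : (i < j)%N -> (j < n.+3)%N ->
  face i (face j x) = face j.-1 (face i x).
Proof.
move=> ij jn; rewrite /face !tensor_map_comp; apply: eq_tensor_map => k /=.
apply: ord_inj; rewrite !val_face_map; try lia.
have := ltn_ord k; move: (nat_of_ord k) => m mN.
by split_ifs; lia.
Qed.

Lemma face_degen_lt n i k (x : V n.+2) : (i < k)%N -> (k < n.+2)%N ->
  face i (degen k x) = degen k.-1 (face i x).
Proof.
move=> ik kn; rewrite /face /degen !tensor_map_comp; apply: eq_tensor_map => v /=.
apply: ord_inj; rewrite !(val_face_map, val_degen_map); try lia.
have := ltn_ord v; move: (nat_of_ord v) => m mN.
by split_ifs; lia.
Qed.

Lemma face_degen_gt n i k (x : V n.+2) : (k.+1 < i)%N -> (i < n.+3)%N ->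
  face i (degen k x) = degen k (face i.-1 x).
Proof.
move=> ik kn; rewrite /face /degen !tensor_map_comp; apply: eq_tensor_map => v /=.
apply: ord_inj; rewrite !(val_face_map, val_degen_map); try lia.
have := ltn_ord v; move: (nat_of_ord v) => m mN.
by split_ifs; lia.
Qed.

Lemma face_degen n i k (x : V n.+1) : (k < n.+1)%N -> (i == k) || (i == k.+1) ->
  face i (degen k x) = x.
Proof.
move=> kn ik; rewrite /face /degen !tensor_map_comp; apply: tensor_map_id => v /=.
apply: ord_inj; rewrite !(val_face_map, val_degen_map); last by case/orP: ik => /eqP->; lia.
have := ltn_ord v; move: (nat_of_ord v) => m mN.
by split_ifs; lia.
Qed.

Lemma hoch_diffE n (x : V n.+2) : hoch_diff x = \sum_(0 <= i < n.+2) face i x *~ (-1) ^+ i.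
Proof. by rewrite big_mkord. Qed.

Lemma hoch_diff_lead n (x : V n.+2) : (forall i, (i < n.+1)%N -> face i x = 0) ->
  hoch_diff x = face n.+1 x *~ (-1) ^+ n.+1.
Proof.
move=> h; rewrite hoch_diffE big_nat_recr //= big_nat_cond big1 ?add0r // => i.
by rewrite andbT => iN; rewrite h ?mul0rz.
Qed.

(** The term (i, j + 1) with i <= j cancels the term (j, i). *)
Lemma alternating_double_sum (W : zmodType) m (F : nat -> nat -> W) :
  (forall i j, (i < j)%N -> (j < m.+1)%N -> F i j = F j.-1 i) ->
  \sum_(i < m) \sum_(j < m.+1) F i j *~ ((-1) ^+ i * (-1) ^+ j) = 0.
Proof.
move=> hF; pose G i j := F i j *~ ((-1) ^+ i * (-1) ^+ j).
transitivity (\sum_(i < m) \sum_(j < m | (j <= i)%N) G i j +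
              \sum_(i < m) \sum_(j < m | (i <= j)%N) G i j.+1).
  rewrite -big_split; apply: eq_bigr => i _; rewrite (bigID (fun j : 'I_m.+1 => (j <= i)%N)) /=.
  congr (_ + _).
    by rewrite big_mkcond big_ord_recr /= leqNgt ltn_ord addr0 -big_mkcond.
  rewrite big_mkcond big_ord_recl /= add0r -big_mkcond; apply: eq_bigl => j.
  by rewrite -ltnNge.
rewrite [X in _ + X](exchange_big_dep xpredT) //= -big_split big1 // => i _ /=.
rewrite -big_split big1 // => j ji /=; rewrite /G (hF j i.+1) ?ltnS //=.
by rewrite -mulrzDr exprS mulrCA mulN1r mulrC subrr mulr0z.
Qed.

Lemma hoch_diffK n (x : V n.+3) : hoch_diff (hoch_diff x) = 0.
Proof.
rewrite [LHS]hoch_diffE big_mkord -[RHS](@alternating_double_sum _ n.+2 (fun i j => face i (face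
  j x))).
  apply: eq_bigr => i _; rewrite hoch_diffE big_mkord raddf_sum mulrz_suml;
    apply: eq_bigr => j _ /=.
  by rewrite raddfMz -mulrzA mulrC.
by move=> i j ij jn; apply: face_face.
Qed.

(** The faces k and k + 1 of s_k z both equal z and cancel, the lower ones vanish, and the higher
    ones are s_k of faces of z. For a cycle z this shows that s_k d_k z is a boundary. *)
Lemma hoch_diff_degen n k (z : V n.+2) : (k < n.+1)%N ->
  (forall i, (i < k)%N -> face i z = 0) ->
  hoch_diff (degen k z) = degen k (face k z) *~ (-1) ^+ k - degen k (hoch_diff z).
Proof.
move=> kn h; rewrite !hoch_diffE.
rewrite (big_cat_nat (n := k)) //=; last by lia.
rewrite [X in X + _ = _]big_nat_cond [X in X + _ = _]big1 ?add0r; last first.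
  by move=> i /andP[/andP[_ ik] _]; rewrite face_degen_lt ?h ?raddf0 ?mul0rz //; lia.
rewrite big_ltn; last by lia.
rewrite big_ltn; last by lia.
rewrite !face_degen ?eqxx ?orbT //; try lia.
rewrite addrA exprS mulN1r mulrNz subrr add0r.
rewrite [in RHS](big_cat_nat (n := k)) //=; last by lia.
rewrite [X in _ - degen k (X + _)]big_nat_cond [X in _ - degen k (X + _)]big1 ?add0r; last first.
  by move=> i /andP[/andP[_ ik] _]; rewrite h ?mul0rz.
rewrite [in RHS]big_ltn; last by lia.
rewrite raddfD /= raddfMz opprD addrA subrr sub0r raddf_sum -sumrN.
rewrite big_add1 /= big_nat_cond [RHS]big_nat_cond; apply: eq_bigr => i.
rewrite andbT => /andP[ki iN]; rewrite face_degen_gt //= raddfMz exprS mulN1r mulrNz //.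
Qed.

(** Here [k] may also be [n.+1], as is required for killing all faces but the last of a bounding
    chain. *)
Lemma hoch_diff_degen0 n k (z : V n.+2) : (k < n.+2)%N ->
  (forall i, (i < n.+2)%N -> face i z = 0) -> hoch_diff (degen k z) = 0.
Proof.
move=> kn h; rewrite hoch_diffE (big_cat_nat (n := k)) //=; last by lia.
rewrite [X in X + _ = _]big_nat_cond [X in X + _ = _]big1 ?add0r; last first.
  by move=> i /andP[/andP[_ ik] _]; rewrite face_degen_lt ?h ?raddf0 ?mul0rz //; lia.
rewrite big_ltn; last by lia.
rewrite big_ltn; last by lia.
rewrite !face_degen ?eqxx ?orbT //; try lia.
rewrite addrA exprS mulN1r mulrNz subrr add0r big_nat_cond big1 // => i.
by move=> /andP[/andP[ik iN] _]; rewrite face_degen_gt ?h ?raddf0 ?mul0rz //; lia.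
Qed.

Lemma face_sub_degen n k i (z : V n.+2) : (k < n.+1)%N -> (i < k.+1)%N ->
  (forall i, (i < k)%N -> face i z = 0) -> face i (z - degen k (face k z)) = 0.
Proof.
move=> kn ik h; rewrite raddfB /=; move: ik; rewrite ltnS leq_eqVlt => /orP[/eqP->|ik].
  by rewrite face_degen ?eqxx ?subrr.
rewrite h // sub0r; case: n z kn h => [|n] z kn h; first by lia.
rewrite face_degen_lt; [|lia|lia]; rewrite (face_face z ik); last by lia.
by rewrite h // !raddf0.
Qed.

(** [mooreZ r] is [M_(r+2)], and [mooreD r] is [d L_(r+3)]. *)
Definition mooreZ r (z : V r.+2) := forall i, (i < r.+2)%N -> face i z = 0.
Definition mooreD r (z : V r.+2) := exists2 b : V r.+3,
  (forall i, (i < r.+2)%N -> face i b = 0) & z = face r.+2 b.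

(** The faces are killed one after the other by passing from z to z - s_k d_k z, which by
    [face_sub_degen] keeps the faces already killed. *)
Lemma moore_iso r : subq_iso id (@mooreZ r) (@mooreD r)
  (fun z : V r.+2 => hoch_diff z = 0) (fun z : V r.+2 => exists u : V r.+3, hoch_diff u = z).
Proof.
have sgn (W : zmodType) (x : W) k : x *~ (-1) ^+ k *~ (-1) ^+ k = x.
  by rewrite -mulrzA -expr2 sqrr_sign.
split=> // [z hz|z hz|y hy].
- by rewrite hoch_diff_lead ?hz ?mul0rz // => i iN; rewrite hz // ltnW.
- split=> [[b hb ->]|[u hu]].
    exists (b *~ (-1) ^+ r.+2); rewrite raddfMz /= hoch_diff_lead ?sgn //.
  (* The correction s_k d_k w has boundary 0: take the boundary of [hoch_diff_degen] and use that
     s_k z is a cycle, all faces of [z] being 0. *)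
  have key k : (k <= r.+2)%N -> exists2 w : V r.+3,
      (forall i, (i < k)%N -> face i w = 0) & hoch_diff w = z.
    elim: k => [_|k IH kr]; first by exists u.
    have [w hw dw] := IH (ltnW kr).
    exists (w - degen k (face k w)); first by move=> i ik; apply: face_sub_degen.
    have := hoch_diff_degen kr hw; rewrite dw => /(congr1 (fun v => hoch_diff v *~ (-1) ^+ k)).
    rewrite hoch_diffK mul0rz raddfB /= (hoch_diff_degen0 _ hz) // subr0 raddfMz sgn => e.
    by rewrite raddfB /= -e subr0.
  have [w hw <-] := key r.+2 (leqnn _).
  exists (w *~ (-1) ^+ r.+2); first by move=> i ik; rewrite raddfMz /= hw ?mul0rz.
  by rewrite raddfMz /= hoch_diff_lead.
(* On cycles the correction is itself a boundary, of s_k z up to sign, so the homology class is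
   kept. *)
- have key k : (k <= r.+1)%N -> exists2 z : V r.+2, (forall i, (i < k)%N -> face i z = 0)
      & exists u : V r.+3, hoch_diff u = y - z.
    elim: k => [_|k IH kr]; first by exists y => //; exists 0; rewrite subrr raddf0.
    have [z hz [u hu]] := IH (ltnW kr).
    have dz : hoch_diff z = 0.
      have -> : z = y - hoch_diff u by rewrite hu opprB addrC subrK.
      by rewrite raddfB /= hy hoch_diffK subrr.
    exists (z - degen k (face k z)); first by move=> i ik; apply: face_sub_degen.
    have := hoch_diff_degen kr hz; rewrite dz raddf0 subr0 => e.
    exists (u + degen k z *~ (-1) ^+ k).
    by rewrite raddfD raddfMz /= hu e sgn opprB [degen _ _ - z]addrC addrA.
  have [z hz [u hu]] := key r.+1 (leqnn _); exists z; last by exists u.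
  move=> i; rewrite ltnS leq_eqVlt => /orP[/eqP->|]; last exact: hz.
  have := hoch_diff_lead hz; have -> : hoch_diff z = 0.
    have -> : z = y - hoch_diff u by rewrite hu opprB addrC subrK.
    by rewrite raddfB /= hy hoch_diffK subrr.
  by move/(congr1 (fun v => v *~ (-1) ^+ r.+1)); rewrite sgn mul0rz.
Qed.

Lemma presents_HH r : presents (HH A r.+1) (@mooreZ r) (@mooreD r).
Proof.
apply: (presents_pull _ (moore_iso r)); last exact: presents_homology.
by split=> [|x y hx hy]; rewrite ?raddf0 // raddfB /= hx hy subrr.
Qed.

Lemma mooreZ_subg r : subg (@mooreZ r).
Proof. by split=> [|x y hx hy] i iN; rewrite ?raddf0 // raddfB /= hx // hy // subrr. Qed.

End Moore.

(** * Cohomology of polygons *)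

Section Cube.
Variables (V : zmodType) (n : nat).
Local Notation E := 'I_n.+1.
Implicit Types (s t : {set E}) (c b : {set E} -> V).

Definition pos t (e : E) : nat := #|[set f in t | (f < e)%N]|.

Definition cube_diff c t : V := \sum_(e in t) c (t :\ e) *~ (-1) ^+ pos t e.

Lemma cube_diffB c b t : cube_diff (fun s => c s - b s) t = cube_diff c t - cube_diff b t.
Proof. by rewrite /cube_diff -sumrB; apply: eq_bigr => e _; rewrite mulrzBl. Qed.

Lemma cube_diffD c b t : cube_diff (fun s => c s + b s) t = cube_diff c t + cube_diff b t.
Proof. by rewrite /cube_diff -big_split; apply: eq_bigr => e _; rewrite mulrzDl. Qed.

Lemma pos_subset s t (e : E) : (forall f : E, (f < e)%N -> (f \in s) = (f \in t)) ->
  pos s e = pos t e.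
Proof.
move=> h; apply: eq_card => f; rewrite !inE.
by case: (ltnP f e) => fe; rewrite ?andbF ?andbT ?h.
Qed.

Lemma pos_D1 t (e f : E) : e \in t -> pos t f = (pos (t :\ e) f + (e < f))%N.
Proof.
move=> et; rewrite /pos; case: (ltnP e f) => ef.
  rewrite addn1 (cardsD1 e) inE et ef /= add1n; congr _.+1; apply: eq_card => g.
  by rewrite !inE andbA.
rewrite addn0; apply: eq_card => g; rewrite !inE.
by case: (g =P e) => [->|_]; rewrite ?andbT // ltnNge ef !andbF.
Qed.

Lemma cube_diffK c t : cube_diff (cube_diff c) t = 0.
Proof.
pose G (e f : E) := c (t :\ e :\ f) *~ ((-1) ^+ pos (t :\ e) f * (-1) ^+ pos t e).
transitivity (\sum_(e in t) \sum_(f in t | (e < f)%N) G e f +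
              \sum_(e in t) \sum_(f in t | (f < e)%N) G e f).
  rewrite -big_split; apply: eq_bigr => e et; rewrite /cube_diff mulrz_suml /=.
  rewrite (bigID (fun f : E => (e < f)%N)) /=.
  congr (_ + _); apply: eq_big => [f|f _]; rewrite ?inE -?mulrzA //.
    by rewrite -val_eqE /=; case: (ltngtP f e); rewrite ?andbF ?andbT.
  by rewrite -val_eqE /= -leqNgt; case: (ltngtP f e); rewrite ?andbF ?andbT.
rewrite [X in _ + X](exchange_big_dep (mem t)) /=; last by move=> e f _ /andP[].
rewrite -big_split big1 // => e et /=.
rewrite [X in _ + X](eq_bigl (fun f => (f \in t) && (e < f)%N)); last first.
  by move=> f; rewrite et.
rewrite -big_split big1 // => f /andP[ft ef] /=; rewrite /G.
have -> : t :\ f :\ e = t :\ e :\ f by rewrite !setDDl setUC.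
rewrite (pos_D1 f et) (pos_D1 e ft) ef [(f < e)%N]ltnNge ltnW // addn0 addn1.
by rewrite -mulrzDr exprS; apply/eqP; rewrite -(mulr0z (c (t :\ e :\ f))); apply/eqP;
  congr (_ *~ _); ring.
Qed.

Definition low i : {set E} := [set e : E | (e < i)%N].
Definition up j : {set E} := [set e : E | (j <= e)%N].

Lemma card_up j : (j <= n.+1)%N -> #|up j| = (n.+1 - j)%N.
Proof.
move=> jn; have := cardsC (up j); rewrite card_ord.
suff -> : #|~: up j| = j by move=> e; lia.
rewrite -sum1_card (eq_bigl (fun e : E => (e < j)%N)); last first.
  by move=> e; rewrite !inE ltnNge.
by rewrite (big_ord_narrow jn) sum1_card card_ord.
Qed.

Lemma up_recl j (e : E) : e = j :> nat -> up j = e |: up j.+1.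
Proof.
by move=> ej; apply/setP => f; rewrite !inE leq_eqVlt -ej -val_eqE [in LHS]eq_sym.
Qed.

(** [I s] stands for the kernel of the projection from the full tensor power to Phi(s). Cochains are
    thus functions with values in one group [V], and cocycle conditions hold modulo [I]. *)
Variable I : {set E} -> V -> Prop.
Hypotheses (hI : forall s, subg (I s)) (Imono : forall s t x, s \subset t -> I s x -> I t x).
Variable rho : nat -> {additive V -> V}.
Hypothesis rho_id : forall s (e : E) x, (e < n)%N -> e \in s -> I s (x - rho e x).
Hypothesis rho_del : forall s (e f : E) x, f = e.+1 :> nat -> f \notin s -> I s x ->
  I (s :\ e) (rho e x).

(* rho splits the projection that contracts the edge i, compatibly with the edges below i. *)
Lemma path_acyclic j i q c : (i < j)%N -> (j <= n.+1)%N -> (0 < q)%N ->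
  (forall t, t \subset low i -> #|t| = q.+1 -> I (t :|: up j) (cube_diff c t)) ->
  exists b, forall t, t \subset low i -> #|t| = q -> I (t :|: up j) (c t - cube_diff b t).
Proof.
elim: i c => [|i IH] c ij jn q0 hc.
  exists (fun=> 0) => t; have -> : low 0 = set0 by apply/setP => e; rewrite !inE.
  by rewrite subset0 => /eqP->; rewrite cards0 => q_0; rewrite -q_0 in q0.
have lowS : low i \subset low i.+1 by apply/subsetP => e; rewrite !inE => /ltnW.
have [|b hb] := IH c (ltnW ij) jn q0.
  by move=> t tl; apply: hc; apply: subset_trans tl lowS.
pose c1 s := c s - cube_diff b s.
have dc1 t : cube_diff c1 t = cube_diff c t by rewrite cube_diffB cube_diffK subr0.
have iN : (i < n)%N by lia.
pose e : E := inord i; have ei : e = i :> nat by rewrite inordK //; lia.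
pose f : E := inord i.+1; have fi : f = i.+1 :> nat by rewrite inordK //; lia.
have eup : e \notin up j by rewrite inE ei -ltnNge ltnW.
(* [e] comes last in a subset of [low i.+1] that contains it, so #|s| is its position in [e |: s].
   This makes the coboundary of [b'] equal to [rho i (c1 t)] on the sets [t] containing [e]. *)
pose b' s := if e \in s then 0 else rho i (c1 (e |: s)) *~ (-1) ^+ #|s|.
exists (fun s => b s + b' s) => t tl tq.
have -> : c t - cube_diff (fun s => b s + b' s) t = c1 t - cube_diff b' t.
  by rewrite cube_diffD opprD addrA.
have [et|et] := boolP (e \in t).
  have pe : pos t e = #|t :\ e|.
    apply: eq_card => g; rewrite !inE andbC ei; case: (g \in t) / boolP => gt; rewrite ?andbF //.
    by have := subsetP tl g gt; rewrite !andbT inE ltnS -val_eqE /= ei ltn_neqAle => ->;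
      rewrite andbT.
  have -> : cube_diff b' t = rho i (c1 t).
    rewrite /cube_diff (bigD1 e) //= big1 ?addr0 => [|g /andP[gt ge]]; last first.
      by rewrite /b' !inE eq_sym ge et mul0rz.
    by rewrite /b' !inE eqxx /= setD1K // pe -mulrzA -expr2 sqrr_sign.
  by rewrite -ei; apply: rho_id; rewrite ?ei // inE et.
have tl' : t \subset low i.
  apply/subsetP => g gt; have := subsetP tl g gt; rewrite !inE ltnS leq_eqVlt => /orP[/eqP gi|//].
  by move: et; rewrite -(_ : g = e) ?gt //; apply: ord_inj; rewrite ei.
have hc1 : I (t :|: up j) (c1 t) by apply: hb.
apply: subgB => //.
(* On a set [t] without [e], the coboundary of [b'] is, up to sign, [rho] of the part [S] of the
   coboundary of [c1] at [e |: t]. The cocycle condition puts [S] in the subgroup for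
   [e |: t :|: up j], and [rho_del] removes [e], the next edge being absent since i + 1 < j. *)
pose S := \sum_(g in t) c1 ((e |: t) :\ g) *~ (-1) ^+ pos (e |: t) g.
have dS : cube_diff c1 (e |: t) = c1 t *~ (-1) ^+ pos (e |: t) e + S.
  rewrite /cube_diff (bigD1 e) ?setU11 //= setU1K //; congr (_ + _).
  apply: eq_bigl => g; rewrite !inE; case: (g =P e) => [->|_] //=; last by rewrite andbT.
  by rewrite (negPf et).
have -> : cube_diff b' t = rho i S *~ (-1) ^+ q.-1.
  rewrite raddf_sum mulrz_suml; apply: eq_bigr => g gt /=.
  have ge : g != e by apply: contraNneq et => <-.
  have gi : (g < i)%N by have := subsetP tl' g gt; rewrite inE.
  rewrite /b' !inE (negPf et) andbF.
  have -> : #|t :\ g| = q.-1 by rewrite -tq [in RHS](cardsD1 g) gt.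
  have -> : e |: t :\ g = (e |: t) :\ g.
    apply/setP => h; rewrite !inE; case: (h =P g) => [->|] //=.
    by rewrite (negPf ge).
  have -> : pos (e |: t) g = pos t g.
    apply: pos_subset => h hg; rewrite !inE -val_eqE /= ei.
    by rewrite (_ : (h == i :> nat) = false) //; apply/negP => /eqP; lia.
  by rewrite raddfMz -!mulrzA mulrC.
apply: subgMz => //.
have sl : e |: t \subset low i.+1 by rewrite subUset tl sub1set inE ei ltnS leqnn.
have sq : #|e |: t| = q.+1 by rewrite cardsU1 et tq.
have IS : I (e |: t :|: up j) S.
  apply: (subgDl (hI _) (x := c1 t *~ (-1) ^+ pos (e |: t) e)).
    apply: subgMz => //; apply: Imono hc1; exact/setSU/subsetUr.
  by rewrite -dS dc1; apply: hc.
have -> : t :|: up j = (e |: t :|: up j) :\ e.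
  by rewrite -setUA setU1K // inE negb_or et.
rewrite -ei; apply: (@rho_del _ e f) => //; first by rewrite fi ei.
rewrite !inE -val_eqE /= fi ei negb_or -ltnNge ij andbT negb_or.
rewrite (_ : (i.+1 == i) = false) /=; last by apply/negP => /eqP; lia.
by apply/negP => ft; have := subsetP tl f ft; rewrite inE fi ltnn.
Qed.

(** The edge sets are treated by the number i of last edges they contain. A set with the last i
    edges [W] but without the edge [e] before them is [t :|: W] with [t] below the gap, where
    [path_acyclic] applies. One set is exempted in the hypothesis so that coboundaries which are
    themselves concentrated on the last edges can be treated. *)
Lemma cube_concentrate k c : (k <= n.+1)%N ->
  (forall t, #|t| = k.+1 -> t != up (n.+1 - k).-1 -> I t (cube_diff c t)) ->
  exists b, forall s, #|s| = k -> s != up (n.+1 - k) -> I s (c s - cube_diff b s).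
Proof.
move=> kn hc; set m := (n.+1 - k)%N in hc *.
have key i : (i <= k)%N -> exists b, forall s, #|s| = k -> ~~ (up (n.+1 - i) \subset s) ->
    I s (c s - cube_diff b s).
  elim: i => [_|i IH ik].
    exists (fun=> 0) => s _; case/negP; apply/subsetP => e; rewrite inE subn0.
    by rewrite leqNgt ltn_ord.
  have [b hb] := IH (ltnW ik); set j' := (n.+1 - i.+1)%N.
  have ejS : (n.+1 - i)%N = j'.+1 by rewrite /j'; lia.
  rewrite ejS in hb; set W := up j'.+1 in hb.
  have jn : (j' < n.+1)%N by rewrite /j'; lia.
  pose e : E := Ordinal jn.
  have cW : #|W| = i by rewrite card_up // /j'; lia.
  pose c1 s := c s - cube_diff b s.
  have dc1 t : cube_diff c1 t = cube_diff c t by rewrite cube_diffB cube_diffK subr0.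
  have dis t : t \subset low j' -> [disjoint t & W].
    move=> tl; rewrite disjoint_subset; apply/subsetP => g gt; rewrite !inE -ltnNge.
    by have := subsetP tl g gt; rewrite inE => /leqW.
  have cU t : t \subset low j' -> #|t :|: W| = (#|t| + i)%N.
    by move=> /dis dt; rewrite cardsU disjoint_setI0 // cards0 subn0 cW.
  have eW : e \notin W by rewrite inE ltnn.
  have el t : t \subset low j' -> e \notin t.
    by move=> tl; apply/negP => et; have := subsetP tl e et; rewrite inE ltnn.
  have delU t g : t \subset low j' -> g \in t -> (t :|: W) :\ g = (t :\ g) :|: W.
    move=> tl gt; rewrite setDUl; congr (_ :|: _); apply/setDidPl.
    by rewrite disjoint_sym disjoints1 (disjointFr (dis t tl) gt).
  have posU t g : t \subset low j' -> g \in t -> pos (t :|: W) g = pos t g.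
    move=> tl gt; apply: pos_subset => h hg; rewrite !inE.
    have := subsetP tl g gt; rewrite inE => gj.
    by rewrite (_ : (j' < h)%N = false) ?orbF //; apply/negP; lia.
  have sumU (d : {set E} -> V) t : t \subset low j' ->
      cube_diff d (t :|: W) = cube_diff (fun s => d (s :|: W)) t +
        \sum_(g in W) d ((t :|: W) :\ g) *~ (-1) ^+ pos (t :|: W) g.
    move=> tl; rewrite /cube_diff (bigID (mem t)) /=; congr (_ + _).
      apply: eq_big => [g|g /andP[_ gt]]; last by rewrite delU // posU.
      by rewrite inE andbC; case: (g \in t).
    apply: eq_bigl => g; rewrite inE; have := @disjointFr _ _ _ g (dis t tl).
    by case: (g \in t) => [->|_] //; rewrite /= andbT.
  have [] := @path_acyclic j'.+1 j' (k - i) (fun t => c1 (t :|: W)) (ltnSn _) _ _ _; try lia.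
    move=> t tl tq; have tk : #|t :|: W| = k.+1 by rewrite cU // tq; lia.
    have : I (t :|: W) (cube_diff c1 (t :|: W)).
      rewrite dc1; apply: hc => //; apply/eqP => /setP/(_ e).
      by rewrite !inE (negPf (el _ tl)) ltnn /= /m /j'; lia.
    rewrite sumU //; apply: subgDr => //; apply: subg_sum => // g gW; apply: subgMz => //.
    apply: (@Imono ((t :|: W) :\ g)); first exact: subsetDl.
    apply: hb; first by move: tk; rewrite (cardsD1 g) inE gW orbT add1n => -[].
    by apply/negP => /subsetP/(_ g gW); rewrite !inE eqxx.
  (* [b1] lives on sets that contain [W]. A set not containing [W] has no such subset, so what was
     achieved for it before is undisturbed. *)
  move=> b'' hb''; pose b1 s := if (W \subset s) && (e \notin s) then b'' (s :\: W) else 0.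
  exists (fun s => b s + b1 s) => s sk sup.
  have -> : c s - cube_diff (fun s => b s + b1 s) s = c1 s - cube_diff b1 s.
    by rewrite cube_diffD opprD addrA.
  have b1W g : g \in W -> b1 (s :\ g) = 0.
    rewrite /b1 => gW; case: ifP => // /andP[/subsetP/(_ g gW)].
    by rewrite !inE eqxx.
  have [Ws|Ws] := boolP (W \subset s); last first.
    rewrite [X in _ - X](_ : _ = 0) ?subr0; first exact: hb.
    rewrite /cube_diff big1 // => g _; rewrite /b1; case: ifP => [/andP[Wg _]|_].
      by case/negP: Ws; apply: subset_trans Wg (subsetDl _ _).
    by rewrite mul0rz.
  have es : e \notin s.
    by apply: contra sup => es; rewrite (@up_recl j' e) // subUset Ws sub1set es.
  pose t := s :\: W.
  have st : s = t :|: W by rewrite setUC /t -{1}(setID s W) (setIidPr Ws).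
  have tl : t \subset low j'.
    apply/subsetP => g; rewrite !inE -leqNgt leq_eqVlt => /andP[/orP[/eqP gj gs|//]].
    by case/negP: es; rewrite -(_ : g = e) //; apply: ord_inj.
  rewrite {3}st sumU // big1 ?addr0; last first.
    by move=> g gW; rewrite -st b1W ?mul0rz.
  have -> : cube_diff (fun s => b1 (s :|: W)) t = cube_diff b'' t.
    apply: eq_bigr => g gt; rewrite /b1 subsetUr inE negb_or eW andbT /=.
    have tgl : t :\ g \subset low j' by apply: subset_trans tl; apply: subsetDl.
    rewrite (el _ tgl) setDUl setDv setU0; congr (b'' _ *~ _).
    by apply/setDidPl; apply: dis.
  rewrite {1 2}st; apply: hb'' => //.
  by move: sk; rewrite st cU //; lia.
have [b hb] := key k (leqnn k); exists b => s sk sm; apply: hb => //.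
apply: contra sm => us; rewrite eq_sym eqEcard us /= card_up; last by lia.
by rewrite sk; lia.
Qed.

End Cube.

Lemma subr_via (V : zmodType) (z x y : V) : x - y = (z - y) - (z - x).
Proof. by rewrite opprB [RHS]addrC addrA subrK. Qed.

(** * Cochains of the polygon, lifted to the full tensor power *)

Section PolygonCube.
Variables (A : comPzRingType) (n : nat).
Local Notation E := 'I_n.+1.
Local Notation V m := (tensor A 'I_m).
Implicit Types (s t : {set E}).

Definition proj s (v : E) : component s :=
  exist _ (fingraph.root (adj s) v) (roots_root (adj_connect_sym s) v).

Definition proj_ker s (x : V n.+1) : Prop := tensor_map (proj s) x = 0.

Lemma proj_eq s u v : (proj s u = proj s v) <-> connect (adj s) u v.
Proof.
split=> [/(congr1 val) /= /(fingraph.rootP (adj_connect_sym s))//|h].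
by apply: val_inj; apply/(fingraph.rootP (adj_connect_sym s)).
Qed.

Lemma proj_edge s e : e \in s -> proj s (ordS e) = proj s e.
Proof.
move=> es; apply/esym/proj_eq/connect1; apply/existsP; exists e.
by rewrite es /joins !eqxx.
Qed.

Lemma proj_factor s (K : Type) (g : E -> K) : (forall e, e \in s -> g (ordS e) = g e) ->
  forall u v, proj s u = proj s v -> g u = g v.
Proof.
move=> hg u v /proj_eq /connectP[p]; elim: p u => [|x p IH] u /=; first by move=> _ ->.
move=> /andP[/existsP[e /andP[es ex]] hp] hv; rewrite -(IH x hp hv).
by case/orP: ex => /andP[/eqP-> /eqP->]; rewrite hg.
Qed.

Lemma proj_ker_map s (K : finType) (g : E -> K) x :
  (forall e, e \in s -> g (ordS e) = g e) -> proj_ker s x -> tensor_map g x = 0.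
Proof. by move=> hg; apply: (tensor_map_factor ord0); apply: proj_factor. Qed.

Lemma proj_ker_mono s t x : s \subset t -> proj_ker s x -> proj_ker t x.
Proof. by move=> st; apply: proj_ker_map => e es; rewrite proj_edge // (subsetP st). Qed.

Lemma proj_ker_subg s : subg (proj_ker s).
Proof. by split=> [|x y hx hy]; rewrite /proj_ker ?raddf0 // raddfB /= hx hy subrr. Qed.

Lemma val_ordS (e : E) : (e < n)%N -> ordS e = e.+1 :> nat.
Proof. by move=> en; rewrite /= modn_small. Qed.

Lemma ordS_max : ordS (ord_max : E) = ord0.
Proof. by apply: val_inj; rewrite /= modnn. Qed.

(** Contraction of the edge i inside the full tensor power, the vertex i + 1 being left with a unit;
    it plays the role of [rho]. *)
Definition retract i : {additive V n.+1 -> V n.+1} := tensor_map (@merge_next n i).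

Lemma merge_nextS (e : E) : (e < n)%N -> @merge_next n e (ordS e) = e.
Proof. by move=> en; rewrite /merge_next /= modn_small // eqxx inord_val. Qed.

Lemma merge_next_id i (v : E) : v != i.+1 :> nat -> @merge_next n i v = v.
Proof. by rewrite /merge_next => /negPf->. Qed.

Lemma retract_id s (e : E) x : (e < n)%N -> e \in s -> proj_ker s (x - retract e x).
Proof.
move=> en es; rewrite /proj_ker raddfB /= tensor_map_comp.
rewrite [X in _ - X](@eq_tensor_map _ _ _ _ (proj s)) ?subrr // => v /=.
have [ve|ve] := eqVneq v (ordS e); first by rewrite ve merge_nextS // proj_edge.
by rewrite merge_next_id // -(val_ordS en).
Qed.

(** Without [f], the vertex e + 1 can meet only the edge [e] of [s]. Once it is merged into the
    vertex [e], the edge [e] is no longer needed to identify the two. *)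
Lemma retract_del s (e f : E) x : f = e.+1 :> nat -> f \notin s ->
  proj_ker s x -> proj_ker (s :\ e) (retract e x).
Proof.
move=> fe fs hx; have en : (e < n)%N by have := ltn_ord f; rewrite fe ltnS.
have ef : ordS e = f by apply: val_inj; rewrite /= modn_small.
rewrite /proj_ker /= tensor_map_comp; apply: proj_ker_map hx => g gs /=.
have gf : g != f by apply: contraNneq fs => <-.
rewrite [merge_next e g]merge_next_id -?fe //.
have [->|ge] := eqVneq g e; first by rewrite merge_nextS.
rewrite merge_next_id ?proj_edge ?inE ?ge // -fe.
by rewrite -ef; apply: contraNneq ge => /val_inj/ordS_inj->.
Qed.

Definition to_cochain k (c : {set E} -> V n.+1) : cochain A n.+1 k :=
  [ffun s : {s : {set E} | #|s| == k} => (tensor_map (proj (val s)) (c (val s)) : Phi A (val s))].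


Lemma to_cochainB k c b : to_cochain k (fun s => c s - b s) = to_cochain k c - to_cochain k b.
Proof. by apply/ffunP => s; rewrite !ffunE raddfB. Qed.

Lemma to_cochain_eq0 k c : to_cochain k c = 0 <-> forall s, #|s| = k -> proj_ker s (c s).
Proof.
split=> [h s /eqP sk|h].
  have /ffunP/(_ (exist _ s sk : {s : {set E} | #|s| == k})) := h; rewrite !ffunE //.
by apply/ffunP => s; rewrite !ffunE; apply: h; apply/eqP/(valP s).
Qed.

Lemma tensor_map_proj_surj s (y : Phi A s) : exists x : V n.+1, tensor_map (proj s) x = y.
Proof.
exists (tensor_map (val : component s -> E) y); rewrite tensor_map_comp.
apply: tensor_map_id => v; apply: val_inj => /=.
by apply/eqP; exact: (valP v).
Qed.

Lemma to_cochain_surj k (y : cochain A n.+1 k) : exists c, to_cochain k c = y.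
Proof.
have /choice[c hc] (s : {s : {set E} | #|s| == k}) : exists x, tensor_map (proj (val s)) x = y s.
  exact: tensor_map_proj_surj.
exists (fun s => oapp c 0 (insub s)); apply/ffunP => s; rewrite ffunE.
by rewrite valK hc.
Qed.

Lemma graph_diff_to_cochain k c :
  graph_diff (to_cochain k c) = to_cochain k.+1 (cube_diff c).
Proof.
apply/ffunP => t; rewrite !ffunE.
transitivity (\sum_(s : {s : {set E} | #|s| == k}) \sum_(e in val t | val s == val t :\ e)
    tensor_map (proj (val t)) (c (val s) *~ (-1) ^+ pos (val t) e)).
  apply: eq_bigr => s _; apply: eq_big => [e|e /andP[es /eqP st]].
    apply/andP/andP => [[es /eqP <-]|[et /eqP->]]; first by rewrite setU11 setU1K.
    by rewrite !inE eqxx setD1K.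
  rewrite ffunE raddfMz; congr (_ *~ (-1) ^+ _).
    rewrite /Phi_map tensor_map_comp; apply: eq_tensor_map => v /=.
    apply: val_inj => /=; apply/(fingraph.rootP (adj_connect_sym _)).
    have sub : val s \subset val t by rewrite -st subsetUr.
    apply/proj_eq; apply: (@proj_factor (val s) _ (proj (val t))).
      by move=> f fs; rewrite proj_edge // (subsetP sub).
    apply/proj_eq; rewrite (adj_connect_sym (val s)); exact: connect_root.
  rewrite /edge_pos /pos -st; apply: eq_card => f; rewrite !inE.
  by case: (f =P e) => [->|] //=; rewrite ltnn !andbF.
rewrite (exchange_big_dep (mem (val t))) /=; last by move=> s e _ /andP[].
rewrite /cube_diff raddf_sum; apply: eq_bigr => e et.
have ck : #|val t :\ e| == k by have := valP t; rewrite (cardsD1 e) et.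
rewrite (big_pred1 (exist _ (val t :\ e) ck : {s : {set E} | #|s| == k})) // => s.
by rewrite et /= -val_eqE.
Qed.

Definition single j (a : V n.+1) s : V n.+1 := if s == up n j then a else 0.

Lemma cube_diff_single j a t : (forall e, e \in t -> t = e |: up n j -> proj_ker t a) ->
  proj_ker t (cube_diff (single j a) t).
Proof.
move=> h; apply: subg_sum => [|e et]; first exact: proj_ker_subg.
apply: subgMz; first exact: proj_ker_subg.
rewrite /single; case: eqP => [te|_]; last exact: (subg0 (proj_ker_subg _)).
by apply: (h e) => //; rewrite -te setD1K.
Qed.

(** If [c] is concentrated on [up n j], only the term deleting [e] survives modulo the kernel at
    [t]. *)
Lemma cube_diff_off j (c : {set E} -> V n.+1) (e : E) t :
  (forall s, #|s| = #|t|.-1 -> s != up n j -> proj_ker s (c s)) ->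
  t = e |: up n j -> e \notin up n j ->
  proj_ker t (cube_diff c t - c (up n j) *~ (-1) ^+ pos t e).
Proof.
move=> hc te eu; have et : e \in t by rewrite te setU11.
rewrite /cube_diff (bigD1 e) //= -(setU1K eu) -te addrAC subrr add0r.
apply: subg_sum => [|f /andP[ft fe]]; first exact: proj_ker_subg.
apply: subgMz; first exact: proj_ker_subg.
apply: (@proj_ker_mono (t :\ f)); first exact: subsetDl.
apply: hc; first by rewrite (cardsD1 f t) ft.
apply/eqP => tf; move: eu; rewrite -tf !inE et andbT negbK => /eqP ef.
by rewrite ef eqxx in fe.
Qed.

(** For m > 0 the edges [up n m] join the vertices m, .., n to 0, leaving m components, and the
    edges below m multiply cyclic neighbours. So these are [M_m] and [d L_(m+1)]; in [polygonD] the
    edge m is the one not imposed on [b]. *)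
Definition polygonZ m a := forall e : E, (e < m)%N -> proj_ker (e |: up n m) a.
Definition polygonD m a := exists2 b : V n.+1,
  (forall e : E, (e < m)%N -> proj_ker (e |: up n m.+1) b) & proj_ker (up n m) (a - b).

Lemma card_add_up (e : E) m : (e < m)%N -> (m <= n.+1)%N -> #|e |: up n m| = (n.+1 - m).+1.
Proof. by move=> em mn; rewrite cardsU1 inE leqNgt em card_up. Qed.

Lemma add_up_case (e : E) t m : (m <= n.+1)%N -> #|t| = (n.+1 - m).+1 ->
  t = e |: up n m -> (e < m)%N.
Proof.
move=> mn tk te; rewrite ltnNge; apply/negP => me; move: tk.
rewrite te cardsU1 inE me card_up //; lia.
Qed.

Lemma polygonZ_subg m : subg (polygonZ m).
Proof.
split=> [e em|x y hx hy e em]; first exact: (subg0 (proj_ker_subg _)).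
by apply: (subgB (proj_ker_subg _)); [apply: hx|apply: hy].
Qed.

Lemma cochain_iso k m : (k <= n)%N -> m = (n.+1 - k.+1)%N ->
  subq_iso (fun a => to_cochain k.+1 (single m a)) (polygonZ m) (polygonD m)
    (fun x => graph_diff x = 0) (fun x => exists u : cochain A n.+1 k, graph_diff u = x).
Proof.
move=> kn mE; have mn : (m < n.+1)%N by lia.
pose e0 : E := Ordinal mn.
have upm : up n m = e0 |: up n m.+1 by apply: up_recl.
have e0u : e0 \notin up n m.+1 by rewrite inE ltnn.
(* [e0] is the least edge of [up n m], so restoring it introduces no sign. *)
have pos0 : pos (up n m) e0 = 0%N.
  by apply: eq_card0 => f; rewrite !inE /= leqNgt; case: (f < m)%N.
have singleB j a b : single j (a - b) = (fun s => single j a s - single j b s).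
  by apply/funext => s; rewrite /single; case: ifP => _; rewrite ?subr0.
have concentrate k' c := @cube_concentrate _ n proj_ker proj_ker_subg proj_ker_mono
  retract retract_id retract_del k' c.
have cm : #|up n m| = k.+1 by rewrite card_up; lia.
have cmS : #|up n m.+1| = k by rewrite card_up; lia.
split=> [a b|a ha|a ha|y hy].
- by rewrite singleB to_cochainB.
- rewrite graph_diff_to_cochain; apply/to_cochain_eq0 => t tk.
  apply: cube_diff_single => e et te; rewrite {1}te; apply: ha.
  by apply: (add_up_case _ _ te); [lia|rewrite tk; lia].
- split=> [[b hb hab]|[u]].
    exists (to_cochain k (single m.+1 b)); rewrite graph_diff_to_cochain.
    apply/eqP; rewrite -subr_eq0 -to_cochainB; apply/eqP/to_cochain_eq0 => s sk.
    have hs e : e \in s -> s = e |: up n m.+1 -> s != up n m -> proj_ker s b.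
      move=> es se sm; rewrite {1}se; apply: hb.
      have : (e < m.+1)%N by apply: (add_up_case _ _ se); [lia|rewrite sk; lia].
      rewrite ltnS leq_eqVlt => /orP[/eqP em|//].
      by case/eqP: sm; rewrite se upm; congr (_ |: _); apply: ord_inj.
    rewrite {2}/single; case: eqP => [sm|/eqP sm]; last first.
      rewrite subr0; apply: cube_diff_single => e es se; exact: hs es se sm.
    have : proj_ker s (cube_diff (single m.+1 b) s - single m.+1 b (up n m.+1) *~ (-1) ^+ pos s e0).
      have hr (r : {set E}) : #|r| = #|s|.-1 -> r != up n m.+1 -> proj_ker r (single m.+1 b r).
        by move=> _ rm; rewrite /single (negPf rm); exact: (subg0 (proj_ker_subg _)).
      have se : s = e0 |: up n m.+1 by rewrite sm.
      exact: (cube_diff_off hr se e0u).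
    have sb : single m.+1 b (up n m.+1) = b by rewrite /single eqxx.
    rewrite {3}sm pos0 mulr1z sb => h1.
    have -> : cube_diff (single m.+1 b) s - a = cube_diff (single m.+1 b) s - b - (a - b).
      by rewrite opprB addrA subrK.
    apply: (subgB (proj_ker_subg _) h1); rewrite {1}sm; exact: hab.
  have [c <-] := to_cochain_surj u.
  rewrite graph_diff_to_cochain => /eqP; rewrite -subr_eq0 -to_cochainB => /eqP/to_cochain_eq0 hc.
  (* The coboundary of [c] agrees with [single m a], which vanishes off [up n m]: this set is the
     exemption in [cube_concentrate]. *)
  have [|t tk tm|b hb] := concentrate k c; first by lia.
    have -> : cube_diff c t = cube_diff c t - single m a t.
      by rewrite /single ifF ?subr0 //; apply: contra_neqF tm => /eqP->; congr up; lia.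
    exact: hc.
  pose c2 s := c s - cube_diff b s.
  have dc2 t : cube_diff c2 t = cube_diff c t by rewrite cube_diffB cube_diffK subr0.
  have hc2 s : #|s| = k -> s != up n m.+1 -> proj_ker s (c2 s).
    by move=> sk sm; apply: hb => //; rewrite (_ : (n.+1 - k)%N = m.+1) //; lia.
  exists (c2 (up n m.+1)) => [e em|].
    have eu : e \notin up n m.+1 by rewrite inE -leqNgt ltnW.
    have ct : #|e |: up n m.+1| = k.+1 by rewrite card_add_up //; lia.
    have h1 : proj_ker (e |: up n m.+1) (cube_diff c2 (e |: up n m.+1) -
        c2 (up n m.+1) *~ (-1) ^+ pos (e |: up n m.+1) e).
      by apply: cube_diff_off erefl eu; rewrite ct.
    have h2 : proj_ker (e |: up n m.+1) (cube_diff c2 (e |: up n m.+1)).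
      rewrite dc2; have := hc _ ct; rewrite /single ifF ?subr0 //.
      apply/eqP => /setP/(_ e); rewrite !inE eqxx /=; lia.
    have := subgMz (proj_ker_subg _) ((-1) ^+ pos (e |: up n m.+1) e)
      (subgB (proj_ker_subg _) h2 h1).
    by rewrite subKr -mulrzA -expr2 sqrr_sign.
  have h1 : proj_ker (up n m) (cube_diff c2 (up n m) - c2 (up n m.+1) *~ (-1) ^+ pos (up n m) e0).
    by apply: cube_diff_off upm e0u; rewrite cm.
  have := hc _ cm; rewrite /single eqxx -dc2 => h2.
  rewrite pos0 mulr1z in h1.
  by rewrite (subr_via (cube_diff c2 (up n m))); apply: (subgB (proj_ker_subg _) h1 h2).
- have [c yc] := to_cochain_surj y; move: hy; rewrite -yc graph_diff_to_cochain.
  move/to_cochain_eq0 => hc.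
  have [||b hb] := concentrate k.+1 c; first by lia.
    by move=> t tk _; apply: hc.
  pose c2 s := c s - cube_diff b s.
  have dc2 t : cube_diff c2 t = cube_diff c t by rewrite cube_diffB cube_diffK subr0.
  have hc2 s : #|s| = k.+1 -> s != up n m -> proj_ker s (c2 s).
    by move=> sk sm; apply: hb => //; rewrite -mE.
  exists (c2 (up n m)) => [e em|].
    have eu : e \notin up n m by rewrite inE -ltnNge.
    have ct : #|e |: up n m| = k.+2 by rewrite card_add_up //; lia.
    have h1 : proj_ker (e |: up n m) (cube_diff c2 (e |: up n m) -
        c2 (up n m) *~ (-1) ^+ pos (e |: up n m) e).
      by apply: cube_diff_off erefl eu; rewrite ct.
    have h2 : proj_ker (e |: up n m) (cube_diff c2 (e |: up n m)) by rewrite dc2; apply: hc.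
    have := subgMz (proj_ker_subg _) ((-1) ^+ pos (e |: up n m) e)
      (subgB (proj_ker_subg _) h2 h1).
    by rewrite subKr -mulrzA -expr2 sqrr_sign.
  exists (to_cochain k b); rewrite graph_diff_to_cochain.
  apply/eqP; rewrite -subr_eq0 -!to_cochainB; apply/eqP/to_cochain_eq0 => s sk.
  rewrite /single; case: eqP => [->|/eqP sm].
    have -> : cube_diff b (up n m) - (c (up n m) - c2 (up n m)) = 0.
      by rewrite /c2 subKr subrr.
    exact: (subg0 (proj_ker_subg _)).
  rewrite subr0 -opprB; apply: (subgN (proj_ker_subg _)); exact: hc2.
Qed.

Lemma presents_polygon k : (k <= n)%N ->
  presents (polygon_cohomology A n.+1 k.+1) (polygonZ (n - k)) (polygonD (n - k)).
Proof.
move=> kn; apply: (presents_pull _ (cochain_iso kn _)); last exact: presents_homology.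
  by split=> [|x y hx hy]; rewrite ?raddf0 // raddfB /= hx hy subrr.
by rewrite subSS.
Qed.

End PolygonCube.

(** * Comparison with the normalised Hochschild complex *)

Section PolygonMoore.
Variables (A : comPzRingType) (n : nat).
Local Notation E := 'I_n.+1.
Local Notation V m := (tensor A 'I_m).
Implicit Types s : {set E}.

(** The edges [up n m.+1] join all vertices beyond m to 0, so Phi of this set is a tensor power over
    the first m + 1 vertices; [collapse] and [include] realise the identification. *)
Definition collapse m (v : E) : 'I_m.+1 := inord (if v < m.+1 then v : nat else 0)%N.
Definition include m (v : 'I_m.+1) : E := inord v.

Lemma val_collapse m (v : E) : @collapse m v = (if v < m.+1 then v : nat else 0)%N :> nat.
Proof. by rewrite /collapse inordK //; case: ifP. Qed.

Lemma val_include m (v : 'I_m.+1) : (m <= n)%N -> @include m v = v :> nat.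
Proof. by move=> mn; rewrite /include inordK // (leq_trans (ltn_ord v)). Qed.

Lemma val_ordSE (e : E) : ordS e = (if e == n :> nat then 0 else e.+1)%N :> nat.
Proof.
case: eqP => [en|/eqP en] /=; first by rewrite en modnn.
by rewrite modn_small // ltnS ltn_neqAle en -ltnS ltn_ord.
Qed.


Lemma collapse_up m (e : E) : e \in up n m.+1 -> @collapse m (ordS e) = @collapse m e.
Proof.
rewrite inE => me; apply: ord_inj; rewrite !val_collapse val_ordSE.
by move: (e : nat) me => x me; split_ifs; lia.
Qed.

Lemma face_collapse r (e : E) : (r < n)%N -> (e < r.+2)%N ->
  @face_map r e (@collapse r.+1 (ordS e)) = @face_map r e (@collapse r.+1 e).
Proof.
move=> rn er; apply: ord_inj; rewrite !val_face_map // !val_collapse val_ordSE.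
by move: (e : nat) er => x er; split_ifs; lia.
Qed.

Lemma proj_up s m (v : E) : up n m \subset s -> (m <= v)%N -> proj s v = proj s ord0.
Proof.
move=> us; move: {2}(n - v)%N (leqnn (n - v)%N) => k; elim: k v => [|k IH] v vk mv.
  have -> : v = ord_max by apply: ord_inj => /=; have := ltn_ord v; lia.
  by rewrite -ordS_max proj_edge // (subsetP us) // inE /=; have := ltn_ord v; lia.
have ves : v \in s by rewrite (subsetP us) // inE.
rewrite -proj_edge //; have [vn|vn] := eqVneq (v : nat) n.
  by congr (proj _ _); apply: ord_inj; rewrite val_ordSE vn eqxx.
by apply: IH; rewrite val_ordSE (negPf vn); move: (ltn_ord v) vk mv; move: (v : nat) vn => x; lia.
Qed.

Lemma proj_include_collapse s m (v : E) : up n m.+1 \subset s -> (m <= n)%N ->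
  proj s (@include m (@collapse m v)) = proj s v.
Proof.
move=> us mn; case: (ltnP v m.+1) => vm.
  by congr (proj _ _); apply: ord_inj; rewrite val_include // val_collapse vm.
rewrite (proj_up us vm); congr (proj _ _); apply: ord_inj.
by rewrite val_include // val_collapse ltnNge vm.
Qed.

(** [degen_map] after [face_map] moves a vertex only to one with which the edge [e], or the final
    path back to 0, already identifies it. *)
Lemma proj_face s r (e : E) (v : 'I_r.+2) : up n r.+2 \subset s -> e \in s -> (r < n)%N ->
  (e < r.+2)%N -> proj s (@include r.+1 (@degen_map r e (@face_map r e v))) = proj s (@include
    r.+1 v).
Proof.
move=> us es rn er.
have iE (w : 'I_r.+2) : @include r.+1 w = w :> nat by apply: val_include.
have [ve|ve] := eqVneq (v : nat) e.+1.
  have -> : @include r.+1 v = ordS e.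
    apply: ord_inj; rewrite iE val_ordSE ve; case: eqP => // en.
    by have := ltn_ord v; rewrite ve; lia.
  rewrite proj_edge //; congr (proj _ _); apply: ord_inj.
  have : (e.+1 < r.+2)%N by rewrite -ve.
  rewrite iE val_degen_map val_face_map // ve; move: (e : nat) => x.
  by split_ifs; lia.
have [[vr er1]|nvr] := pselect (v = r.+1 :> nat /\ e = r.+1 :> nat).
  have -> : @include r.+1 (@degen_map r e (@face_map r e v)) = ord0.
    by apply: ord_inj; rewrite iE val_degen_map val_face_map // vr er1 leqnn eqxx.
  have -> : @include r.+1 v = e by apply: ord_inj; rewrite iE vr er1.
  rewrite -(proj_edge es); have [en|en] := eqVneq (e : nat) n.
    by congr (proj _ _); apply: ord_inj; rewrite val_ordSE en eqxx.
  by rewrite (proj_up us) // val_ordSE (negPf en) er1.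
congr (proj _ _); apply: ord_inj; rewrite !iE val_degen_map val_face_map //.
have := ltn_ord v; move: (v : nat) (e : nat) er ve nvr => x y er ve nvr xr.
have nvr' : (x != r.+1) || (y != r.+1).
  by rewrite -negb_and; apply/negP => /andP[/eqP a /eqP b]; apply: nvr.
by split_ifs; lia.
Qed.

Lemma face_of_proj_ker r (e : E) s (x : V n.+1) : (r < n)%N -> (e < r.+2)%N ->
  s = e |: up n r.+2 -> proj_ker s x -> face e (tensor_map (@collapse r.+1) x) = 0.
Proof.
move=> rn er ->; rewrite /face tensor_map_comp; apply: proj_ker_map => f.
rewrite in_setU1 => /orP[/eqP->|fu] /=; first exact: face_collapse.
by rewrite collapse_up.
Qed.

Lemma proj_ker_of_face r (e : E) s (a : V r.+2) : (r < n)%N -> (e < r.+2)%N ->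
  s = e |: up n r.+2 -> face e a = 0 -> proj_ker s (tensor_map (@include r.+1) a).
Proof.
move=> rn er -> h; rewrite /proj_ker tensor_map_comp.
rewrite -(@eq_tensor_map _ _ _ ((proj (e |: up n r.+2) \o @include r.+1 \o @degen_map r e) \o
  @face_map r e)).
  by rewrite -tensor_map_comp -/(face e a) h raddf0.
by move=> v /=; apply: proj_face; rewrite ?subsetUr ?setU11.
Qed.

Lemma collapseK m (v : 'I_m.+1) : (m <= n)%N -> @collapse m (@include m v) = v.
Proof. by move=> mn; apply: ord_inj; rewrite val_collapse val_include // ltn_ord. Qed.

Lemma proj_ker_collapse m (x : V n.+1) : (m <= n)%N ->
  proj_ker (up n m.+1) (x - tensor_map (@include m) (tensor_map (@collapse m) x)).
Proof.
move=> mn; rewrite /proj_ker raddfB /= !tensor_map_comp.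
rewrite [X in _ - X](@eq_tensor_map _ _ _ _ (proj (up n m.+1))) ?subrr // => v /=.
exact: proj_include_collapse.
Qed.

Lemma polygon_moore_iso r : (r.+2 <= n)%N -> subq_iso (tensor_map (@include r.+1))
  (@mooreZ A r) (@mooreD A r) (@polygonZ A n r.+2) (@polygonD A n r.+2).
Proof.
move=> rn; have rn' : (r < n)%N by apply: ltnW.
have Zi a : mooreZ a -> polygonZ r.+2 (tensor_map (@include r.+1) a : V n.+1).
  by move=> ha e er; apply: (proj_ker_of_face rn' er erefl); apply: ha.
split=> [a b|a ha|a ha|x hx]; rewrite ?raddfB //; first exact: Zi.
- split=> [[b hb ab]|[b hb hab]].
    exists (tensor_map (@include r.+2) b).
      move=> e er; apply: (@proj_ker_of_face r.+1 e) => //; first exact: ltnW.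
      exact: hb.
    rewrite ab /proj_ker raddfB /= !tensor_map_comp.
    rewrite [X in X - _](@eq_tensor_map _ _ _ _ (proj (up n r.+2) \o @include r.+2)) ?subrr // =>
      v /=.
    have [vr|vr] := eqVneq (v : nat) r.+2.
      rewrite [RHS](@proj_up _ r.+2) ?val_include ?vr //; congr (proj _ _).
      by apply: ord_inj; rewrite val_include // val_face_map // vr leqnn eqxx.
    congr (proj _ _); apply: ord_inj; rewrite !val_include ?val_face_map //.
    by have := ltn_ord v; move: (v : nat) vr => x vr xr; split_ifs; lia.
  exists (tensor_map (@collapse r.+2) b).
    move=> i ir; pose e : E := Ordinal (leq_trans ir (leqW rn)).
    apply: (@face_of_proj_ker r.+1 e _ b rn _ erefl); first exact: ltnW.
    exact: (hb e).
  rewrite -[LHS](tensor_map_id a (fun v => collapseK v rn')) -tensor_map_comp.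
  have fc : face_map r.+2 \o @collapse r.+2 =1 @collapse r.+1.
    move=> v; apply: ord_inj; rewrite /= val_face_map // !val_collapse.
    by move: (v : nat) => x; split_ifs; lia.
  rewrite /face [RHS]tensor_map_comp (eq_tensor_map _ fc).
  apply/eqP; rewrite -subr_eq0 -raddfB; apply/eqP.
  by apply: proj_ker_map hab => e eu; apply: collapse_up.
- exists (tensor_map (@collapse r.+1) x).
    move=> i ir; pose e : E := Ordinal (leq_trans ir (leqW rn)).
    exact: (@face_of_proj_ker r e _ x rn' ir erefl (hx e ir)).
  exists 0; first by move=> e _; exact: (subg0 (proj_ker_subg _ _)).
  by rewrite subr0; apply: proj_ker_collapse.
Qed.

Lemma presents_polygon_moore r : (r.+2 <= n)%N ->
  presents (polygon_cohomology A n.+1 (n - r.+2).+1) (@mooreZ A r) (@mooreD A r).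
Proof.
move=> rn; apply: (presents_pull _ (polygon_moore_iso rn)); first exact: polygonZ_subg.
by rewrite -{2 3}(subKn rn); apply: presents_polygon; rewrite leq_subr.
Qed.

Lemma polygon_vanish k (x : polygon_cohomology A n.+1 k.+1) : (n <= k.+1)%N -> x = 0.
Proof.
move=> nk; case: (leqP k n) => kn; last first.
  have C0 (y : cochain A n.+1 k.+1) : y = 0.
    apply/ffunP => -[s sk]; have := max_card (mem s).
    by rewrite (eqP sk) card_ord; lia.
  rewrite -[x]reprK; have -> : repr x = 0 by apply: val_inj; rewrite [LHS]C0.
  by rewrite raddf0.
have [f [fB fs fD]] := presents_polygon A kn; have [a ha <-] := fs x; apply/(fD a ha).
case: (ltngtP k.+1 n) nk => // [nk|nk] _.
  (* All edges are present: no condition is left on a primitive, and [a] is its own. *)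
  have e0 : (n - k = 0)%N by lia.
  exists a; last by rewrite subrr; exact: (subg0 (proj_ker_subg _ _)).
  by move=> e; rewrite e0.
(* The last n edges already connect all vertices, so the edge 0 merges nothing, and the cocycle
   condition says that [a] represents 0. *)
have e1 : (n - k = 1)%N by lia.
rewrite e1 in ha *.
exists 0; first by move=> e _; exact: (subg0 (proj_ker_subg _ _)).
rewrite subr0; apply: proj_ker_map (ha ord0 isT) => e _.
have const v : proj (up n 1) v = proj (up n 1) ord0.
  by case: (posnP v) => [v0|v0]; [congr (proj _ _); apply: ord_inj|apply: (@proj_up _ 1)].
by rewrite !const.
Qed.

Lemma cochain0_iso : subq_iso (fun a : V n.+1 => to_cochain 0 (fun=> a))
  (@polygonZ A n n.+1) (fun a => a = 0) (fun x => graph_diff x = 0)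
  (fun x => exists u : cochain A n.+1 0, (\0 : cochain A n.+1 0 -> cochain A n.+1 0) u = x).
Proof.
have up0 : up n n.+1 = set0 by apply/setP => e; rewrite !inE leqNgt ltn_ord.
split=> [a b|a ha|a ha|y hy].
- by rewrite -to_cochainB.
- rewrite graph_diff_to_cochain; apply/to_cochain_eq0 => t /eqP/cards1P[e ->].
  have := ha e (ltn_ord e); rewrite up0 setU0 => hae.
  apply: (subg_sum (proj_ker_subg _ _)) => f _; exact: (subgMz (proj_ker_subg _ _)).
- split=> [->|[u /= /esym/to_cochain_eq0 h]].
    by exists 0; apply/esym/to_cochain_eq0 => s _; exact: (subg0 (proj_ker_subg _ _)).
  rewrite -(tensor_map_id (phi := id) a (frefl _)).
  by apply: (@proj_ker_map _ _ set0 _ id a _ (h set0 (cards0 _))) => e; rewrite inE.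
have [c yc] := to_cochain_surj y; move: hy; rewrite -yc graph_diff_to_cochain.
move/to_cochain_eq0 => hc; exists (c set0) => [e _|].
  have := hc [set e] (cards1 e); rewrite up0 setU0 /cube_diff big_set1 setDv => h.
  have := subgMz (proj_ker_subg _ _) ((-1) ^+ pos [set e] e) h.
  by rewrite -mulrzA -expr2 sqrr_sign.
exists 0; apply/esym; rewrite -to_cochainB; apply/to_cochain_eq0 => s /cards0_eq->.
by rewrite subrr; exact: (subg0 (proj_ker_subg _ _)).
Qed.

End PolygonMoore.

Lemma presents_polygon0 (A : comPzRingType) r :
  presents (polygon_cohomology A r.+2 0) (@mooreZ A r) (fun a => a = 0).
Proof.
apply: (presents_ext (Z := @polygonZ A r.+1 r.+2) (D := fun a => a = 0)) => //; last first.
  apply: (presents_pull _ (@cochain0_iso A r.+1)); last exact: presents_homology.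
  by split=> [|x y hx hy]; rewrite ?raddf0 // raddfB /= hx hy subrr.
move=> x; have cid : @collapse r.+1 r.+1 =1 id.
  by move=> v; apply: ord_inj; rewrite val_collapse ltn_ord.
have iid : @include r.+1 r.+1 =1 id by move=> v; apply: ord_inj; rewrite val_include.
split=> [h i ir|h e er].
  have := @face_of_proj_ker A r.+1 r (Ordinal ir) _ x (leqnn _) ir erefl (h (Ordinal ir) ir).
  by rewrite (tensor_map_id x cid).
have := @proj_ker_of_face A r.+1 r e _ x (leqnn _) er erefl (h e er).
by rewrite (tensor_map_id x iid).
Qed.

(** * Descent to one variable *)

Section Periodicity.
Variables (A : comPzRingType) (pi : {rmorphism {poly int} -> A}) (P : {poly int}).
Hypotheses (Pm : P \is monic) (Ps : (1 < size P)%N).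
Hypothesis pi_surj : forall a, exists q, pi q = a.
Hypothesis pi_ker : forall q, pi q = 0 <-> exists u, q = u * P.

Local Notation B := iter_poly.
Local Notation V n := (tensor A 'I_n).
Local Notation psi := (psi pi).

Definition nullP n (b : B n.+1) : Prop := psi b = 0.
Definition chainP n (b : B n.+1) : Prop := chain (psi b).
Local Notation yv := first_var.
Local Notation wv := last_var.
Local Notation aZ n := (alphaZ (@nullP n) (@chainP n) (yv n) (wv n)).
Local Notation aD n := (alphaD P (@nullP n) (@chainP n) (yv n) (wv n)).
Local Notation bZ n := (betaZ P (@nullP n) (@chainP n) (yv n) (wv n)).
Local Notation bD n := (betaD (@nullP n) (@chainP n) (yv n) (wv n)).

Lemma nullP_subg n : subg (@nullP n).
Proof. by split=> [|x y hx hy]; rewrite /nullP ?raddf0 // raddfB /= hx hy subrr. Qed.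

Lemma chainP_subg n : subg (@chainP n).
Proof.
split=> [|x y hx hy]; rewrite /chainP; first by rewrite raddf0; exact: (subg0 (@chain_subg A n)).
by rewrite raddfB; exact: (subgB (@chain_subg A n) hx hy).
Qed.

Lemma nullP_chainP n x : @nullP n x -> @chainP n x.
Proof. by rewrite /nullP /chainP => ->; exact: (subg0 (@chain_subg A n)). Qed.

Lemma nullP_mul n (b c : B n.+1) : nullP c -> nullP (b * c).
Proof. exact: (psi_ker_mul Pm Ps pi_surj pi_ker). Qed.

Lemma chainP_mul n (b c : B n.+1) : chainP c -> chainP (b * c).
Proof. exact: (chain_mul Pm Ps pi_surj pi_ker). Qed.

Lemma psi_int_poly n : psi (int_poly P (B n) : B n.+1) = 0.
Proof. by rewrite -[int_poly P (B n)]mul1r (psi_mulP pi_ker). Qed.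

Lemma nullP_y n : nullP (int_poly P (B n.+1)).[yv n].
Proof. by rewrite /nullP -(psi_horner _ (psi_first_var pi (n := n))) psi_int_poly raddf0. Qed.

Lemma nullP_w n : nullP (int_poly P (B n.+1)).[wv n].
Proof. by rewrite /nullP -(psi_horner _ (psi_last_var pi (n := n))) psi_int_poly raddf0. Qed.

Lemma nullPE n (b : {poly B n.+1}) : @nullP n.+1 b <->
  exists q, forall j, nullP (b - q * int_poly P (B n.+1))`_j.
Proof. exact: (psi_ker Pm Ps pi_surj pi_ker). Qed.

Lemma chainPE n (b : {poly B n.+1}) : @chainP n.+1 b <->
  (exists q, forall j, chainP (b - q * int_poly P (B n.+1))`_j) /\ nullP b.[wv n].
Proof. exact: (chainS Pm Ps pi_surj pi_ker). Qed.

Lemma beta_alpha n : subq_iso (fun v : B n.+1 => v%:P * delta P 'X (yv n)%:P : B n.+2)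
  (bZ n) (bD n) (aZ n.+1) (aD n.+1).
Proof.
exact: (beta_alpha_iso Pm Ps (@nullP_subg n) (@chainP_subg n) (@nullP_mul n) (@chainP_mul n)
  (@nullP_y n) (@nullP_w n) (@nullPE n) (@chainPE n)).
Qed.

Lemma alpha_beta n : subq_iso (fun v : B n.+1 => v%:P * ('X - (wv n)%:P) : B n.+2)
  (aZ n) (aD n) (bZ n.+1) (bD n.+1).
Proof.
exact: (alpha_beta_iso Pm Ps (@nullP_subg n) (@chainP_subg n) (@nullP_chainP n)
  (@nullP_mul n) (@chainP_mul n) (@nullP_y n) (@nullP_w n) (@nullPE n) (@chainPE n)).
Qed.

Lemma eval_beta n : subq_iso (horner_eval (yv n) : B n.+2 -> B n.+1)
  (@chainP n.+1) (bZ n.+1) (bD n) (@nullP n).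
Proof.
exact: (eval_iso Pm Ps (@nullP_subg n) (@chainP_subg n) (@nullP_mul n) (@chainP_mul n)
  (@nullP_y n) (@nullP_w n) (@nullPE n) (@chainPE n)).
Qed.

Lemma bD_eval n (v : B n.+1) :
  bD n v <-> exists2 a : B n.+2, chainP a & nullP (v - (a : {poly B n.+1}).[yv n]).
Proof.
exact: (betaD_eval Pm Ps (@nullP_subg n) (@chainP_subg n) (@nullP_mul n) (@chainP_mul n)
  (@nullP_y n) (@nullP_w n) (@nullPE n) (@chainPE n)).
Qed.

Lemma aZ_subg n : subg (aZ n).
Proof.
split=> [|a b [ha ka] [hb kb]]; split.
- exact: (subg0 (@chainP_subg n)).
- by rewrite mulr0; exact: (subg0 (@nullP_subg n)).
- exact: (subgB (@chainP_subg n) ha hb).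
- by rewrite mulrBr; exact: (subgB (@nullP_subg n) ka kb).
Qed.

Lemma bZ_subg n : subg (bZ n).
Proof.
split=> [|a b [ha ka] [hb kb]]; split.
- exact: (subg0 (@chainP_subg n)).
- by rewrite mulr0; exact: (subg0 (@nullP_subg n)).
- exact: (subgB (@chainP_subg n) ha hb).
- by rewrite mulrBr; exact: (subgB (@nullP_subg n) ka kb).
Qed.

Lemma mult_subg n (t : B n.+1) :
  subg (fun v => exists2 l, @chainP n l & nullP (v - t * l)).
Proof.
split=> [|a b [l hl ka] [m hm kb]].
  exists 0; first exact: (subg0 (@chainP_subg n)).
  by rewrite mulr0 subr0; exact: (subg0 (@nullP_subg n)).
exists (l - m); first exact: (subgB (@chainP_subg n) hl hm).
have -> : a - b - t * (l - m) = (a - t * l) - (b - t * m) by ring.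
exact: (subgB (@nullP_subg n) ka kb).
Qed.

(** Each removal of a variable exchanges alpha and beta, so the parity of [n] decides which one is
    reached. *)
Lemma presents_descent (G : zmodType) n :
  (presents G (bZ n) (bD n) ->
     if odd n then presents G (aZ 0) (aD 0) else presents G (bZ 0) (bD 0)) /\
  (presents G (aZ n) (aD n) ->
     if odd n then presents G (bZ 0) (bD 0) else presents G (aZ 0) (aD 0)).
Proof.
elim: n => [|n [IHb IHa]] //; split=> h /=.
  have /IHa := presents_pull (bZ_subg n.+1) (alpha_beta n) h.
  by case: (odd n).
have /IHb := presents_pull (aZ_subg n.+1) (beta_alpha n) h.
by case: (odd n).
Qed.

(** [merge_next] keeps a unit where [face] shortens the tensor; [face_map] and [degen_map] pass from
    one form to the other. *)
Lemma chain_face r (v : V r.+2) : chain v <-> forall i, (i < r.+1)%N -> face i v = 0.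
Proof.
split=> h i ir.
  rewrite /face -(@eq_tensor_map _ _ _ (@face_map r i \o @merge_next r.+1 i)).
    by rewrite -tensor_map_comp h // raddf0.
  move=> k /=; apply: ord_inj; rewrite !val_face_map ?(leqW ir) // /merge_next.
  case: (eqVneq (val k) i.+1) => [ki|//]; rewrite inordK ?(leqW ir) //.
  by rewrite (ki : k = i.+1 :> nat); split_ifs; lia.
rewrite -(@eq_tensor_map _ _ _ (@degen_map r i \o @face_map r i)).
  by rewrite -tensor_map_comp -/(face i v) h // raddf0.
move=> k /=; apply: ord_inj; rewrite val_degen_map val_face_map ?(leqW ir) // /merge_next.
case: (eqVneq (val k) i.+1) => [ki|ki].
  by rewrite inordK ?(leqW ir) // ki; split_ifs; lia.
by have := ltn_ord k; move: ki; rewrite /=; move: (k : nat) => x; split_ifs; lia.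
Qed.

Lemma face_top n (b : {poly B n.+1}) : face n.+1 (psi (b : B n.+2)) = psi b.[yv n].
Proof.
rewrite -(psi_horner _ (psi_first_var pi (n := n))); apply: eq_tensor_map => k.
apply: ord_inj; rewrite val_face_map // -ltnS ltn_ord /fold_last.
case: (unliftP ord_max k) => [j ->|->] /=; last by rewrite eqxx.
by rewrite -[bump _ _]/(nat_of_ord (fintype.lift ord_max j)) lift_max ltn_eqF.
Qed.

Lemma bZE n (b : {poly B n.+1}) : bZ n.+1 b <-> mooreZ (psi (b : B n.+2)).
Proof.
have e : nullP (delta P (wv n.+1) (yv n.+1) * b) <-> nullP b.[yv n].
  exact: (step_dl Pm Ps (@nullP_subg n) (@nullP_mul n) (@nullP_y n) (@nullPE n)).
split=> [[/chain_face hc /e hy] i|h].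
  by rewrite ltnS leq_eqVlt => /orP[/eqP->|/hc //]; rewrite face_top.
split; first by apply/chain_face => i ir; apply: h; apply: leqW.
by apply/e; rewrite /nullP -face_top; apply: h.
Qed.

Lemma moore_psi_iso r : subq_iso (fun b : B r.+2 => psi b) (bZ r.+1) (bD r.+1)
  (@mooreZ A r) (@mooreD A r).
Proof.
split=> [a b|b /bZE//|b hb|v hv]; first exact: raddfB.
  split=> [/bD_eval[a ha]|[v hv e]].
    rewrite /nullP raddfB => /eqP; rewrite subr_eq0 => /eqP e.
    exists (psi a); first by apply/chain_face.
    by rewrite face_top.
  have [a ea] := psi_surj pi_surj v; apply/bD_eval; exists a.
    by rewrite /chainP ea; apply/chain_face.
  by rewrite /nullP raddfB /= e -ea face_top subrr.
have [b eb] := psi_surj pi_surj v; exists b; first by apply/bZE; rewrite eb.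
rewrite eb subrr; exists 0 => [i ir|]; by rewrite raddf0.
Qed.

Lemma presents_moore (G : zmodType) r : presents G (@mooreZ A r) (@mooreD A r) ->
  if odd r then presents G (bZ 0) (bD 0) else presents G (aZ 0) (aD 0).
Proof.
move=> h; have := presents_pull (@mooreZ_subg A r) (moore_psi_iso r) h.
by move/(presents_descent G r.+1).1 => /=; case: (odd r).
Qed.

Lemma psi1E (b : {poly int}) : psi (b : B 1) = adjoin (pi b) (pure [ffun=> 1]).
Proof.
have e : b = 1%:P * map_poly intr b.
  by rewrite mul1r -[LHS](map_poly_id (g := id)) //; apply: eq_map_poly => k; rewrite /= intz.
rewrite [in LHS]e -[LHS]/(psi (1%:P * map_poly intr b : B 1)).
by rewrite psi_map psi0E mulr1z.
Qed.

Fact eval0_lin (f : {ffun 'I_1 -> A}) i u v :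
  (upd f i (u + v)) ord0 = (upd f i u) ord0 + (upd f i v) ord0.
Proof. by rewrite [i]ord1 !ffunE. Qed.

Lemma adjoin1_inj a : adjoin a (pure ([ffun=> 1] : {ffun 'I_0 -> A})) = 0 -> a = 0.
Proof.
move/(congr1 (tensor_lift (F := fun f : {ffun 'I_1 -> A} => f ord0) eval0_lin)).
rewrite raddf0 adjoin_pure tensor_lift_pure.
by rewrite (_ : ord0 = ord_max) ?ext_max //; apply: val_inj.
Qed.

Lemma nullP0 (b : {poly int}) : @nullP 0 b <-> pi b = 0.
Proof. by rewrite /nullP psi1E; split=> [/adjoin1_inj//|->]; rewrite adjoin0. Qed.

Lemma chainP0 b : @chainP 0 b. Proof. by move=> i. Qed.

(** With one variable y and w coincide: the divided difference becomes the derivative, and the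
    factor w - y becomes 0. *)
Lemma delta0 : delta P (wv 0) (yv 0) = P^`() :> {poly int}.
Proof.
rewrite [LHS](delta_diag P ('X : {poly int})).
by rewrite horner_int_polyX -[RHS](map_poly_id (g := id)) //; apply: eq_map_poly => k;
  rewrite /= intz.
Qed.

Lemma aZ0 b : aZ 0 b.
Proof. by split; [exact: chainP0|rewrite subrr mul0r; exact: (subg0 (@nullP_subg 0))]. Qed.

Lemma aD0 (b : {poly int}) : aD 0 b <-> exists l, pi b = pi P^`() * pi l.
Proof.
split=> [[l _ /nullP0]|[l e]].
  by rewrite delta0 rmorphB rmorphM /= => /eqP; rewrite subr_eq0 => /eqP ->; exists l.
exists l; first exact: chainP0.
by apply/nullP0; rewrite delta0 rmorphB rmorphM /= e subrr.
Qed.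

Lemma bZ0 (b : {poly int}) : bZ 0 b <-> pi (P^`() * b) = 0.
Proof.
split=> [[_ /nullP0]|h]; first by rewrite delta0.
by split; [exact: chainP0|apply/nullP0; rewrite delta0].
Qed.

Lemma bD0 (b : {poly int}) : bD 0 b <-> pi b = 0.
Proof.
split=> [[l _ /nullP0]|h]; first by rewrite subrr mul0r subr0.
by exists 0; [exact: chainP0|apply/nullP0; rewrite subrr mul0r subr0].
Qed.

Lemma presents_moore_odd (G : zmodType) r : ~~ odd r -> presents G (@mooreZ A r) (@mooreD A r) ->
  presents G (fun _ : {poly int} => True) (fun b => exists l, pi b = pi P^`() * pi l).
Proof.
move=> /negPf ro /presents_moore; rewrite ro; apply: presents_ext => b.
  by split=> // _; exact: aZ0.
by move=> _; exact: aD0.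
Qed.

Lemma presents_moore_even (G : zmodType) r : odd r -> presents G (@mooreZ A r) (@mooreD A r) ->
  presents G (fun b : {poly int} => pi (P^`() * b) = 0) (fun b => pi b = 0).
Proof.
move=> ro /presents_moore; rewrite ro; apply: presents_ext => b; first exact: bZ0.
by move=> _; exact: bD0.
Qed.

Lemma HH0_iso : HH A 0 \simeq A.
Proof.
pose h (a : A) := adjoin a (pure ([ffun=> 1] : {ffun 'I_0 -> A})) : V 1.
apply: (@presents_iso _ A (fun=> True) (fun a => a = 0)) => //; last exact: presents_self.
apply: (@presents_pull _ (V 1) (fun x => (\0 : V 1 -> V 1) x = 0)
  (fun x => exists u : V 2, hoch_diff u = x) _ A h); last exact: presents_homology.
  by split=> // x y _ _.
(* Both faces merge the two factors into the only remaining one, by commutativity, and they carry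
   opposite signs. *)
have d0 (u : V 2) : hoch_diff u = 0.
  rewrite hoch_diffE big_nat_recl // big_nat1 /= expr1 expr0 mulrN1z mulr1z.
  apply/eqP; rewrite subr_eq0; apply/eqP; apply: eq_tensor_map => k; apply: ord_inj.
  by rewrite [LHS](_ : _ = 0%N) ?[RHS](_ : _ = 0%N) //; apply/eqP; rewrite -leqn0 -ltnS ltn_ord.
split=> // [a b|a _|v _]; first by rewrite /h adjoinB.
  split=> [->|[u]]; first by exists 0; rewrite d0 /h adjoin0.
  by rewrite d0 => /esym/adjoin1_inj.
have [b <-] := psi_surj pi_surj v; exists (pi b) => //; exists 0.
by rewrite d0 psi1E subrr.
Qed.

End Periodicity.

Lemma subq_rank_pull (V W : zmodType) (h : V -> W) (Z D : V -> Prop) (Z' D' : W -> Prop) r :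
  subg Z -> subg D' -> subq_iso h Z D Z' D' -> subq_rank Z' D' r -> subq_rank Z D r.
Proof.
move=> hZ hD' [hB hZZ hDD hs] [I [v [<- vZ vf vspan]]].
pose hm := GRing.isZmodMorphism.Build _ _ h hB.
pose h' : {additive V -> W} := HB.pack h hm.
have /choice[x hx] i : exists x, Z x /\ D' (v i - h x).
  by have [x] := hs _ (vZ i); exists x.
have Zs c : Z (\sum_i x i *~ c i) by apply: subg_sum => // i _; apply: subgMz => //; case: (hx i).
have diff c : D' (\sum_i v i *~ c i - h (\sum_i x i *~ c i)).
  have -> : h (\sum_i x i *~ c i) = \sum_i h (x i) *~ c i.
    by rewrite -[h]/(h' : V -> W) raddf_sum; apply: eq_bigr => i _; rewrite raddfMz.
  rewrite -sumrB; apply: subg_sum => // i _; rewrite -mulrzBl.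
  by apply: subgMz => //; case: (hx i).
exists I, x; split=> // [i|c|y Zy]; first by case: (hx i).
  move/(hDD _ (Zs c)) => hc; apply: vf; rewrite -[X in D' X](subrK (h (\sum_i x i *~ c i))).
  exact: (subgD hD').
have [k k0 [c hc]] := vspan _ (hZZ y Zy); exists k => //; exists c.
apply/hDD; first by apply: subgB => //; apply: subgMz.
have -> : h (y *~ k - \sum_i x i *~ c i) =
    (h y *~ k - \sum_i v i *~ c i) + (\sum_i v i *~ c i - h (\sum_i x i *~ c i)).
  by rewrite addrA subrK hB; congr (_ - _); rewrite -[h]/(h' : V -> W) raddfMz.
exact: (subgD hD').
Qed.

(** No nonzero element of [Z] maps to 0, so the chosen section of [f] is automatically additive. *)
Lemma presents_embedding (G V : zmodType) (Z : V -> Prop) : subg Z ->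
  presents G Z (fun x => x = 0) -> exists e : {additive G -> V}, injective e.
Proof.
move=> hZ [f [fB fs fD]].
pose s g := s2val (cid2 (fs g)).
have sZ g : Z (s g) by rewrite /s; case: cid2.
have sK g : f (s g) = g by rewrite /s; case: cid2.
have sB : zmod_morphism s.
  move=> x y; have zxy := subgB hZ (sZ x) (sZ y).
  apply/eqP; rewrite -subr_eq0; apply/eqP/fD; first exact: subgB.
  by rewrite fB // [f (s x - _)]fB // !sK subrr.
pose m := GRing.isZmodMorphism.Build _ _ s sB.
by exists (HB.pack_for {additive G -> V} s m); apply: (can_inj sK).
Qed.

Lemma rank_quot_monic (P : {poly int}) : P \is monic -> (1 < size P)%N ->
  subq_rank (fun _ : {poly int} => True) (fun b => exists u, b = u * P) (size P).-1.
Proof.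
move=> Pm Ps; exists 'I_(size P).-1, (fun j : 'I_(size P).-1 => 'X^j).
have sE (c : 'I_(size P).-1 -> int) : \sum_(j < (size P).-1) ('X^j : {poly int}) *~ c j =
    \sum_(j < (size P).-1) c j *: 'X^j.
  by apply: eq_bigr => j _; rewrite -scaler_int intz.
have cE (c : 'I_(size P).-1 -> int) (i : 'I_(size P).-1) : (\sum_(j < (size P).-1) c j *:
  'X^j)`_i = c i.
  rewrite coef_sum (bigD1 i) //= coefZ coefXn eqxx mulr1 big1 ?addr0 // => j ji.
  by rewrite coefZ coefXn -[_ == _ :> nat]/(i == j) eq_sym (negPf ji) mulr0.
have sz (c : 'I_(size P).-1 -> int) : (size (\sum_(j < (size P).-1) c j *: 'X^j)%R < size P)%N.
  apply: (@leq_ltn_trans (size P).-1); last by case: (size P) Ps.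
  apply: (leq_trans (size_sum _ _ _)); apply/bigmax_leqP => j _.
  by rewrite (leq_trans (size_scale_leq _ _)) // size_polyXn.
split=> [||c [u hu] i|b _] //; first exact: card_ord.
  have u0 : u = 0.
    apply/eqP; apply: contraT => u0; have := sz c; rewrite -sE hu size_Mmonic //.
    by move: u0; rewrite -size_poly_gt0; move: (size u) (size P) => m k; lia.
  by rewrite -(cE c i) -sE hu u0 mul0r coef0.
exists 1 => //; exists (fun j : 'I_(size P).-1 => (Pdiv.Ring.rmodp b P)`_j).
exists (Pdiv.Ring.rdivp b P); rewrite mulr1z sE.
rewrite {1}(Pdiv.RingMonic.rdivp_eq Pm b) -addrA -[RHS]addr0; congr (_ + _).
apply/eqP; rewrite subr_eq0; apply/eqP; rewrite -poly_def.
apply/polyP => i; rewrite coef_poly; case: ltnP => // iP.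
rewrite nth_default // (leq_trans _ iP) //.
have := Pdiv.CommonRing.ltn_rmodpN0 b (monic_neq0 Pm).
by case: (size P) Ps.
Qed.

(** * Ranks of the groups of cocycles *)

Section Ranks.
Variables (A : comPzRingType) (pi : {rmorphism {poly int} -> A}) (P : {poly int}).
Hypotheses (Pm : P \is monic) (Ps : (1 < size P)%N).
Hypothesis pi_surj : forall a, exists q, pi q = a.
Hypothesis pi_ker : forall q, pi q = 0 <-> exists u, q = u * P.

Local Notation B := iter_poly.
Local Notation V n := (tensor A 'I_n).
Local Notation psi := (psi pi).
Local Notation d := (size P).-1.
Local Notation nullP n := (@nullP A pi n).
Local Notation chainP n := (@chainP A pi n).
Local Notation aZ n := (alphaZ (nullP n) (chainP n) (first_var n) (last_var n)).
Local Notation aD n := (alphaD P (nullP n) (chainP n) (first_var n) (last_var n)).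
Local Notation bZ n := (betaZ P (nullP n) (chainP n) (first_var n) (last_var n)).
Local Notation bD n := (betaD (nullP n) (chainP n) (first_var n) (last_var n)).

Let nsub n : subg (nullP n) := @nullP_subg A pi n.
Let csub n : subg (chainP n) := @chainP_subg A pi n.

Lemma bD_subg n : subg (bD n).
Proof. exact: mult_subg. Qed.
Lemma aD_subg n : subg (aD n).
Proof. exact: mult_subg. Qed.

(** The product (w - y) D(w,y) is P(w) - P(y), and both terms vanish in the tensor power. *)
Lemma bD_bZ n v : bD n v -> bZ n v.
Proof.
case=> l hl hv; have hl' : chainP n ((last_var n - first_var n) * l).
  exact: (chainP_mul Pm Ps pi_surj pi_ker).
split; first by apply: (subgDr (csub n) (subgN (csub n) hl')); apply: nullP_chainP.
rewrite -[v](subrK ((last_var n - first_var n) * l)) mulrDr.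
apply: (subgD (nsub n)); first exact: (nullP_mul Pm Ps pi_surj pi_ker).
set dl := delta _ _ _; have -> : dl * ((last_var n - first_var n) * l) =
  l * ((last_var n - first_var n) * dl) by ring.
rewrite deltaE.
apply: (nullP_mul Pm Ps pi_surj pi_ker).
by apply: (subgB (nsub n)); [exact: nullP_w|exact: nullP_y].
Qed.

Lemma nullP_bD n v : nullP n v -> bD n v.
Proof. by move=> h; exists 0; [exact: (subg0 (csub n))|rewrite mulr0 subr0]. Qed.

Lemma rank_chain n : subq_rank (chainP n) (nullP n) (d * (size P).-2 ^ n).
Proof.
elim: n => [|n IH].
  rewrite muln1; apply: subq_rank_ext (rank_quot_monic Pm Ps) => b.
    by split=> // _ i.
  by rewrite nullP0 pi_ker.
rewrite expnSr mulnA.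
exact: (chain_rank Pm Ps (first_var n) (nsub n) (csub n)
  (@nullP_mul A pi P Pm Ps pi_surj pi_ker n) (@chainP_mul A pi P Pm Ps pi_surj pi_ker n)
  (@nullP_w A pi P pi_ker n) (@nullPE A pi P Pm Ps pi_surj pi_ker n)
  (@chainPE A pi P Pm Ps pi_surj pi_ker n) IH).
Qed.

Variable g : nat.
Hypothesis rank_a0 :
  subq_rank (fun _ : {poly int} => True) (fun b => exists l, pi b = pi P^`() * pi l) g.
Hypothesis rank_b0 :
  subq_rank (fun b : {poly int} => pi (P^`() * b) = 0) (fun b => pi b = 0) g.

Lemma rank_b_a n : subq_rank (bZ n) (bD n) g /\ subq_rank (aZ n) (aD n) g.
Proof.
elim: n => [|n [IHb IHa]]; split.
- by apply: subq_rank_ext rank_b0 => b; apply: iff_sym; [exact: bZ0|exact: bD0].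
- apply: subq_rank_ext rank_a0 => b; last by apply: iff_sym; exact: aD0.
  by split=> // _; exact: aZ0.
- exact: (subq_rank_push (aZ_subg _ _) (bD_subg _) (alpha_beta Pm Ps pi_surj pi_ker n) IHa).
- exact: (subq_rank_push (bZ_subg _ _ _) (aD_subg _) (beta_alpha Pm Ps pi_surj pi_ker n) IHb).
Qed.

(** Let e be the rank of [bD n]. Then [bZ n] has rank g + e, and [eval_beta] gives rank L_(n+2) = e
    + a', with a' the rank of [bZ n.+1]. Eliminating e leaves a' = d (d-1)^(n+1) - a + g, so the
    contribution of g disappears at every second step. *)
Lemma rank_bZ n : exists2 a : nat, subq_rank (bZ n) (nullP n) a &
  a%:Z = (d%:Z - 1) ^+ n.+1 + (-1) ^+ n.+1 * (d%:Z - 1) + (if odd n then 0 else g%:Z).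
Proof.
elim: n => [|n [a ha ea]].
  exists g; last by rewrite /=; ring.
  apply: subq_rank_ext (rank_b_a 0).1 => // b; rewrite nullP0; exact: bD0.
have [e he] : exists e, subq_rank (bD n) (nullP n) e.
  by apply: (subq_rankW (nsub n) _ (rank_chain n)) => v /bD_bZ[].
have hge := subq_rankD (bD_subg n) (@bD_bZ n) (@nullP_bD n) (rank_b_a n).1 he.
have ae := subq_rank_uniq (nsub n) ha hge.
have hce := subq_rank_pull (csub n.+1) (nsub n) (eval_beta Pm Ps pi_surj pi_ker n) he.
have [a' ha'] : exists a', subq_rank (bZ n.+1) (nullP n.+1) a'.
  by apply: (subq_rankW (nsub n.+1) _ (rank_chain n.+1)) => v [].
have hl := subq_rankD (bZ_subg pi P n.+1) _ _ hce ha'.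
have {hl} : (d * (size P).-2 ^ n.+1)%N = (e + a')%N.
  apply: (subq_rank_uniq (nsub n.+1) (rank_chain n.+1)); apply: hl; first by move=> v [].
  by move=> v hv; apply: bD_bZ; apply: nullP_bD.
move=> el; exists a' => //.
have -> : a'%:Z = (d * (size P).-2 ^ n.+1)%:Z - (a%:Z - g%:Z) by rewrite el ae; lia.
rewrite -[(size P).-2]/(d.-1).
have -> : (d * d.-1 ^ n.+1)%:Z = d%:Z * (d%:Z - 1) ^+ n.+1.
  rewrite PoszM -!natz natrX; congr (_ * _ ^+ _).
  by rewrite !natz; case: (size P) Ps => [|[|k]] // _; rewrite /=; lia.
by rewrite ea /=; case: (odd n); rewrite !exprS; ring.
Qed.

Lemma rank_mooreZ r : exists2 a : nat, subq_rank (@mooreZ A r) (fun v => v = 0) a &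
  a%:Z = (d%:Z - 1) ^+ r.+2 + (-1) ^+ r.+2 * (d%:Z - 1) + (if odd r then g%:Z else 0).
Proof.
have [a ha ea] := rank_bZ r.+1; exists a; last by rewrite ea /=; case: (odd r).
apply: (subq_rank_push (h := fun b : B r.+2 => psi b) (bZ_subg _ _ _) (@subg_zero _) _ ha).
have [hB hZ _ _] := moore_psi_iso Pm Ps pi_surj pi_ker r; split=> // v hv.
have [b eb] := psi_surj pi_surj v; exists b; last by rewrite eb subrr.
by apply/(bZE Pm Ps pi_surj pi_ker); rewrite eb.
Qed.

Lemma moore_free (G : zmodType) r a : presents G (@mooreZ A r) (fun v => v = 0) ->
  subq_rank (@mooreZ A r) (fun v => v = 0) a -> G \simeq 'rV[int]_a.
Proof.
move=> hG ha; have [e einj] := presents_embedding (@mooreZ_subg A r) hG.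
have [K [f finj]] := tensor_embedding Pm Ps pi_surj pi_ker r.+2.
have hr := presents_rank (@mooreZ_subg A r) hG ha.
exact: (@free_rank _ _ (f \o e : {additive G -> 'rV[int]_K}) _ (inj_comp finj einj) hr).
Qed.

End Ranks.

(** * The polynomial p and its derivative *)

Section CommonRoots.
Local Notation pQ p := (map_poly (intr : int -> rat) p).

Lemma int_poly_inj (p q : {poly int}) : pQ p = pQ q -> p = q.
Proof. by apply: map_inj_poly => //; exact: intr_inj. Qed.

Lemma clear_denominators (f : {poly rat}) :
  exists2 k : int, k != 0 & exists h : {poly int}, k%:~R *: f = pQ h.
Proof.
have [h [a a0 e]] := rat_poly_scale f; exists a => //; exists h.
by rewrite e scalerA mulfV ?scale1r // intr_eq0.
Qed.

Variable p : {poly int}.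
Hypotheses (p_size : (1 < size p)%N) (p_lead : lead_coef p = 1 \/ lead_coef p = -1).

Local Notation F := (pQ p).
Local Notation G := F^`().
Local Notation gam := (gcdp F G).
Local Notation g := (size gam).-1.

Lemma lead_sqr : lead_coef p * lead_coef p = 1.
Proof. by case: p_lead => ->. Qed.

Definition monic_assoc : {poly int} := lead_coef p *: p.

Lemma monic_assoc_monic : monic_assoc \is monic.
Proof. by rewrite monicE lead_coefZ lead_sqr. Qed.

Lemma monic_assocK : lead_coef p *: monic_assoc = p.
Proof. by rewrite scalerA lead_sqr scale1r. Qed.

Lemma size_monic_assoc : size monic_assoc = size p.
Proof. by apply: size_scale; case: p_lead => ->. Qed.

Lemma dvd_monic_assoc b : (exists u, b = u * monic_assoc) <-> exists u, b = u * p.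
Proof.
split=> -[u ->]; exists (lead_coef p *: u); first by rewrite -scalerAl scalerAr.
by rewrite -{1}monic_assocK -scalerAl scalerAr.
Qed.

(** The remainder modulo the monic associate is integral and still a rational multiple of p; its
    degree is smaller, so it is 0. *)
Lemma dvd_over_rat (x : {poly int}) : F %| pQ x -> exists u, x = u * p.
Proof.
move=> Fx; apply/dvd_monic_assoc; have Pm := monic_assoc_monic.
set P := monic_assoc in Pm *.
exists (Pdiv.Ring.rdivp x P); have e := Pdiv.RingMonic.rdivp_eq Pm x.
set r := Pdiv.Ring.rmodp x P in e; suff r0 : r = 0 by rewrite {1}e r0 addr0.
have FP : F %= pQ P by rewrite map_polyZ eqp_sym eqp_scale // intr_eq0; case: p_lead => ->.
have Fr : pQ P %| pQ r.
  have -> : pQ r = pQ x - pQ (Pdiv.Ring.rdivp x P) * pQ P by rewrite {1}e rmorphD rmorphM /=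
    addrC addKr.
  by rewrite -(eqp_dvdl _ FP) dvdp_sub // (eqp_dvdl _ FP) dvdp_mull.
apply: int_poly_inj; rewrite rmorph0; apply/eqP; apply: contraT => r0.
have := dvdp_leq r0 Fr; rewrite !size_map_inj_poly ?rmorph0 //; try exact: intr_inj.
by rewrite leqNgt Pdiv.CommonRing.ltn_rmodpN0 ?monic_neq0.
Qed.

Lemma F_neq0 : F != 0.
Proof.
rewrite -size_poly_gt0 size_map_inj_poly ?rmorph0 //; last exact: intr_inj.
exact: ltnW.
Qed.

Lemma gam_neq0 : gam != 0.
Proof. by rewrite gcdp_eq0 (negPf F_neq0). Qed.

Lemma size_gam : size gam = g.+1.
Proof. by rewrite prednK // size_poly_gt0 gam_neq0. Qed.

Local Notation S c := (\sum_(j < g) c j *: 'X^j : {poly int}).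

Lemma coef_S (c : 'I_g -> int) (i : 'I_g) : (S c)`_i = c i.
Proof.
rewrite coef_sum (bigD1 i) //= coefZ coefXn eqxx mulr1 big1 ?addr0 // => j ji.
by rewrite coefZ coefXn -[_ == _ :> nat]/(i == j) eq_sym (negPf ji) mulr0.
Qed.

Lemma size_S (c : 'I_g -> int) : (size (pQ (S c)) < size gam)%N.
Proof.
rewrite [X in (_ < X)%N]size_gam ltnS size_map_inj_poly ?rmorph0 //; last exact: intr_inj.
apply: (leq_trans (size_sum _ _ _)); apply/bigmax_leqP => j _.
by rewrite (leq_trans (size_scale_leq _ _)) // size_polyXn.
Qed.

Lemma S_eq0 (c : 'I_g -> int) : gam %| pQ (S c) -> forall i, c i = 0.
Proof.
move=> h i; have e : S c = 0.
  apply: int_poly_inj; rewrite rmorph0; apply/eqP; apply: contraT => s0.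
  by have := dvdp_leq s0 h; rewrite leqNgt size_S.
by rewrite -coef_S e coef0.
Qed.

Lemma S_of_poly (h : {poly int}) : (size h <= g)%N -> h = S (fun j => h`_j).
Proof.
move=> hg; apply/polyP => i; rewrite -poly_def coef_poly; case: ltnP => // ig.
by rewrite nth_default // (leq_trans hg).
Qed.

(** Over the rationals the ideal (p, p') is generated by the gcd, so the powers of X below its
    degree form a basis of the quotient. *)
Lemma rank_quotient : subq_rank (fun _ : {poly int} => True)
  (fun b => exists u l, b = u * p + l * p^`()) g.
Proof.
exists 'I_g, (fun j : 'I_g => 'X^j).
have sE (c : 'I_g -> int) : \sum_(j < g) ('X^j : {poly int}) *~ c j = S c.
  by apply: eq_bigr => j _; rewrite -scaler_int intz.
split=> [||c|b _] //; first exact: card_ord.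
  rewrite sE => -[u [l e]]; apply: S_eq0; rewrite e rmorphD !rmorphM /= -deriv_map.
  by rewrite dvdp_add // dvdp_mull ?dvdp_gcdl ?dvdp_gcdr.
have [w /eqpP[[c1 c2] /= /andP[c10 c20] hw]] := Bezoutp F G.
pose q := pQ b %/ gam; pose r := pQ b %% gam.
have gE : gam = (c1 / c2) *: (w.1 * F + w.2 * G).
  by rewrite mulrC -scalerA hw scalerA mulVf // scale1r.
have [k1 k10 [a ha]] := clear_denominators (q * ((c1 / c2) *: w.1)).
have [k2 k20 [c hc]] := clear_denominators (q * ((c1 / c2) *: w.2)).
have [k3 k30 [s hs]] := clear_denominators r.
have sg : (size s <= g)%N.
  rewrite -ltnS -size_gam -(size_map_inj_poly (f := intr : int -> rat)) ?rmorph0 //;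
    last exact: intr_inj.
  by rewrite -hs (leq_ltn_trans (size_scale_leq _ _)) // ltn_modp gam_neq0.
(* [k1] and [k2] clear the denominators of the Bezout coefficients multiplied by the quotient of [b]
   by the gcd, and [k3] those of the remainder. *)
exists (k1 * k2 * k3); first by rewrite !mulf_neq0.
exists (fun j : 'I_g => k1 * k2 * s`_j); rewrite sE.
exists ((k2 * k3) *: a), ((k1 * k3) *: c).
have -> : S (fun j => k1 * k2 * s`_j) = (k1 * k2) *: s.
  rewrite [in RHS](S_of_poly sg) scaler_sumr; apply: eq_bigr => j _; by rewrite scalerA.
have eb : b *~ (k1 * k2 * k3) = (k1 * k2 * k3) *: b by rewrite -scaler_int intz.
apply: int_poly_inj; rewrite eb rmorphB rmorphD !rmorphM /= !map_polyZ -deriv_map -ha -hc -hs.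
have -> : pQ b = q * ((c1 / c2) *: (w.1 * F + w.2 * G)) + r by rewrite -gE; exact: divp_eq.
rewrite !scalerA -!mul_polyC !(rmorphM, rmorphD) /=; ring.
Qed.

(** Dividing p and p' by their gcd gives coprime [h0] and [g1]. By Gauss, p divides p' b over the
    rationals exactly when [h0] divides b, so the annihilator is [h0] times the polynomials modulo
    the gcd. *)
Lemma rank_annihilator : subq_rank (fun b : {poly int} => exists u, p^`() * b = u * p)
  (fun b => exists u, b = u * p) g.
Proof.
pose h0 := F %/ gam; pose g1 := G %/ gam.
have F_E : F = h0 * gam by rewrite divpK // dvdp_gcdl.
have G_E : G = g1 * gam by rewrite divpK // dvdp_gcdr.
have h00 : h0 != 0 by have := F_neq0; rewrite F_E mulf_eq0 negb_or => /andP[].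
have cop : coprimep h0 g1 by apply: coprimep_div_gcd; rewrite F_neq0.
have [k0 k00 [h hh]] := clear_denominators h0.
exists 'I_g, (fun j : 'I_g => 'X^j * h).
have sE (c : 'I_g -> int) : \sum_(j < g) ('X^j * h : {poly int}) *~ c j = S c * h.
  by rewrite mulr_suml; apply: eq_bigr => j _; rewrite -scaler_int intz scalerAl.
split=> [|j|c|b [u hu]]; first exact: card_ord.
- apply: dvd_over_rat; rewrite !rmorphM /= -deriv_map -hh [X in X * _]G_E.
  have -> : g1 * gam * (pQ 'X^j * (k0%:~R *: h0)) = (g1 * pQ 'X^j * k0%:~R%:P) * F.
    by rewrite [X in _ = _ * X]F_E -mul_polyC; ring.
  exact: dvdp_mull.
- rewrite sE => -[u e]; apply: S_eq0.
  have : F %| pQ (S c) * h0.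
    have -> : pQ (S c) * h0 = (k0%:~R)^-1 *: pQ u * F.
      rewrite -scalerAl -rmorphM /= -e rmorphM /= -hh -scalerAr scalerA mulVf ?scale1r //.
      by rewrite intr_eq0.
    exact: dvdp_mull.
  by rewrite [X in X %| _]F_E mulrC dvdp_mul2r.
have h0b : h0 %| pQ b.
  have : F %| G * pQ b by rewrite deriv_map -rmorphM /= hu rmorphM /= dvdp_mull.
  rewrite [X in X %| _]F_E [X in _ %| X * _]G_E mulrAC dvdp_mul2r ?gam_neq0 //.
  by rewrite Gauss_dvdpr.
pose t := pQ b %/ h0; have tE : pQ b = t * h0 by rewrite divpK.
have [k1 k10 [a ha]] := clear_denominators (t %/ gam).
(* The family is built on [h], which is [k0] times [h0]; the inverse of [k0] compensates for
   this. *)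
have [k2 k20 [s hs]] := clear_denominators (k0%:~R^-1 *: (t %% gam)).
have sg : (size s <= g)%N.
  rewrite -ltnS -size_gam -(size_map_inj_poly (f := intr : int -> rat)) ?rmorph0 //;
    last exact: intr_inj.
  by rewrite -hs !(leq_ltn_trans (size_scale_leq _ _)) // ltn_modp gam_neq0.
exists (k1 * k2); first by rewrite mulf_neq0.
exists (fun j : 'I_g => k1 * s`_j); rewrite sE; exists (k2 *: a).
have -> : S (fun j => k1 * s`_j) = k1 *: s.
  rewrite [in RHS](S_of_poly sg) scaler_sumr; apply: eq_bigr => j _; by rewrite scalerA.
have eb : b *~ (k1 * k2) = (k1 * k2) *: b by rewrite -scaler_int intz.
apply: int_poly_inj; rewrite eb rmorphB !rmorphM /= !map_polyZ -ha -hs -hh.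
rewrite tE {1}(divp_eq t gam) [X in _ = _ * X]F_E.
have k0K : k0%:~R * k0%:~R^-1 = 1 :> rat by rewrite mulfV // intr_eq0.
rewrite !scalerA -!mul_polyC !(rmorphM, rmorphD) /=.
set x := k0%:~R%:P; set y := (k0%:~R^-1)%:P.
have xy : x * y = 1 :> {poly rat} by rewrite -rmorphM /= k0K.
transitivity (k1%:~R%:P * k2%:~R%:P * ((t %/ gam) * gam + (t %% gam) * (1 - x * y)) * h0).
  ring.
by rewrite xy subrr mulr0 addr0; ring.
Qed.

End CommonRoots.

(** * Presentations over Z[x] of the groups in the theorem *)

Lemma rclass_eq0 (R : comPzRingType) (s : seq R) x :
  rclass s x = 0 <-> exists c : 'I_(size s) -> R, x = \sum_i c i * s`_i.
Proof.
have -> : (0 : ring_quot s) = rclass s 0 by rewrite raddf0.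
split=> [/eqP|h]; [|apply/eqP]; rewrite -Quotient.idealrBE subr0 unfold_in.
  by move=> /asboolP.
by apply/asboolP.
Qed.

Lemma rclass1_eq0 (R : comPzRingType) (t x : R) :
  rclass [:: t] x = 0 <-> exists u, x = u * t.
Proof.
rewrite rclass_eq0; split=> [[c ->]|[u ->]]; first by exists (c ord0); rewrite big_ord1.
by exists (fun=> u); rewrite big_ord1.
Qed.

Lemma rclass_surj (R : comPzRingType) (s : seq R) (a : ring_quot s) : exists x, rclass s x = a.
Proof. by exists (repr a); rewrite /rclass reprK. Qed.

Lemma presents_subgroup (V U : zmodType) (S : zmodClosed U) (f : {additive V -> U}) :
  (forall a, exists x, f x = a) ->
  presents (subgroup S) (fun x => f x \in S) (fun x => f x = 0).
Proof.
move=> fs; pose F x : subgroup S := insubd (0 : subgroup S) (f x).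
have FE x : f x \in S -> val (F x) = f x by move=> h; rewrite val_insubd h.
exists F; split=> [x y hx hy|[a ha]|x hx].
- by apply: val_inj; rewrite raddfB /= !FE // ?raddfB ?rpredB.
- by have [x ex] := fs a; exists x; rewrite ?ex //; apply: val_inj; rewrite FE ex.
- split=> [/(congr1 val)|h]; first by rewrite FE // => ->; rewrite raddf0.
  by apply: val_inj; rewrite FE // h raddf0.
Qed.

Lemma presents_onto (V G : zmodType) (f : {additive V -> G}) :
  (forall a, exists x, f x = a) -> presents G (fun=> True) (fun x => f x = 0).
Proof.
move=> fs; exists f; split=> // [x y _ _|g]; first by rewrite raddfB.
by have [x ex] := fs g; exists x.
Qed.

Lemma truth_subg (V : zmodType) : subg (fun _ : V => True).
Proof. by []. Qed.

Definition principal (p b : {poly int}) := exists u, b = u * p.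
Definition jacobian (p b : {poly int}) := exists u l, b = u * p + l * p^`().
Definition annihilator (p b : {poly int}) := exists u, p^`() * b = u * p.

Section PolynomialQuotient.
Variable p : {poly int}.
Hypotheses (p_size : (1 < size p)%N) (p_lead : lead_coef p = 1 \/ lead_coef p = -1).
Local Notation A := (poly_quot p).

Definition quot_proj : {rmorphism {poly int} -> A} := rclass [:: p].
Local Notation pi := quot_proj.
Local Notation P := (monic_assoc p).
Local Notation g := (size (gcdp (map_poly intr p : {poly rat}) (map_poly intr p)^`())).-1.

Lemma pi_surj a : exists q, pi q = a.
Proof. exact: rclass_surj. Qed.

Lemma pi_eq0 q : pi q = 0 <-> principal p q.
Proof. exact: rclass1_eq0. Qed.

Lemma pi_ker q : pi q = 0 <-> exists u, q = u * P.
Proof. by rewrite pi_eq0 dvd_monic_assoc. Qed.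

Let Pm : P \is monic := monic_assoc_monic p_lead.
Lemma P_size : (1 < size P)%N.
Proof. by rewrite size_monic_assoc. Qed.
Let Ps := P_size.

Lemma annihilator_subg : subg (annihilator p).
Proof.
split=> [|a b [u hu] [v hv]]; first by exists 0; rewrite mulr0 mul0r.
by exists (u - v); rewrite mulrBr hu hv mulrBl.
Qed.

Lemma jacobianE b : (exists l, pi b = pi P^`() * pi l) <-> jacobian p b.
Proof.
have dP : P^`() = lead_coef p *: p^`() by rewrite derivZ.
split=> [[l e]|[u [l e]]].
  have /pi_eq0[u hu] : pi (b - P^`() * l) = 0 by rewrite rmorphB rmorphM /= e subrr.
  exists u, (lead_coef p *: l); rewrite -hu dP -!scalerAl [l * _]mulrC.
  by rewrite subrK.
exists (lead_coef p *: l); rewrite -rmorphM; apply/eqP; rewrite -subr_eq0 -rmorphB.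
apply/eqP/pi_eq0; exists u.
by rewrite dP -scalerAl -scalerAr scalerA lead_sqr // scale1r e [l * _]mulrC addrK.
Qed.

Lemma annihilatorE b : pi (P^`() * b) = 0 <-> annihilator p b.
Proof.
have dP : P^`() = lead_coef p *: p^`() by rewrite derivZ.
rewrite pi_eq0 dP -scalerAl; split=> -[u hu]; exists (lead_coef p *: u).
  by rewrite -scalerAl -hu scalerA lead_sqr // scale1r.
by rewrite hu scalerAl.
Qed.

Lemma presents_moore_jacobian (G : zmodType) r : ~~ odd r ->
  presents G (@mooreZ A r) (@mooreD A r) -> presents G (fun=> True) (jacobian p).
Proof.
move=> ro /(presents_moore_odd Pm Ps pi_surj pi_ker ro).
by apply: presents_ext => // b _; exact: jacobianE.
Qed.

Lemma presents_moore_annihilator (G : zmodType) r : odd r ->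
  presents G (@mooreZ A r) (@mooreD A r) -> presents G (annihilator p) (principal p).
Proof.
move=> ro /(presents_moore_even Pm Ps pi_surj pi_ker ro).
by apply: presents_ext => [b|b _]; [exact: annihilatorE|exact: pi_eq0].
Qed.

Lemma HH_odd i : odd i -> presents (HH A i) (fun=> True) (jacobian p).
Proof. by case: i => // r ro; apply: presents_moore_jacobian ro _; exact: presents_HH. Qed.

Lemma HH_even i : ~~ odd i -> (2 <= i)%N -> presents (HH A i) (annihilator p) (principal p).
Proof.
case: i => // r ro _; apply: (@presents_moore_annihilator _ r); last exact: presents_HH.
by move: ro; rewrite /= negbK.
Qed.

Lemma presents_ideal_quot : presents (ring_quot [:: p; p^`()]) (fun=> True) (jacobian p).
Proof.
apply: presents_ext (presents_onto (@rclass_surj _ [:: p; p^`()])) => // b _.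
rewrite rclass_eq0; split=> [[c ->]|[u [l ->]]].
  by exists (c ord0), (c (fintype.lift ord0 ord0)); rewrite big_ord_recl big_ord1.
exists (fun i : 'I_2 => if i == ord0 then u else l).
by rewrite big_ord_recl big_ord1.
Qed.

Lemma presents_quot_quot :
  presents (ring_quot [:: rclass [:: p] p^`()]) (fun=> True) (jacobian p).
Proof.
have fs (a : ring_quot [:: rclass [:: p] p^`()]) :
    exists x, (rclass [:: rclass [:: p] p^`()] \o rclass [:: p]) x = a.
  by have [y <-] := rclass_surj a; have [x <-] := rclass_surj y; exists x.
apply: presents_ext (presents_onto fs) => // b _ /=.
rewrite rclass1_eq0; split=> [[c]|[u [l ->]]].
  have [l <-] := rclass_surj c => e.
  have /rclass1_eq0[u hu] : rclass [:: p] (b - l * p^`()) = 0 by rewrite rmorphB rmorphM /= e subrr.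
  by exists u, l; rewrite -hu subrK.
exists (rclass [:: p] l); rewrite rmorphD !rmorphM /=.
have -> : rclass [:: p] p = 0 by apply/rclass1_eq0; exists 1; rewrite mul1r.
by rewrite mulr0 add0r.
Qed.

Lemma presents_deriv_ann : presents (deriv_ann p) (annihilator p) (principal p).
Proof.
apply: presents_ext (@presents_subgroup _ _ (@in_deriv_ann p) pi pi_surj) => b.
  rewrite unfold_in; split=> [/asboolP[q e [u hu]]|[u hu]]; last first.
    by apply/asboolP; exists b => //; exists u; rewrite mulrC.
  apply/pi_eq0; rewrite rmorphM /= [pi b]e -rmorphM; apply/pi_eq0.
  by exists u; rewrite mulrC.
by move=> _; exact: pi_eq0.
Qed.

Lemma presents_kernel :
  presents (ker ((rclass [:: p] p^`() : A) \*o @idfun A)) (annihilator p) (principal p).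
Proof.
apply: presents_ext (@presents_subgroup _ _ (in_ker ((rclass [:: p] p^`() : A) \*o @idfun A)) pi
  pi_surj) => b; last by move=> _; exact: pi_eq0.
rewrite unfold_in /=; split=> [/eqP h|h].
  by apply/pi_eq0; rewrite rmorphM.
by apply/eqP; rewrite -rmorphM; apply/pi_eq0.
Qed.

Lemma presents_zero_moore r a : subq_rank (@mooreZ A r) (fun v => v = 0) a ->
  polygon_cohomology A r.+2 0 \simeq 'rV[int]_a.
Proof.
move=> ha; have := moore_free Pm Ps pi_surj pi_ker _ ha.
by apply; exact: presents_polygon0.
Qed.

Lemma rank_moore r : exists2 a : nat, subq_rank (@mooreZ A r) (fun v => v = 0) a &
  a%:Z = ((size p).-1%:Z - 1) ^+ r.+2 + (-1) ^+ r.+2 * ((size p).-1%:Z - 1)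
    + (if odd r then g%:Z else 0).
Proof.
have ra : subq_rank (fun _ : {poly int} => True) (fun b => exists l, pi b = pi P^`() * pi l) g.
  by apply: subq_rank_ext (rank_quotient p_size) => // b; apply: iff_sym; exact: jacobianE.
have rb : subq_rank (fun b : {poly int} => pi (P^`() * b) = 0) (fun b => pi b = 0) g.
  by apply: subq_rank_ext (rank_annihilator p_size p_lead) => b; apply: iff_sym;
    [exact: annihilatorE|exact: pi_eq0].
by have := rank_mooreZ Pm Ps pi_surj pi_ker ra rb r; rewrite size_monic_assoc.
Qed.

End PolynomialQuotient.

(** * The case p = x^(m+1) *)

Section Monomial.
Variable m : nat.
Local Notation Xm := ('X^(m.+1) : {poly int}).

Lemma size_Xm : (1 < size Xm)%N.
Proof. by rewrite size_polyXn. Qed.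

Lemma lead_Xm : lead_coef Xm = 1 \/ lead_coef Xm = -1.
Proof. by left; apply/eqP; rewrite -monicE monicXn. Qed.

Lemma principal_Xm (b : {poly int}) : principal Xm b <-> forall i, (i < m.+1)%N -> b`_i = 0.
Proof.
split=> [[u ->] i im|h]; first by rewrite coefMXn im.
exists (\poly_(i < size b) b`_(m.+1 + i)); apply/polyP => i; rewrite coefMXn.
case: ltnP => im; first exact: h.
rewrite coef_poly subnKC //; case: ltnP => // ib.
by rewrite nth_default // (leq_trans ib) // leq_subr.
Qed.

Lemma deriv_Xm : Xm^`() = m.+1%:R *: 'X^m.
Proof. by rewrite derivXn scaler_nat. Qed.

Lemma annihilator_Xm (b : {poly int}) : annihilator Xm b <-> b`_0 = 0.
Proof.
rewrite /annihilator deriv_Xm -/(principal _ _) principal_Xm; split=> [/(_ m (ltnSn m))|b0 i im].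
  rewrite -scalerAl coefZ coefXnM ltnn subnn => /eqP.
  by rewrite mulf_eq0 => /orP[/eqP|/eqP //]; lia.
rewrite -scalerAl coefZ coefXnM; case: ltnP => mi; first by rewrite mulr0.
have -> : (i - m = 0)%N by lia.
by rewrite b0 mulr0.
Qed.

(** Modulo X^(m+1), a multiple of (m+1) X^m depends only on the constant term of the cofactor. *)
Lemma jacobian_Xm (b : {poly int}) : jacobian Xm b <->
  (forall i, (i < m)%N -> b`_i = 0) /\ (m.+1 %| b`_m)%Z.
Proof.
rewrite /jacobian deriv_Xm; split=> [[u [l ->]]|[h /dvdzP[q hq]]].
  split=> [i im|]; rewrite -scalerAr coefD coefZ !coefMXn.
    by rewrite im ltnS (ltnW im) mulr0 addr0.
  by rewrite ltnSn ltnn subnn add0r dvdz_mulr // natz.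
have [u hu] : principal Xm (b - (q *: 'X^m) * m.+1%:R).
  apply/principal_Xm => i; rewrite ltnS leq_eqVlt coefB mulr_natr coefMn coefZ coefXn =>
    /orP[/eqP->|im].
    by rewrite eqxx mulr1 hq -mulr_natr natz subrr.
  by rewrite ltn_eqF // mulr0 mul0rn subr0 h.
exists u, q%:P; rewrite -hu.
have -> : q%:P * (m.+1%:R *: 'X^m) = (q *: 'X^m) * m.+1%:R.
  by rewrite -scalerAr mul_polyC scaler_nat mulr_natr.
by rewrite subrK.
Qed.

Lemma presents_rV : presents 'rV[int]_m.+1 (fun=> True) (principal Xm).
Proof.
exists (fun b : {poly int} => \row_(i < m.+1) b`_i); split=> [x y _ _|v|b _].
- by apply/rowP => i; rewrite !mxE coefB.
- exists (\poly_(i < m.+1) v 0 (inord i)) => //.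
  by apply/rowP => i; rewrite mxE coef_poly ltn_ord inord_val.
- rewrite principal_Xm; split=> [/rowP h i im|h].
    by have := h (Ordinal im); rewrite !mxE.
  by apply/rowP => i; rewrite !mxE h.
Qed.

Lemma presents_annihilator_rV : presents 'rV[int]_m (annihilator Xm) (principal Xm).
Proof.
exists (fun b : {poly int} => \row_(i < m) b`_i.+1); split=> [x y _ _|v|b /annihilator_Xm b0].
- by apply/rowP => i; rewrite !mxE coefB.
- exists (\poly_(i < m.+1) if i is j.+1 then oapp (v 0) 0 (insub j) else 0).
    by apply/annihilator_Xm; rewrite coef_poly.
  by apply/rowP => i; rewrite mxE coef_poly ltnS ltn_ord valK.
- rewrite principal_Xm; split=> [/rowP h [|i] im|h]; rewrite ?b0 //.
    by have := h (Ordinal (im : (i < m)%N)); rewrite !mxE.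
  by apply/rowP => i; rewrite !mxE h // ltnS.
Qed.

Lemma Zp1_muln k : (Zp1 : 'I_m.+1) *+ k = inZp k.
Proof. by rewrite Zp_mulrn; apply: val_inj => /=; rewrite modnMml mul1n. Qed.

Lemma Zp1_intmul (z : int) : (Zp1 : 'I_m.+1) *~ z = 0 <-> (m.+1 %| z)%Z.
Proof.
have nat_case k : (Zp1 : 'I_m.+1) *+ k = 0 <-> (m.+1 %| k)%N.
  rewrite Zp1_muln; split=> [/(congr1 val) /= e|/eqP e]; last exact: val_inj.
  exact/eqP.
case: z => k; first exact: nat_case.
rewrite NegzE mulrNz dvdzE abszN; split=> [/eqP|/nat_case h].
  by rewrite oppr_eq0 => /eqP/nat_case.
by apply/eqP; rewrite oppr_eq0; apply/eqP.
Qed.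

(** The coefficients below m survive freely, the one at m survives modulo m + 1, and the higher ones
    vanish. The type ['I_m.+1] is cyclic of order m + 1 also for m = 0, where it is trivial. *)
Lemma presents_jacobian_prod :
  presents ('I_m.+1 * 'rV[int]_m)%type (fun=> True) (jacobian Xm).
Proof.
exists (fun b : {poly int} => ((Zp1 : 'I_m.+1) *~ b`_m, \row_(i < m) b`_i)).
split=> [x y _ _|[k v]|b _].
- by congr pair; [rewrite coefB mulrzBr|apply/rowP => i; rewrite !mxE coefB].
- exists (\poly_(i < m.+1) if (i < m)%N then oapp (v 0) 0 (insub i) else (k : nat)%:Z) => //.
  congr pair; last by apply/rowP => i; rewrite mxE coef_poly ltnS ltnW ltn_ord // valK.
  rewrite coef_poly ltnSn ltnn -[_ *~ _]/((Zp1 : 'I_m.+1) *+ k) Zp1_muln.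
  exact: valZpK.
- rewrite jacobian_Xm; split=> [[/Zp1_intmul hm /rowP h]|[h hm]].
    by split=> // i im; have := h (Ordinal im); rewrite !mxE.
  congr pair; first exact/Zp1_intmul.
  by apply/rowP => i; rewrite !mxE h.
Qed.

End Monomial.

(** * Cohomology and Euler characteristic of polygons *)

Section Polygons.
Variable p : {poly int}.
Hypotheses (p_size : (1 < size p)%N) (p_lead : lead_coef p = 1 \/ lead_coef p = -1).
Local Notation A := (poly_quot p).
Local Notation g := (size (gcdp (map_poly intr p : {poly rat}) (map_poly intr p)^`())).-1.

(** Degree k of the n-gon, for 0 < k < n - 1, involves tensors with n - k factors; an even number of
    factors leads to Z[x]/(p,p'), an odd number to the annihilator of p'. *)
Lemma polygon_jacobian n i : (1 <= i)%N -> (2 * i <= n - 1)%N ->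
  presents (polygon_cohomology A n (n - 2 * i)) (fun=> True) (jacobian p).
Proof.
case: n i => [|n] [|i] // _ hi.
have hr : (i.*2.+2 <= n)%N by lia.
have -> : (n.+1 - 2 * i.+1 = (n - i.*2.+2).+1)%N by lia.
apply: (@presents_moore_jacobian p p_size p_lead _ i.*2); first by rewrite odd_double.
exact: presents_polygon_moore.
Qed.

Lemma polygon_annihilator n i : (1 <= i)%N -> (2 * i <= n - 2)%N ->
  presents (polygon_cohomology A n (n - 2 * i - 1)) (annihilator p) (principal p).
Proof.
case: n i => [|n] [|i] // _ hi.
have hr : (i.*2.+3 <= n)%N by lia.
have -> : (n.+1 - 2 * i.+1 - 1 = (n - i.*2.+3).+1)%N by lia.
apply: (@presents_moore_annihilator p p_size p_lead _ i.*2.+1); first by rewrite /= odd_double.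
exact: presents_polygon_moore.
Qed.

Lemma jacobian_rank (G : zmodType) : presents G (fun=> True) (jacobian p) -> has_rank G g.
Proof. by move/presents_has_rank => h; apply: h => //; exact: rank_quotient. Qed.

Lemma annihilator_rank (G : zmodType) :
  presents G (annihilator p) (principal p) -> has_rank G g.
Proof.
move/presents_has_rank => h; apply: h; first exact: annihilator_subg.
exact: rank_annihilator.
Qed.

Lemma polygon_rank n k : (0 < k)%N -> (k < n - 1)%N -> has_rank (polygon_cohomology A n k) g.
Proof.
move=> k0 kn; have [o|o] := boolP (odd (n - k)).
  have e : (n - k = 2 * ((n - k) %/ 2) + 1)%N by rewrite {1}(divn_eq (n - k) 2) modn2 o mulnC.
  have -> : (k = n - 2 * ((n - k) %/ 2) - 1)%N by lia.
  by apply: annihilator_rank; apply: polygon_annihilator; lia.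
have e : (n - k = 2 * ((n - k) %/ 2))%N by rewrite {1}(divn_eq (n - k) 2) modn2 (negPf o) addn0
  mulnC.
have -> : (k = n - 2 * ((n - k) %/ 2))%N by lia.
by apply: jacobian_rank; apply: polygon_jacobian; lia.
Qed.

Lemma polygon_top n k : (2 <= n)%N -> (n - 1 <= k)%N -> forall x : polygon_cohomology A n k, x = 0.
Proof.
case: n => [|n] // n1; case: k => [|k] hk x; first by lia.
by apply: polygon_vanish; lia.
Qed.

Lemma trivial_rank (G : zmodType) : (forall x : G, x = 0) -> has_rank G 0.
Proof.
move=> G0; apply: has_rankP; exists 'I_0, (fun=> 0); split=> [||c _ []|x _] //.
  exact: card_ord.
by exists 1 => //; exists (fun=> 0).
Qed.

Lemma polygon_zero r : exists2 N : nat, polygon_cohomology A r.+2 0 \simeq 'rV[int]_N &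
  N%:Z = ((size p).-1%:Z - 1) ^+ r.+2 + (-1) ^+ r.+2 * ((size p).-1%:Z - 1)
    + (if odd r then g%:Z else 0).
Proof.
have [a ha ea] := rank_moore p_size p_lead r; exists a => //.
exact: presents_zero_moore.
Qed.

Lemma alternating_ones r : \sum_(i < r) (-1) ^+ i.+1 = - (odd r : nat)%:Z :> int.
Proof.
elim: r => [|r IH]; first by rewrite big_ord0 oppr0.
by rewrite big_ord_recr IH /= exprS -signr_odd; case: (odd r).
Qed.

(** The groups in degrees 1, .., r all have rank g and cancel in pairs, except for one term -g when
    r is odd. *)
Lemma polygon_euler r N : polygon_cohomology A r.+2 0 \simeq 'rV[int]_N ->
  exists rk : nat -> nat, (forall i, has_rank (polygon_cohomology A r.+2 i) (rk i)) /\
    \sum_(i < r.+3) (-1) ^+ i * (rk i)%:Z = N%:Z - (if odd r then g%:Z else 0).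
Proof.
move=> isoN; exists (fun i => if i == 0%N then N else if (i < r.+1)%N then g else 0%N).
split=> [[|i] /=|].
- have hp := presents_of_iso (presents_self _) (zmod_iso_sym isoN).
  exact: (presents_has_rank (truth_subg _) hp (row_vector_rank N)).
- case: ltnP => ir; first by apply: (@polygon_rank r.+2 i.+1); lia.
  by apply: trivial_rank; apply: (@polygon_top r.+2 i.+1); lia.
- rewrite big_ord_recl expr0 mul1r /= !big_ord_recr /= /bump /= !add1n !ltnn ltnNge leqnSn.
  rewrite !mulr0 !addr0; congr (_ + _).
  rewrite (eq_bigr (fun i : 'I_r => (-1) ^+ i.+1 * g%:Z)) => [|i _]; last first.
    by rewrite ltnS ltn_ord.
  by rewrite -mulr_suml alternating_ones; case: (odd r); rewrite ?mulN1r ?oppr0 ?mul0r.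
Qed.

End Polygons.

Theorem theorem4p6 :
  (forall p : {poly int}, (1 < size p)%N -> lead_coef p = 1 \/ lead_coef p = -1 ->
     let A := poly_quot p in
     let pQ : {poly rat} := map_poly intr p in
     let g := (size (gcdp pQ pQ^`())).-1 in
     forall i : nat,
       (odd i -> HH A i \simeq ring_quot [:: p; p^`()] /\ has_rank (HH A i) g) /\
       (~~ odd i -> (2 <= i)%N -> HH A i \simeq deriv_ann p /\ has_rank (HH A i) g))
  /\
  (forall m : nat,
     let A := poly_quot 'X^(m.+1) in
     (forall i : nat, odd i -> HH A i \simeq ('I_m.+1 * 'rV[int]_m)%type) /\
     (forall i : nat, ~~ odd i -> (2 <= i)%N -> HH A i \simeq 'rV[int]_m) /\
     HH A 0 \simeq A /\ A \simeq 'rV[int]_m.+1)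
  /\
  (forall p : {poly int}, (1 < size p)%N -> lead_coef p = 1 \/ lead_coef p = -1 ->
     forall n : nat, (2 <= n)%N ->
     let A := poly_quot p in
     let p' : A := rclass [:: p] p^`() in
     let H := polygon_cohomology A n in
     let d := (size p).-1 in
     let chi : int := (d%:Z - 1) ^+ n + (-1) ^+ n * (d%:Z - 1) in
     (forall i : nat, (1 <= i)%N -> (2 * i <= n - 1)%N ->
        H (n - 2 * i)%N \simeq ring_quot [:: p']) /\
     (forall i : nat, (1 <= i)%N -> (2 * i <= n - 2)%N ->
        H (n - 2 * i - 1)%N \simeq ker (p' \*o @idfun A)) /\
     (forall k : nat, (n - 1 <= k)%N -> forall x : H k, x = 0) /\
     (~~ odd n -> exists N : nat, N%:Z = chi /\ H 0%N \simeq 'rV[int]_N) /\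
     (odd n -> exists N r : nat,
        [/\ has_rank (H 1%N) r, N%:Z = chi + r%:Z & H 0%N \simeq 'rV[int]_N]) /\
     (exists r : nat -> nat, (forall i, has_rank (H i) (r i)) /\
        \sum_(i < n.+1) (-1) ^+ i * (r i)%:Z = chi)).
Proof.
split; [|split].
- move=> p ps pl A pQ g i; split=> [io|ie i2].
    have hp := HH_odd ps pl io; split; last exact: (jacobian_rank ps hp).
    exact: (presents_iso (truth_subg _) hp (presents_ideal_quot p)).
  have hp := HH_even ps pl ie i2; split; last exact: (annihilator_rank ps pl hp).
  exact: (presents_iso (annihilator_subg p) hp (presents_deriv_ann p)).
- move=> m A; have ps := size_Xm m; have pl := lead_Xm m; split; [|split; [|split]].
  + move=> i io; exact: (presents_iso (truth_subg _) (HH_odd ps pl io) (presents_jacobian_prod m)).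
  + move=> i ie i2; exact: (presents_iso (annihilator_subg _) (HH_even ps pl ie i2)
      (presents_annihilator_rV m)).
  + exact: (HH0_iso (@pi_surj 'X^(m.+1))).
  + apply: (presents_iso (truth_subg _) _ (presents_rV m)).
    by apply: presents_ext (presents_onto (@pi_surj 'X^(m.+1))) => // b _; exact: pi_eq0.
- move=> p ps pl [|[|r]] // n2 A p' H d chi.
  have [N isoN eN] := polygon_zero ps pl r.
  split; [|split; [|split; [|split; [|split]]]].
  + move=> i i1 hi; exact: (presents_iso (truth_subg _) (polygon_jacobian ps pl i1 hi)
      (presents_quot_quot p)).
  + move=> i i1 hi; exact: (presents_iso (annihilator_subg p) (polygon_annihilator ps pl i1 hi)
      (presents_kernel p)).
  + move=> k hk; exact: polygon_top.
  + rewrite /= negbK => re; exists N; split=> //; rewrite eN ifN ?addr0 //.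
  + move=> ro; exists N, (size (gcdp (map_poly intr p : {poly rat}) (map_poly intr p)^`())).-1.
    move: ro; rewrite /= negbK => ro; split=> //; last by rewrite eN ro.
    (* An odd n is at least 3, so degree 1 lies in the range where the rank is that of the gcd. *)
    have r0 : (0 < r)%N by move: ro; case: (r).
    by apply: (@polygon_rank p ps pl r.+2 1); lia.
  + have [rk [hrk erk]] := polygon_euler ps pl isoN; exists rk; split=> //.
    by rewrite erk eN addrK.
Qed.
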